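(* For fixed $a$ and $\lambda \rightarrow \infty$ with $|\arg(\lambda)| \leq \frac{3}{4}\pi - \delta$ \[ L_{U}(a,\lambda) \sim\frac{U(a,0)}{\lambda}\sum_{ s=0}^{\infty} \frac{\alpha_{s}(a)}{\lambda^{2s}}+\frac{U'(a,0)}{\lambda^{2}}\sum_{ s=0}^{\infty} \frac{\beta_{s}(a)}{\lambda^{2s}}, \] where $\alpha_{0}(a)=\beta_{0}(a)=1$, $\alpha_{1}(a)=\beta_{1}(a)=a$, and for $ s=0,1,2,\ldots$ \[ \alpha_{s+2}=a\alpha_{s+1}+\tfrac{1}{2}(s+1)(2s+1)\alpha_{s},\qquad \beta_{s+2}=a\beta_{s+1}+\tfrac{1}{2}(s+1)(2s+3)\beta_{s}, \] \[ U(a,0)=\frac{\sqrt{\pi}}{2^{\frac{1}{2}a+\frac{1}{4}}\Gamma\left(\frac{1}{2}a+\frac{3}{4}\right)},\qquad U'(a,0)=-\frac{\sqrt{\pi}}{2^{\frac{1}{2}a-\frac{1}{4}}\Gamma\left(\frac{1}{2}a+\frac{1}{4}\right)}. \]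
   Context: $U(a,z)$ is the standard parabolic cylinder function, the solution of $y''-(\tfrac14 z^2+a)y=0$ with $U(a,z)\sim z^{-a-1/2}e^{-z^2/4}$ as $z\to\infty$, $|\arg z|\le\tfrac34\pi-\delta$. $L_{U}(a,\lambda)=\int_{0}^{\infty} e^{-\lambda t} U(a,t)dt$ (entire in $\lambda$). $\delta$ denotes an arbitrary small positive constant. *)

(* Defs.v *)
From Stdlib Require Import Reals Factorial.
From Coquelicot Require Import Coquelicot.
Open Scope R_scope.

Definition Cexp (w : C) : C :=
  (exp (Re w) * cos (Im w), exp (Re w) * sin (Im w)).

Definition Rcpow (b : R) (w : C) : C := Cexp (w * RtoC (ln b))%C.

(* Reciprocal Gamma function (entire), via Gauss's product formula:
   1/Gamma(w) = lim_{n->oo} w (w+1) ... (w+n) / (n! n^w). *)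
Fixpoint rising_prod (w : C) (n : nat) : C :=
  match n with
  | O => w
  | S m => (rising_prod w m * (w + RtoC (INR (S m))))%C
  end.

Definition rgamma (w : C) : C :=
  @lim (CompleteNormedModule.CompleteSpace _ C_CompleteNormedModule) (filtermap (fun n : nat =>
         (rising_prod w n / (RtoC (INR (fact n)) * Rcpow (INR n) w))%C)
       eventually).

(* U is (the restriction to the real line of) the parabolic cylinder
   function U(a,.), with derivative U': it solves y'' = (t^2/4 + a) y on R
   and U(t) ~ t^(-a-1/2) e^(-t^2/4) as t -> +oo. *)
Definition is_PCU (a : C) (U U' : R -> C) : Prop :=
  (forall t : R, is_derive U t (U' t)) /\
  (forall t : R, is_derive U' t ((RtoC (t ^ 2 / 4) + a) * U t)%C) /\
  filterlim (fun t : R => (U t * Cexp ((a + RtoC (1/2)) * RtoC (ln t)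
                                       + RtoC (t ^ 2 / 4)))%C)
            (Rbar_locally p_infty) (locally (RtoC 1)).

Definition LU (U : R -> C) (lam : C) : C :=
  @RInt_gen C_R_CompleteNormedModule (fun t : R => (Cexp (- (lam * RtoC t)) * U t)%C)
           (at_point 0) (Rbar_locally p_infty).

Fixpoint alpha_beta (c : R) (a : C) (s : nat) : C * C :=
  (* returns (gamma_s, gamma_{s+1}) for the recurrence
     g_{s+2} = a g_{s+1} + 1/2 (s+1)(2s+c) g_s, g_0 = 1, g_1 = a *)
  match s with
  | O => (RtoC 1, a)
  | S m => let (g0, g1) := alpha_beta c a m in
           (g1, (a * g1 + RtoC (/2 * INR (S m) * (2 * INR m + c)) * g0)%C)
  end.

Definition alpha (a : C) (s : nat) : C := fst (alpha_beta 1 a s).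
Definition beta (a : C) (s : nat) : C := fst (alpha_beta 3 a s).

Definition in_sector (theta0 : R) (lam : C) : Prop :=
  lam <> RtoC 0 /\
  exists th : R, Rabs th <= theta0 /\
    lam = (Cmod lam * cos th, Cmod lam * sin th).

Fixpoint csum (f : nat -> C) (N : nat) : C :=
  match N with
  | O => RtoC 0
  | S m => (csum f m + f m)%C
  end.

Definition LU_trunc (a U0 U1 lam : C) (N : nat) : C :=
  (U0 / lam * csum (fun s => alpha a s / Cpow lam (2 * s)) N
   + U1 / Cpow lam 2 * csum (fun s => beta a s / Cpow lam (2 * s)) N)%C.

(* Main.v *)
(* The values at [0]: multiply [U] by an explicit growing solution [u] of the same equation, a
   Gaussian times a Kummer series in [t^2/2]. The Wronskian of [U] and [u] is constant, equal to
   [U 0] or [- U' 0] up to the choice of [u], and its value at infinity is read off the growth of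
   [u]. That growth is an Abelian theorem: the Taylor coefficients of the Kummer series are
   asymptotic to a power of [n] by Gauss's product formula for [1/Gamma], and the Poisson
   distribution of large mean concentrates.

   The expansion: integrating by parts gives the truncated series plus [lam^(-2N)] times the
   Laplace transform [S] of the derivative of order [2N] of [U], for every [lam <> 0]. For
   [Re lam >= 0] this [S] is bounded. It satisfies a second-order equation in [lam] whose solutions
   behave like [exp (lam^2)] and [exp (- lam^2)]; on the hyperbolas where [Re (lam^2)] is a negative
   constant both factors have constant modulus. Such a hyperbola joins each point of the rest of the
   sector to its mirror image in the right half-plane, so an energy estimate along it bounds [S] by
   [K |lam|], which suffices after going one step further in the expansion. *)
Require Import Defs.
From Stdlib Require Import Reals Factorial Lra Lia.
From Coquelicot Require Import Coquelicot.
Open Scope R_scope.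

(** * Complex-valued functions of a real variable *)

(** [is_PCU] describes [U] on the real line only, by its equation and its behaviour at [+oo].
    Turning the ray of integration, the classical way past [|arg lam| = pi/2], would need [U] in
    complex directions, so the continuation is done in the [lam]-plane. There the differential
    equation survives: multiplication by [t] becomes [- d/dlam] and [d/dt] becomes [lam] up to
    boundary values, so [y'' = (t^2/4 + a) y] turns into [S'' = 4 lam^2 S] plus lower-order terms,
    the source of the exponents [lam^2] and [- lam^2]. The chosen hyperbolas have the rays
    [|arg lam| = pi/4] and [|arg lam| = 3 pi/4] as asymptotes; this is where the opening of the
    sector comes from, and the margin [delta] keeps the hyperbolic parameter bounded, hence the
    Gronwall factor uniform. A boundary value multiplied by [lam] explains why the energy estimate
    yields [K |lam|] and not [K]. Gamma enters only through Gauss's limit: a Kummer coefficient is a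
    quotient of two Gauss products, and the normalizing value [1/Gamma(1/2)] comes from Wallis's
    integrals. *)

Lemma Ceq (z w : C) : Re z = Re w -> Im z = Im w -> z = w.
Proof. destruct z, w; unfold Re, Im; simpl; intros; subst; reflexivity. Qed.

Lemma RtoC_neq_0 (x : R) : x <> 0 -> RtoC x <> 0.
Proof. intros H E. apply H. now inversion E. Qed.

Lemma Cmod_le_Re_Im (z : C) : Cmod z <= Rabs (Re z) + Rabs (Im z).
Proof.
  replace z with (RtoC (Re z) + (0, Im z))%C at 1
    by (apply Ceq; simpl; ring).
  eapply Rle_trans; [apply Cmod_triangle|].
  rewrite Cmod_R.
  apply Rplus_le_compat_l. unfold Cmod; simpl.
  rewrite <- sqrt_Rsqr_abs. apply Req_le. f_equal. unfold Rsqr; ring.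
Qed.

Lemma Im_le_Cmod (z : C) : Rabs (Im z) <= Cmod z.
Proof.
  eapply Rle_trans; [apply Rmax_r | apply Rmax_Cmod].
Qed.

Lemma is_derive_eq (f : R -> R) (t l l' : R) : is_derive f t l -> l = l' -> is_derive f t l'.
Proof. intros H ->; exact H. Qed.

Lemma is_derive_Ceq (f : R -> C) (t : R) (l l' : C) : is_derive f t l -> l = l' -> is_derive f t l'.
Proof. intros H ->; exact H. Qed.

Lemma is_derive_C (f : R -> C) (t : R) (l : C) :
  is_derive (fun t => Re (f t)) t (Re l) ->
  is_derive (fun t => Im (f t)) t (Im l) -> is_derive f t l.
Proof.
  intros H1 H2.
  apply is_derive_ext with
    (fun t => plus (scal (Re (f t)) (1, 0)) (scal (Im (f t)) (0, 1)) : C).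
  { intros u. apply Ceq; cbn; ring. }
  eapply is_derive_Ceq.
  { apply (@is_derive_plus R_AbsRing C_R_NormedModule).
    - apply (@is_derive_scal_l R_AbsRing C_R_NormedModule _ _ _ ((1,0):C) H1).
    - apply (@is_derive_scal_l R_AbsRing C_R_NormedModule _ _ _ ((0,1):C) H2). }
  apply Ceq; cbn; ring.
Qed.

Lemma is_derive_Re (f : R -> C) (t : R) (l : C) :
  is_derive f t l -> is_derive (fun t => Re (f t)) t (Re l).
Proof.
  intros H.
  exact (filterdiff_comp' f (@fst R R) t _ (@fst R R) H (filterdiff_linear _ is_linear_fst)).
Qed.

Lemma is_derive_Im (f : R -> C) (t : R) (l : C) :
  is_derive f t l -> is_derive (fun t => Im (f t)) t (Im l).
Proof.
  intros H.
  exact (filterdiff_comp' f (@snd R R) t _ (@snd R R) H (filterdiff_linear _ is_linear_snd)).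
Qed.

Lemma is_derive_Cconst (z : C) (t : R) : is_derive (fun _ : R => z) t (RtoC 0).
Proof. apply is_derive_C; simpl; apply @is_derive_const. Qed.

Lemma is_derive_RtoC (f : R -> R) (t l : R) :
  is_derive f t l -> is_derive (fun t => RtoC (f t)) t (RtoC l).
Proof. intros H; apply is_derive_C; simpl; [exact H | apply @is_derive_const]. Qed.

Lemma is_derive_Cplus (f g : R -> C) (t : R) (l m : C) :
  is_derive f t l -> is_derive g t m -> is_derive (fun t => f t + g t)%C t (l + m)%C.
Proof. apply @is_derive_plus. Qed.

Lemma is_derive_Copp (f : R -> C) (t : R) (l : C) :
  is_derive f t l -> is_derive (fun t => - f t)%C t (- l)%C.
Proof. apply @is_derive_opp. Qed.

Lemma is_derive_Cminus (f g : R -> C) (t : R) (l m : C) :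
  is_derive f t l -> is_derive g t m -> is_derive (fun t => f t - g t)%C t (l - m)%C.
Proof. intros; apply is_derive_Cplus; [|apply is_derive_Copp]; assumption. Qed.

Lemma is_derive_Cmult (f g : R -> C) (t : R) (l m : C) :
  is_derive f t l -> is_derive g t m ->
  is_derive (fun t => f t * g t)%C t (l * g t + f t * m)%C.
Proof.
  intros Hf Hg.
  pose proof (is_derive_Re _ _ _ Hf) as Hf1. pose proof (is_derive_Im _ _ _ Hf) as Hf2.
  pose proof (is_derive_Re _ _ _ Hg) as Hg1. pose proof (is_derive_Im _ _ _ Hg) as Hg2.
  apply is_derive_C; simpl.
  - eapply is_derive_eq.
    + apply @is_derive_minus; apply Derive.is_derive_mult; eassumption.
    + cbn. unfold Re, Im. ring.
  - eapply is_derive_eq.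
    + apply @is_derive_plus; apply Derive.is_derive_mult; eassumption.
    + cbn. unfold Re, Im. ring.
Qed.

Lemma is_derive_Ccomp (f : R -> C) (g : R -> R) (t l : R) (m : C) :
  is_derive f (g t) m -> is_derive g t l ->
  is_derive (fun t => f (g t)) t (RtoC l * m)%C.
Proof.
  intros Hf Hg. eapply is_derive_Ceq.
  - apply (@is_derive_comp _ C_R_NormedModule); eassumption.
  - rewrite scal_R_Cmult. reflexivity.
Qed.

Lemma Cexp_plus (z w : C) : Cexp (z + w) = (Cexp z * Cexp w)%C.
Proof.
  unfold Cexp. apply Ceq; simpl; unfold Re, Im; rewrite exp_plus, ?cos_plus, ?sin_plus; ring.
Qed.

Lemma Cexp_0 : Cexp 0 = 1.
Proof. unfold Cexp. apply Ceq; simpl; rewrite exp_0, ?cos_0, ?sin_0; ring. Qed.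

Lemma Cexp_RtoC (x : R) : Cexp x = exp x.
Proof. unfold Cexp. apply Ceq; simpl; rewrite ?cos_0, ?sin_0; ring. Qed.

Lemma Cmod_Cexp (z : C) : Cmod (Cexp z) = exp (Re z).
Proof.
  unfold Cmod, Cexp; cbn [fst snd].
  replace (_ + _) with ((exp (Re z))²).
  - apply sqrt_Rsqr. left; apply exp_pos.
  - pose proof (sin2_cos2 (Im z)) as H. unfold Rsqr in *.
    replace (_ + _) with (exp (Re z) * exp (Re z) * (sin (Im z) * sin (Im z) + cos (Im z) * cos (Im z))) by ring.
    rewrite H; ring.
Qed.

Lemma Cexp_neq_0 (z : C) : Cexp z <> 0.
Proof. apply Cmod_gt_0. rewrite Cmod_Cexp. apply exp_pos. Qed.

Lemma Cexp_opp (z : C) : Cexp (- z) = (/ Cexp z)%C.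
Proof.
  assert (H : (Cexp z * Cexp (- z) = 1)%C).
  { rewrite <- Cexp_plus, Cplus_opp_r. apply Cexp_0. }
  replace (Cexp (- z)) with (Cexp z * Cexp (- z) / Cexp z)%C by (field; apply Cexp_neq_0).
  rewrite H. field. apply Cexp_neq_0.
Qed.

Lemma is_derive_Cexp (f : R -> C) (t : R) (l : C) :
  is_derive f t l -> is_derive (fun t => Cexp (f t)) t (l * Cexp (f t))%C.
Proof.
  intros H.
  pose proof (is_derive_Re _ _ _ H) as H1. pose proof (is_derive_Im _ _ _ H) as H2.
  assert (E : is_derive (fun t => exp (Re (f t))) t (Re l * exp (Re (f t)))).
  { apply (is_derive_comp exp (fun t => Re (f t))); [apply is_derive_exp | exact H1]. }
  assert (Co : is_derive (fun t => cos (Im (f t))) t (Im l * - sin (Im (f t)))).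
  { apply (is_derive_comp cos (fun t => Im (f t))); [apply is_derive_cos | exact H2]. }
  assert (Si : is_derive (fun t => sin (Im (f t))) t (Im l * cos (Im (f t)))).
  { apply (is_derive_comp sin (fun t => Im (f t))); [apply is_derive_sin | exact H2]. }
  apply is_derive_C; simpl.
  - eapply is_derive_eq; [apply Derive.is_derive_mult; eassumption|]. cbn. unfold Re, Im. ring.
  - eapply is_derive_eq; [apply Derive.is_derive_mult; eassumption|]. cbn. unfold Re, Im. ring.
Qed.

(* The factor 2 is not optimal; it comes from treating real and imaginary parts separately. *)
Lemma C_bounded_variation (f df : R -> C) (D x y : R) :
  (forall t, Rmin x y <= t <= Rmax x y -> is_derive f t (df t) /\ Cmod (df t) <= D) ->
  Cmod (f y - f x)%C <= 2 * D * Rabs (y - x).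
Proof.
  intros H.
  assert (MV : forall p : C -> R,
    (forall (g : R -> C) (t : R) (l : C), is_derive g t l -> is_derive (fun t : R => p (g t)) t (p l)) ->
    (forall z, Rabs (p z) <= Cmod z) -> Rabs (p (f y) - p (f x)) <= D * Rabs (y - x)).
  { intros p Hd Hp.
    destruct (MVT_gen (fun t => p (f t)) x y (fun t => p (df t))) as [c [Hc ->]].
    - intros t Ht. apply Hd, H. lra.
    - intros t Ht. apply continuity_pt_filterlim.
      apply (ex_derive_continuous (fun t => p (f t))). eexists. apply Hd, H, Ht.
    - rewrite Rabs_mult. apply Rmult_le_compat_r; [apply Rabs_pos|].
      eapply Rle_trans; [apply Hp | apply H, Hc]. }
  pose proof (MV Re is_derive_Re re_le_Cmod).
  pose proof (MV Im is_derive_Im Im_le_Cmod).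
  eapply Rle_trans; [apply Cmod_le_Re_Im|].
  replace (Re (f y - f x)) with (Re (f y) - Re (f x)) by reflexivity.
  replace (Im (f y - f x)) with (Im (f y) - Im (f x)) by reflexivity.
  lra.
Qed.

Lemma C_constant (f : R -> C) (x y : R) :
  (forall t, is_derive f t (RtoC 0)) -> f x = f y.
Proof.
  intros H. symmetry. apply Ceq_minus, Cmod_eq_0, Rle_antisym; [|apply Cmod_ge_0].
  replace 0 with (2 * 0 * Rabs (y - x)) by ring.
  apply (C_bounded_variation f (fun _ => RtoC 0)).
  intros t _; split; [apply H | rewrite Cmod_0; lra].
Qed.

(** * Limits of complex-valued functions along a filter, in epsilon form *)

Definition Ctends {T : Type} (F : (T -> Prop) -> Prop) (f : T -> C) (l : C) : Prop :=
  forall eps, 0 < eps -> F (fun x => Cmod (f x - l)%C <= eps).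

Section Ctends.
Context {T : Type} {F : (T -> Prop) -> Prop} {FF : Filter F}.

Lemma Ctends_filterlim (f : T -> C) (l : C) :
  filterlim f F (locally l) <-> Ctends F f l.
Proof.
  split.
  - intros H eps He.
    rewrite (@filterlim_locally_ball_norm C_AbsRing T C_NormedModule F _ f l) in H.
    generalize (H (mkposreal eps He)). apply filter_imp.
    intros x Hx. left. unfold ball_norm in Hx. exact Hx.
  - intros H.
    apply (@filterlim_locally_ball_norm C_AbsRing T C_NormedModule F _ f l).
    intros [eps He].
    generalize (H (eps / 2) ltac:(lra)). apply filter_imp.
    intros x Hx. unfold ball_norm. simpl.
    change (Cmod (f x - l) < eps). lra.
Qed.

Lemma Ctends_ext_loc (f g : T -> C) (l : C) :
  F (fun x => f x = g x) -> Ctends F f l -> Ctends F g l.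
Proof.
  intros H Hf eps He. generalize (filter_and _ _ H (Hf eps He)). apply filter_imp.
  intros x [<- Hx]; exact Hx.
Qed.

Lemma Ctends_ext (f g : T -> C) (l : C) :
  (forall x, f x = g x) -> Ctends F f l -> Ctends F g l.
Proof. intros H; apply Ctends_ext_loc, filter_forall, H. Qed.

Lemma Ctends_const (z : C) : Ctends F (fun _ => z) z.
Proof.
  intros eps He. apply filter_forall. intros _.
  replace (z - z)%C with (RtoC 0) by ring. rewrite Cmod_0; lra.
Qed.

Lemma Ctends_plus (f g : T -> C) (l m : C) :
  Ctends F f l -> Ctends F g m -> Ctends F (fun x => f x + g x)%C (l + m)%C.
Proof.
  intros Hf Hg eps He.
  assert (He2 : 0 < eps / 2) by lra.
  generalize (filter_and _ _ (Hf _ He2) (Hg _ He2)).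
  apply filter_imp. intros x [H1 H2].
  replace (f x + g x - (l + m))%C with ((f x - l) + (g x - m))%C by ring.
  eapply Rle_trans; [apply Cmod_triangle | lra].
Qed.

Lemma Ctends_bounded (f : T -> C) (l : C) :
  Ctends F f l -> F (fun x => Cmod (f x) <= Cmod l + 1).
Proof.
  intros H. generalize (H 1 Rlt_0_1). apply filter_imp. intros x Hx.
  replace (f x) with (l + (f x - l))%C by ring.
  eapply Rle_trans; [apply Cmod_triangle | lra].
Qed.

Lemma Ctends_0_mult (f g : T -> C) (K : R) :
  Ctends F f 0 -> F (fun x => Cmod (g x) <= K) -> Ctends F (fun x => f x * g x)%C 0.
Proof.
  intros Hf Hg eps He.
  assert (HK : 0 < Rabs K + 1) by (pose proof (Rabs_pos K); lra).
  generalize (filter_and _ _ (Hf _ (Rdiv_lt_0_compat _ _ He HK)) Hg).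
  apply filter_imp. intros x [H1 H2].
  replace (f x * g x - 0)%C with ((f x - 0) * g x)%C by ring. rewrite Cmod_mult.
  replace eps with (eps / (Rabs K + 1) * (Rabs K + 1)) by (field; lra).
  apply Rmult_le_compat; try apply Cmod_ge_0; [exact H1|].
  pose proof (Rle_abs K); lra.
Qed.

Lemma Ctends_0_sub (f : T -> C) (l : C) :
  Ctends F (fun x => f x - l)%C 0 <-> Ctends F f l.
Proof.
  split; intros H eps He; generalize (H eps He); apply filter_imp; intros x;
    replace (f x - l - 0)%C with (f x - l)%C by ring; exact (fun h => h).
Qed.

Lemma Ctends_mult (f g : T -> C) (l m : C) :
  Ctends F f l -> Ctends F g m -> Ctends F (fun x => f x * g x)%C (l * m)%C.
Proof.
  intros Hf Hg. apply Ctends_0_sub.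
  apply Ctends_ext with (fun x => (f x - l) * g x + (g x - m) * l)%C.
  { intros x; ring. }
  replace (RtoC 0) with (0 + 0)%C by ring.
  apply Ctends_plus.
  - apply Ctends_0_mult with (Cmod m + 1); [apply Ctends_0_sub, Hf | apply Ctends_bounded, Hg].
  - apply Ctends_0_mult with (Cmod l); [apply Ctends_0_sub, Hg | apply filter_forall; intros; lra].
Qed.

Lemma Ctends_opp (f : T -> C) (l : C) : Ctends F f l -> Ctends F (fun x => - f x)%C (- l)%C.
Proof.
  intros H eps He. generalize (H eps He). apply filter_imp. intros x Hx.
  replace (- f x - - l)%C with (- (f x - l))%C by ring. rewrite Cmod_opp. exact Hx.
Qed.

Lemma Ctends_inv (f : T -> C) (l : C) :
  l <> 0 -> Ctends F f l -> Ctends F (fun x => / f x)%C (/ l)%C.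
Proof.
  intros Hl Hf. pose proof (proj1 (Cmod_gt_0 l) Hl) as Hp.
  assert (Hb : F (fun x => Cmod l / 2 <= Cmod (f x))).
  { assert (Hp2 : 0 < Cmod l / 2) by lra. generalize (Hf _ Hp2). apply filter_imp. intros x Hx.
    assert (Cmod l <= Cmod (f x) + Cmod (f x - l)); [|lra].
    rewrite <- (Cmod_opp (f x - l)).
    replace l with (f x + - (f x - l))%C at 1 by ring. apply Cmod_triangle. }
  apply Ctends_0_sub.
  apply Ctends_ext_loc with (fun x => (f x - l) * (- / (f x * l)))%C.
  { generalize Hb. apply filter_imp. intros x Hx.
    assert (f x <> 0) by (apply Cmod_gt_0; lra). field; auto. }
  apply Ctends_0_mult with (/ (Cmod l / 2 * Cmod l)); [apply Ctends_0_sub, Hf|].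
  generalize Hb. apply filter_imp. intros x Hx.
  assert (f x <> 0) by (apply Cmod_gt_0; lra).
  rewrite Cmod_opp, Cmod_inv, Cmod_mult by (try apply Cmult_neq_0; auto).
  apply Rinv_le_contravar; [|apply Rmult_le_compat_r; lra].
  apply Rmult_lt_0_compat; lra.
Qed.

Lemma Ctends_squeeze (f : T -> C) (l : C) (g : T -> C) :
  F (fun x => Cmod (f x - l)%C <= Cmod (g x)) -> Ctends F g 0 -> Ctends F f l.
Proof.
  intros H Hg eps He. generalize (filter_and _ _ H (Hg eps He)). apply filter_imp.
  intros x [H1 H2]. replace (g x - 0)%C with (g x) in H2 by ring. lra.
Qed.

End Ctends.

Lemma Ctends_unique {T : Type} (F : (T -> Prop) -> Prop) {FF : ProperFilter F} (f : T -> C) (l m : C) :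
  Ctends F f l -> Ctends F f m -> l = m.
Proof.
  intros Hl Hm. apply Ceq_minus, Cmod_eq_0, Rle_antisym; [|apply Cmod_ge_0].
  apply Rnot_lt_le; intros Hp.
  set (d := Cmod (l - m)) in *.
  assert (Hd : 0 < d / 3) by lra.
  destruct (filter_ex _ (filter_and _ _ (Hl _ Hd) (Hm _ Hd))) as [x [H1 H2]].
  assert (d <= Cmod (f x - m) + Cmod (f x - l)); [|lra].
  unfold d. rewrite <- (Cmod_opp (f x - l)).
  replace (l - m)%C with ((f x - m) + - (f x - l))%C by ring. apply Cmod_triangle.
Qed.

Lemma Ctends_comp {T S : Type} (F : (T -> Prop) -> Prop) (G : (S -> Prop) -> Prop)
  (f : T -> C) (g : S -> T) (l : C) :
  filterlim g G F -> Ctends F f l -> Ctends G (fun x => f (g x)) l.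
Proof. intros Hg Hf eps He. apply (Hg _ (Hf eps He)). Qed.

Lemma Ctends_Cinv_infty : Ctends (Rbar_locally p_infty) (fun t => RtoC (/ t)) 0.
Proof.
  intros eps He. exists (Rmax 1 (/ eps)). intros x Hx.
  pose proof (Rmax_l 1 (/ eps)). pose proof (Rmax_r 1 (/ eps)).
  replace (RtoC (/ x) - 0)%C with (RtoC (/ x)) by ring.
  rewrite Cmod_R, Rabs_pos_eq by (left; apply Rinv_0_lt_compat; lra).
  rewrite <- (Rinv_inv eps). apply Rinv_le_contravar; [apply Rinv_0_lt_compat|]; lra.
Qed.

(** * Gauss's product and Wallis's integrals *)

Lemma Re_le_Cmod (z : C) : Re z <= Cmod z.
Proof. eapply Rle_trans; [apply Rle_abs | apply re_le_Cmod]. Qed.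

Lemma Cmod_Cexp_le (z : C) : Cmod (Cexp z) <= exp (Cmod z).
Proof.
  rewrite Cmod_Cexp. destruct (Rle_lt_or_eq_dec _ _ (Re_le_Cmod z)) as [H| ->]; [|lra].
  left; apply exp_increasing, H.
Qed.

Lemma exp_le (x y : R) : x <= y -> exp x <= exp y.
Proof. intros [H| ->]; [left; apply exp_increasing, H | lra]. Qed.

Lemma is_derive_Cexp_line (z : C) (t : R) : is_derive (fun t : R => Cexp (RtoC t * z)) t (z * Cexp (RtoC t * z))%C.
Proof.
  apply is_derive_Cexp.
  eapply is_derive_Ceq.
  - apply is_derive_Cmult; [apply is_derive_RtoC, is_derive_id | apply is_derive_Cconst].
  - cbn [one]. change (@one R_AbsRing) with 1. ring.
Qed.

Lemma Cexp_sub_1_le (z : C) : Cmod (Cexp z - 1)%C <= 2 * (Cmod z * exp (Cmod z)).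
Proof.
  assert (H := C_bounded_variation (fun t : R => Cexp (RtoC t * z)) (fun t => z * Cexp (RtoC t * z))%C
    (Cmod z * exp (Cmod z)) 0 1).
  cbv beta in H. rewrite Cmult_1_l, Cmult_0_l, Cexp_0, Rminus_0_r, Rabs_R1, Rmult_1_r in H.
  apply H. intros t Ht. rewrite Rmin_left, Rmax_right in Ht by lra.
  split; [apply is_derive_Cexp_line|]. rewrite Cmod_mult.
  apply Rmult_le_compat_l; [apply Cmod_ge_0|].
  eapply Rle_trans; [apply Cmod_Cexp_le|]. apply exp_le.
  rewrite Cmod_mult, Cmod_R, Rabs_pos_eq by lra. pose proof (Cmod_ge_0 z). nra.
Qed.

(** Mean value bound for [Cexp (t z) - 1 - t z] on [[0, 1]], whose derivative [z (Cexp (t z) - 1)]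
    is controlled by [Cexp_sub_1_le]. The constant 4 is the factor 2 of [C_bounded_variation]
    incurred twice. *)
Lemma Cexp_taylor (z : C) : Cmod (Cexp z - 1 - z)%C <= 4 * (Cmod z ^ 2 * exp (Cmod z)).
Proof.
  assert (H := C_bounded_variation (fun t : R => Cexp (RtoC t * z) - 1 - RtoC t * z)%C
    (fun t => z * (Cexp (RtoC t * z) - 1))%C (Cmod z * (2 * (Cmod z * exp (Cmod z)))) 0 1).
  cbv beta in H. rewrite Cmult_1_l, Cmult_0_l, Cexp_0, Rminus_0_r, Rabs_R1, Rmult_1_r in H.
  replace (Cexp z - 1 - z - (1 - 1 - 0))%C with (Cexp z - 1 - z)%C in H by ring.
  eapply Rle_trans; [apply H|apply Req_le; ring].
  intros t Ht. rewrite Rmin_left, Rmax_right in Ht by lra.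
  split.
  - eapply is_derive_Ceq.
    { apply is_derive_Cminus; [apply is_derive_Cminus|].
      - apply is_derive_Cexp_line.
      - apply is_derive_Cconst.
      - apply is_derive_Cmult; [apply is_derive_RtoC, is_derive_id | apply is_derive_Cconst]. }
    change (@one R_AbsRing) with 1. cbv beta. ring.
  - rewrite Cmod_mult. apply Rmult_le_compat_l; [apply Cmod_ge_0|].
    eapply Rle_trans; [apply Cexp_sub_1_le|].
    assert (Cmod (t * z) <= Cmod z).
    { rewrite Cmod_mult, Cmod_R, Rabs_pos_eq by lra. pose proof (Cmod_ge_0 z). nra. }
    apply Rmult_le_compat_l; [lra|].
    apply Rmult_le_compat; [apply Cmod_ge_0 | left; apply exp_pos | assumption | apply exp_le; assumption].
Qed.

Lemma INR_S_pos (n : nat) : 0 < INR (S n).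
Proof. apply lt_0_INR; lia. Qed.

(** The increments are dominated by those of a telescoping sequence, so the variation after index
    [m] is at most [K / (m + 1)], which gives the Cauchy criterion without summing a series. *)
Lemma Ctends_telescoping (h : nat -> C) (K : R) :
  (forall n, Cmod (h (S n) - h n)%C <= K * (/ INR (S n) - / INR (S (S n)))) ->
  exists l, Ctends eventually h l.
Proof.
  intros H.
  assert (H1 : forall m n, (m <= n)%nat -> Cmod (h n - h m)%C <= K * (/ INR (S m) - / INR (S n))).
  { intros m n Hmn. induction Hmn as [|n Hmn IH].
    - replace (h m - h m)%C with (RtoC 0) by ring. rewrite Cmod_0. lra.
    - replace (h (S n) - h m)%C with ((h (S n) - h n) + (h n - h m))%C by ring.
      eapply Rle_trans; [apply Cmod_triangle|]. specialize (H n). lra. }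
  assert (HK : 0 <= K).
  { specialize (H O). pose proof (Cmod_ge_0 (h 1%nat - h O)%C). simpl in H. lra. }
  assert (H2 : forall m n, (m <= n)%nat -> Cmod (h n - h m)%C <= K * / INR (S m)).
  { intros m n Hmn. specialize (H1 m n Hmn).
    pose proof (Rinv_0_lt_compat _ (INR_S_pos n)). nra. }
  destruct (proj1 (@filterlim_locally_cauchy nat
     (CompleteNormedModule.CompleteSpace _ C_CompleteNormedModule) eventually _ h)) as [l Hl].
  - intros eps.
    destruct (nfloor_ex (2 * K / eps)) as [M [_ HM]].
    { apply Rmult_le_pos; [lra | left; apply Rinv_0_lt_compat, cond_pos]. }
    exists (fun n => (M <= n)%nat). split; [exists M; auto|].
    intros u v Hu Hv.
    apply (@norm_compat1 C_AbsRing C_NormedModule). change (Cmod (h v - h u) < eps).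
    pose proof (H2 M u Hu). pose proof (H2 M v Hv).
    replace (h v - h u)%C with ((h v - h M) + - (h u - h M))%C by ring.
    eapply Rle_lt_trans; [apply Cmod_triangle|]. rewrite Cmod_opp.
    assert (2 * K * / INR (S M) < eps); [|lra].
    pose proof (cond_pos eps). pose proof (INR_S_pos M). rewrite S_INR in *.
    apply (Rmult_lt_reg_r (INR M + 1)); [lra|].
    replace (2 * K * / (INR M + 1) * (INR M + 1)) with (2 * K) by (field; lra).
    apply (Rmult_lt_reg_r (/ eps)); [apply Rinv_0_lt_compat; lra|].
    replace (eps * (INR M + 1) * / eps) with (INR M + 1) by (field; lra). exact HM.
  - exists l. apply Ctends_filterlim, Hl.
Qed.

Definition gauss (w : C) (n : nat) : C :=
  (rising_prod w n / (RtoC (INR (fact n)) * Rcpow (INR n) w))%C.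

(** [lim] is a total operator whose value is meaningful on Cauchy filters. The existence of a limit
    makes the filter Cauchy, and uniqueness identifies that limit with [lim]. *)
Lemma lim_Ctends (f : nat -> C) (l : C) :
  Ctends eventually f l ->
  @lim (CompleteNormedModule.CompleteSpace _ C_CompleteNormedModule) (filtermap f eventually) = l.
Proof.
  intros H. apply (Ctends_unique eventually f); [|exact H].
  apply Ctends_filterlim in H. apply Ctends_filterlim.
  apply filterlim_locally. intros eps.
  apply (@complete_cauchy (CompleteNormedModule.CompleteSpace _ C_CompleteNormedModule) (filtermap f eventually)).
  - apply filtermap_proper_filter, eventually_filter.
  - intros e. exists l. exact (proj1 (filterlim_locally f l) H e).
Qed.

Lemma Rcpow_neq_0 (b : R) (w : C) : Rcpow b w <> 0.
Proof. apply Cexp_neq_0. Qed.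

Lemma INR_fact_C_neq_0 (n : nat) : RtoC (INR (fact n)) <> 0.
Proof. intros H. apply (INR_fact_neq_0 n). now inversion H. Qed.

Lemma gauss_ratio (w : C) (n : nat) :
  gauss w (S (S n)) =
  (gauss w (S n) * ((1 + w * RtoC (/ INR (S (S n))))
     * Cexp (- (w * RtoC (ln (INR (S (S n))) - ln (INR (S n)))))))%C.
Proof.
  unfold gauss, Rcpow.
  set (p := RtoC (ln (INR (S (S n))))). set (q := RtoC (ln (INR (S n)))).
  replace (- (w * RtoC (ln (INR (S (S n))) - ln (INR (S n)))))%C with (w * q + - (w * p))%C
    by (rewrite RtoC_minus; fold p q; ring).
  rewrite Cexp_plus, Cexp_opp.
  change (rising_prod w (S (S n))) with (rising_prod w (S n) * (w + RtoC (INR (S (S n)))))%C.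
  change (fact (S (S n))) with (S (S n) * fact (S n))%nat.
  rewrite mult_INR, RtoC_mult.
  assert (H0 : INR (S (S n)) <> 0) by (apply not_0_INR; lia).
  rewrite RtoC_inv by exact H0.
  field. repeat split; try apply Cexp_neq_0; try apply INR_fact_C_neq_0.
  intros H; apply H0; now inversion H.
Qed.

Lemma ln_succ_bounds (n : nat) :
  / INR (S (S n)) <= ln (INR (S (S n))) - ln (INR (S n)) <= / INR (S n).
Proof.
  pose proof (INR_S_pos n). pose proof (INR_S_pos (S n)).
  assert (E : INR (S (S n)) = INR (S n) + 1) by apply S_INR.
  set (x := INR (S n)) in *. set (y := INR (S (S n))) in *.
  rewrite <- ln_div by lra. split.
  - replace (ln (y / x)) with (- ln (x / y))
      by (rewrite !ln_div by lra; ring).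
    assert (ln (x / y) <= x / y - 1).
    { pose proof (exp_ineq1_le (ln (x / y))) as Hi. rewrite exp_ln in Hi; [lra|].
      apply Rdiv_lt_0_compat; lra. }
    replace (/ y) with (1 - x / y) by (rewrite E; field; lra). lra.
  - pose proof (exp_ineq1_le (ln (y / x))) as Hi. rewrite exp_ln in Hi by (apply Rdiv_lt_0_compat; lra).
    replace (/ x) with (y / x - 1) by (rewrite E; field; lra). lra.
Qed.

(** The ratio of consecutive Gauss terms is [1 + O(1/n^2)], because the first-order part [w/n] of
    the linear factor cancels that of the exponential. The bound is written as a difference of
    inverses to feed [Ctends_telescoping]. *)
Lemma gauss_ratio_bound (w : C) : exists K, 0 <= K /\ forall n,
  Cmod ((1 + w * RtoC (/ INR (S (S n))))
     * Cexp (- (w * RtoC (ln (INR (S (S n))) - ln (INR (S n))))) - 1)%C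
  <= K * (/ INR (S n) - / INR (S (S n))).
Proof.
  pose proof (Cmod_ge_0 w) as Hw.
  exists ((1 + Cmod w) * (4 * (Cmod w ^ 2 * exp (Cmod w)) * 2) + Cmod w + 2 * Cmod w ^ 2). split.
  { pose proof (exp_pos (Cmod w)). assert (0 <= Cmod w ^ 2) by (apply pow2_ge_0).
    assert (0 <= Cmod w ^ 2 * exp (Cmod w)) by (apply Rmult_le_pos; lra).
    assert (0 <= (1 + Cmod w) * (4 * (Cmod w ^ 2 * exp (Cmod w)) * 2)) by (apply Rmult_le_pos; lra). lra. }
  intros n. pose proof (ln_succ_bounds n) as He. set (e := _ - _) in *.
  set (x := / INR (S n)) in *. set (y := / INR (S (S n))) in *.
  assert (Hx : 0 < x) by apply Rinv_0_lt_compat, INR_S_pos.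
  assert (Hy : 0 < y) by apply Rinv_0_lt_compat, INR_S_pos.
  assert (Hxy : x - y = x * y).
  { unfold x, y. pose proof (INR_S_pos n). rewrite (S_INR (S n)). field; lra. }
  assert (Hx1 : x <= 1).
  { unfold x. rewrite <- Rinv_1. apply Rinv_le_contravar; [lra|]. rewrite S_INR. pose proof (pos_INR n). lra. }
  assert (Hx2 : x <= 2 * y) by nra.
  set (z := (- (w * RtoC e))%C).
  assert (Hz : Cmod z = Cmod w * e).
  { unfold z. rewrite Cmod_opp, Cmod_mult, Cmod_R, Rabs_pos_eq by lra. reflexivity. }
  (* The second-order remainder of the exponential, the mismatch between [e] and [y], and the cross
     term: each is [O(x * y)], and [x * y = x - y]. *)
  replace ((1 + w * y) * Cexp z - 1)%C with
    ((1 + w * y) * (Cexp z - 1 - z) + (- (w * RtoC (e - y)) + - (w * w * RtoC (e * y))))%C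
    by (rewrite RtoC_minus, RtoC_mult; unfold z; ring).
  eapply Rle_trans; [apply Cmod_triangle|].
  rewrite (Rplus_assoc (_ * _)), Rmult_plus_distr_r. apply Rplus_le_compat.
  - rewrite Cmod_mult, Rmult_assoc. apply Rmult_le_compat; try apply Cmod_ge_0.
    + eapply Rle_trans; [apply Cmod_triangle|]. rewrite Cmod_1, Cmod_mult, Cmod_R, Rabs_pos_eq by lra. nra.
    + eapply Rle_trans; [apply Cexp_taylor|]. rewrite Hz, Hxy, !Rmult_assoc.
      apply Rmult_le_compat_l; [lra|].
      assert (exp (Cmod w * e) <= exp (Cmod w)) by (apply exp_le; nra).
      pose proof (exp_pos (Cmod w * e)).
      assert (e ^ 2 <= 2 * (x * y)) by nra.
      replace ((Cmod w * e) ^ 2 * exp (Cmod w * e)) with (Cmod w ^ 2 * (exp (Cmod w * e) * e ^ 2)) by ring.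
      apply Rmult_le_compat_l; [apply pow2_ge_0|].
      apply Rmult_le_compat; try lra. apply pow2_ge_0.
  - eapply Rle_trans; [apply Cmod_triangle|].
    rewrite !Cmod_opp, !Cmod_mult, !Cmod_R, !Rabs_pos_eq by nra.
    rewrite Rmult_plus_distr_r. apply Rplus_le_compat.
    + apply Rmult_le_compat_l; lra.
    + rewrite Hxy. assert (e * y <= 2 * (x * y)) by nra.
      replace (2 * Cmod w ^ 2 * (x * y)) with (Cmod w * Cmod w * (2 * (x * y))) by ring.
      apply Rmult_le_compat_l; [nra | assumption].
Qed.

(** An increment is the current term times the ratio minus 1. The ratio bound first shows that the
    terms stay bounded, through a product of exponentials whose exponents telescope, and then that
    the increments do. The estimates start at index 1, where [ln (INR n)] is a genuine logarithm. *)
Lemma gauss_tends (w : C) : Ctends eventually (gauss w) (rgamma w).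
Proof.
  destruct (gauss_ratio_bound w) as [K [HK HR]].
  assert (HB : forall n, Cmod (gauss w (S n)) <= Cmod (gauss w 1) * exp (K * (1 - / INR (S n)))).
  { induction n as [|n IH].
    - simpl INR. rewrite Rinv_1, Rminus_diag, Rmult_0_r, exp_0. lra.
    - rewrite gauss_ratio, Cmod_mult.
      replace (K * (1 - / INR (S (S n)))) with
        (K * (1 - / INR (S n)) + K * (/ INR (S n) - / INR (S (S n)))) by ring.
      rewrite exp_plus, <- Rmult_assoc. apply Rmult_le_compat; try apply Cmod_ge_0; [exact IH|].
      specialize (HR n). set (r := (_ * Cexp _)%C) in *.
      replace r with (1 + (r - 1))%C by ring.
      eapply Rle_trans; [apply Cmod_triangle|]. rewrite Cmod_1.
      eapply Rle_trans; [|apply exp_ineq1_le]. lra. }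
  destruct (Ctends_telescoping (fun n => gauss w (S n)) (Cmod (gauss w 1) * exp K * K)) as [l Hl].
  { intros n. rewrite (gauss_ratio w n). specialize (HR n). set (r := (_ * Cexp _)%C) in *.
    replace (gauss w (S n) * r - gauss w (S n))%C with (gauss w (S n) * (r - 1))%C by ring.
    rewrite Cmod_mult, Rmult_assoc. apply Rmult_le_compat; try apply Cmod_ge_0; [|exact HR].
    eapply Rle_trans; [apply HB|]. apply Rmult_le_compat_l; [apply Cmod_ge_0|].
    apply exp_le. pose proof (Rinv_0_lt_compat _ (INR_S_pos n)). nra. }
  assert (Hg : Ctends eventually (gauss w) l).
  { intros eps He. destruct (Hl eps He) as [N HN]. exists (S N). intros [|n] Hn; [lia|]. apply HN; lia. }
  replace (rgamma w) with l; [exact Hg|]. symmetry. apply lim_Ctends, Hg.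
Qed.

(** * Wallis's integrals and the value of [1/Gamma(1/2)] *)

Definition wallis (n : nat) : R := RInt (fun x => cos x ^ n) 0 (PI / 2).

Lemma is_RInt_wallis (n : nat) : is_RInt (fun x => cos x ^ n) 0 (PI / 2) (wallis n).
Proof.
  apply (@RInt_correct R_CompleteNormedModule), (@ex_RInt_continuous R_CompleteNormedModule).
  intros x _. apply (ex_derive_continuous (fun x => cos x ^ n)). auto_derive; trivial.
Qed.

Lemma wallis_0 : wallis 0 = PI / 2.
Proof.
  unfold wallis. simpl. rewrite RInt_const. unfold scal; simpl; unfold mult; simpl. ring.
Qed.

Lemma wallis_1 : wallis 1 = 1.
Proof.
  assert (H : is_RInt (fun x => cos x ^ 1) 0 (PI / 2) (minus (sin (PI / 2)) (sin 0))).
  { apply (is_RInt_derive sin (fun x => cos x ^ 1)).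
    - intros x _. rewrite pow_1. apply is_derive_sin.
    - intros x _. apply (ex_derive_continuous (fun x => cos x ^ 1)). auto_derive; trivial. }
  unfold wallis. rewrite (is_RInt_unique _ _ _ _ H), sin_PI2, sin_0.
  unfold minus, plus, opp; simpl; ring.
Qed.

(** Integrates the derivative of [sin x * cos x ^ S n], a function that vanishes at both ends of the
    interval. *)
Lemma wallis_rec (n : nat) : INR (S (S n)) * wallis (S (S n)) = INR (S n) * wallis n.
Proof.
  assert (H : is_RInt (fun x => INR (S (S n)) * cos x ^ S (S n) - INR (S n) * cos x ^ n) 0 (PI / 2)
     (minus (sin (PI/2) * cos (PI/2) ^ S n) (sin 0 * cos 0 ^ S n))).
  { apply (is_RInt_derive (fun x => sin x * cos x ^ S n)).
    - intros x _. auto_derive; trivial.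
      change (Nat.pred (S n)) with n. rewrite !S_INR.
      pose proof (sin2_cos2 x) as E. unfold Rsqr in E.
      transitivity (cos x * (cos x * cos x ^ n) - (INR n + 1) * (sin x * sin x) * cos x ^ n).
      { cbn [pow]. destruct n; simpl; ring. }
      replace (sin x * sin x) with (1 - cos x * cos x) by lra. cbn [pow]. ring.
    - intros x _. apply (ex_derive_continuous (fun x => INR (S (S n)) * cos x ^ S (S n) - INR (S n) * cos x ^ n)).
      auto_derive; trivial. }
  rewrite cos_PI2, sin_0 in H.
  assert (H' := @is_RInt_minus _ _ _ _ _ _ _
    (is_RInt_scal _ _ _ (INR (S (S n))) _ (is_RInt_wallis (S (S n))))
    (is_RInt_scal _ _ _ (INR (S n)) _ (is_RInt_wallis n))).
  assert (E := eq_trans (eq_sym (@is_RInt_unique R_CompleteNormedModule _ _ _ _ H'))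
    (@is_RInt_unique R_CompleteNormedModule _ _ _ _ H)).
  change (INR (S (S n)) * wallis (S (S n)) - INR (S n) * wallis n
    = sin (PI / 2) * 0 ^ S n - 0 * cos 0 ^ S n) in E.
  cbn [pow] in E. lra.
Qed.

Lemma wallis_decr (n : nat) : 0 <= wallis (S n) <= wallis n.
Proof.
  assert (Hc : forall x, 0 < x < PI / 2 -> 0 <= cos x <= 1).
  { intros x Hx. split; [left; apply cos_gt_0; lra | apply COS_bound]. }
  pose proof PI_RGT_0. split.
  - apply RInt_ge_0; [lra | eexists; apply is_RInt_wallis |].
    intros x Hx. apply pow_le, Hc, Hx.
  - apply RInt_le; [lra | eexists; apply is_RInt_wallis | eexists; apply is_RInt_wallis |].
    intros x Hx. simpl. specialize (Hc x Hx). pose proof (pow_le _ n (proj1 Hc)). nra.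
Qed.

Lemma wallis_prod (n : nat) : INR (S n) * wallis (S n) * wallis n = PI / 2.
Proof.
  induction n as [|n IH].
  - rewrite wallis_0, wallis_1. simpl. ring.
  - rewrite wallis_rec. rewrite <- IH. ring.
Qed.

Lemma rising_prod_half (n : nat) :
  rising_prod (RtoC (1/2)) n = RtoC (INR (fact n) * (INR n + 1/2) * (2 / PI * wallis (2 * n))).
Proof.
  pose proof PI_RGT_0.
  induction n as [|n IH].
  - simpl. rewrite wallis_0. f_equal. field. lra.
  - change (rising_prod (RtoC (1/2)) (S n)) with (rising_prod (RtoC (1/2)) n * (RtoC (1/2) + RtoC (INR (S n))))%C.
    rewrite IH, <- RtoC_plus, <- RtoC_mult. f_equal.
    replace (2 * S n)%nat with (S (S (2 * n))) by lia.
    change (fact (S n)) with (S n * fact n)%nat. rewrite mult_INR.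
    pose proof (wallis_rec (2 * n)) as HW.
    assert (E : wallis (S (S (2 * n))) = (2 * INR n + 1) / (2 * (INR n + 1)) * wallis (2 * n)).
    { pose proof (pos_INR n). rewrite !S_INR, mult_INR in HW. simpl (INR 2) in HW.
      apply (Rmult_eq_reg_l (2 * (INR n + 1))); [|lra].
      replace (2 * (INR n + 1)) with ((1 + 1) * INR n + 1 + 1) at 1 by ring. rewrite HW. field; lra. }
    rewrite E, S_INR. pose proof (pos_INR n). field. lra.
Qed.

(** The square of the Gauss term contains [wallis (2 n) ^ 2]. Monotonicity places it between the
    products of [wallis (2 n)] with its two neighbours, both known exactly from [wallis_prod], so
    the square is squeezed to [1/PI]. *)
Lemma rgamma_half : rgamma (RtoC (1/2)) = RtoC (/ sqrt PI).
Proof.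
  apply (Ctends_unique eventually (gauss (RtoC (1/2)))); [apply gauss_tends|].
  pose proof PI_RGT_0 as HPI. pose proof (sqrt_lt_R0 _ HPI) as Hs.
  pose proof (sqrt_sqrt PI ltac:(lra)) as Hss. set (s := sqrt PI) in *.
  assert (HG : forall n, (0 < n)%nat -> exists g, gauss (RtoC (1/2)) n = RtoC g /\ 0 <= g /\
     / PI <= g * g <= / PI * (1 + / (2 * INR n)) ^ 2).
  { intros n Hn. pose proof (lt_0_INR n Hn) as HIn.
    exists ((INR n + 1/2) * (2 / PI * wallis (2 * n)) / sqrt (INR n)).
    pose proof (sqrt_lt_R0 _ HIn) as Hsn. pose proof (sqrt_sqrt (INR n) (Rlt_le _ _ HIn)) as Hssn.
    assert (HW : 0 <= wallis (2 * n)).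
    { destruct (wallis_decr (2 * n)). lra. }
    assert (HW1 := wallis_prod (2 * n)).
    assert (HW2 := wallis_prod (2 * n - 1)). replace (S (2 * n - 1)) with (2 * n)%nat in HW2 by lia.
    assert (HD1 := wallis_decr (2 * n)). assert (HD2 := wallis_decr (2 * n - 1)).
    replace (S (2 * n - 1)) with (2 * n)%nat in HD2 by lia.
    rewrite S_INR, mult_INR in HW1. rewrite mult_INR in HW2. simpl (INR 2) in *.
    set (W := wallis (2 * n)) in *. set (W1 := wallis (S (2 * n))) in *. set (W2 := wallis (2 * n - 1)) in *.
    set (sn := sqrt (INR n)) in *. set (x := INR n) in *.
    split; [|split].
    - unfold gauss. rewrite rising_prod_half. fold W x.
      unfold Rcpow. rewrite <- RtoC_mult, Cexp_RtoC, <- RtoC_mult.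
      fold x. replace (exp (1 / 2 * ln x)) with sn.
      + pose proof (INR_fact_neq_0 n). rewrite <- RtoC_div.
        * f_equal. field. repeat split; lra.
        * apply Rmult_integral_contrapositive_currified; lra.
      + unfold sn. rewrite <- Rpower_sqrt by exact HIn. unfold Rpower. f_equal. lra.
    - apply Rmult_le_pos; [|left; apply Rinv_0_lt_compat; exact Hsn].
      apply Rmult_le_pos; [lra|]. apply Rmult_le_pos; [|exact HW]. left; apply Rdiv_lt_0_compat; lra.
    - replace ((x + 1 / 2) * (2 / PI * W) / sn * ((x + 1 / 2) * (2 / PI * W) / sn))
        with ((x + 1/2) ^ 2 * 4 / (PI * PI * (sn * sn)) * (W * W)) by (field; split; lra).
      rewrite Hssn.
      assert (HL : W * W1 = PI / (2 * (2 * x + 1))).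
      { apply (Rmult_eq_reg_l (2 * (2 * x + 1))); [|lra].
        transitivity (2 * (((1 + 1) * x + 1) * W1 * W)); [ring|]. rewrite HW1. field. lra. }
      assert (HU : W * W2 = PI / (4 * x)).
      { apply (Rmult_eq_reg_l (4 * x)); [|lra].
        transitivity (2 * (((1 + 1) * x) * W * W2)); [ring|]. rewrite HW2. field. lra. }
      assert (Hc : 0 < (x + 1/2) ^ 2 * 4 / (PI * PI * x)).
      { apply Rdiv_lt_0_compat; [|apply Rmult_lt_0_compat; [apply Rmult_lt_0_compat|]; lra].
        apply Rmult_lt_0_compat; [|lra]. apply pow_lt; lra. }
      split.
      + apply Rle_trans with ((x + 1/2) ^ 2 * 4 / (PI * PI * x) * (W * W1)).
        * rewrite HL. replace ((x + 1 / 2) ^ 2 * 4 / (PI * PI * x) * (PI / (2 * (2 * x + 1))))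
            with (/ PI * (1 + / (2 * x))) by (field; lra).
          pose proof (Rinv_0_lt_compat _ HPI). assert (0 < / (2 * x)) by (apply Rinv_0_lt_compat; lra). nra.
        * apply Rmult_le_compat_l; [lra|]. nra.
      + apply Rle_trans with ((x + 1/2) ^ 2 * 4 / (PI * PI * x) * (W * W2)).
        * apply Rmult_le_compat_l; [lra|]. nra.
        * rewrite HU. apply Req_le. field. lra. }
  intros eps He.
  destruct (nfloor_ex (2 / (s * eps))) as [N [_ HN]].
  { apply Rlt_le, Rdiv_lt_0_compat; [lra | apply Rmult_lt_0_compat; lra]. }
  exists (S N). intros n Hn. destruct (HG n ltac:(lia)) as [g [-> [Hg [Hg1 Hg2]]]].
  rewrite <- RtoC_minus, Cmod_R.
  assert (Hn' : INR N + 1 <= INR n) by (rewrite <- S_INR; apply le_INR, Hn).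
  pose proof (pos_INR N). set (x := INR n) in *.
  assert (Hi : 0 < / s) by (apply Rinv_0_lt_compat; lra).
  assert (Hii : / s * / s = / PI) by (rewrite <- Hss; field; lra).
  assert (H1 : / s <= g) by nra.
  rewrite Rabs_pos_eq by lra.
  (* The right-hand side factors as [(g - 1/s) (g + 1/s)], and the second factor is at least
     [1/s]. *)
  assert (H2 : (g - / s) * / s <= g * g - / PI) by nra.
  assert (H3 : / PI * (1 + / (2 * x)) ^ 2 - / PI <= / PI * (2 / x)).
  { replace (/ PI * (2 / x)) with (/ PI * (1 + / x + / x) - / PI) by (field; lra).
    apply Rplus_le_compat_r, Rmult_le_compat_l; [left; apply Rinv_0_lt_compat; lra|].
    replace ((1 + / (2 * x)) ^ 2) with (1 + / x + / x * (/ x / 4)) by (field; lra).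
    assert (/ x <= 1) by (rewrite <- Rinv_1; apply Rinv_le_contravar; lra).
    assert (0 < / x) by (apply Rinv_0_lt_compat; lra). nra. }
  assert (H4 : g - / s <= / s * (2 / x)).
  { apply (Rmult_le_reg_r (/ s)); [lra|].
    replace (/ s * (2 / x) * / s) with (/ PI * (2 / x)) by (rewrite <- Hii; ring). lra. }
  eapply Rle_trans; [exact H4|].
  replace (/ s * (2 / x)) with (2 / (s * eps) * eps / x) by (field; lra).
  apply (Rmult_le_reg_r x); [lra|].
  replace (2 / (s * eps) * eps / x * x) with (2 / (s * eps) * eps) by (field; lra).
  rewrite (Rmult_comm eps). apply Rmult_le_compat_r; lra.
Qed.

(** * Exponential generating functions *)

(** This growth condition makes the exponential generating function entire and is stable under index
    shifts and products with [INR n]. Requiring [1 <= q] makes [q ^ n] nondecreasing, so one bound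
    serves all smaller indices. *)
Definition geom_bounded (d : nat -> C) : Prop :=
  exists K q, 0 <= K /\ 1 <= q /\ forall n, Cmod (d n) <= K * q ^ n.

(** The Poisson weight without its normalization [exp (- x)]. *)
Definition pois (x : R) (n : nat) : R := x ^ n / INR (fact n).

Lemma pois_pos (x : R) (n : nat) : 0 <= x -> 0 <= pois x n.
Proof.
  intros Hx. apply Rmult_le_pos; [apply pow_le, Hx | left; apply Rinv_0_lt_compat, INR_fact_lt_0].
Qed.

Lemma is_series_Rext (a b : nat -> R) (l : R) :
  (forall n, a n = b n) -> is_series a l -> is_series b l.
Proof. apply is_series_ext. Qed.

Lemma ex_series_Rext (a b : nat -> R) :
  (forall n, a n = b n) -> ex_series a -> ex_series b.
Proof. apply ex_series_ext. Qed.

Lemma is_series_pois (x : R) : is_series (pois x) (exp x).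
Proof.
  apply is_series_Rext with (fun n => / INR (fact n) * x ^ n).
  - intros n. unfold pois. apply Rmult_comm.
  - apply is_pseries_R, is_exp_Reals.
Qed.

Lemma pois_S (x : R) (n : nat) : INR (S n) * pois x (S n) = x * pois x n.
Proof.
  unfold pois. change (fact (S n)) with (S n * fact n)%nat. rewrite mult_INR.
  pose proof (INR_fact_neq_0 n). assert (INR (S n) <> 0) by (apply not_0_INR; lia).
  cbn [pow]. field. auto.
Qed.

(** A factor [n] against the weight of index [n] equals [x] against the weight of index [n - 1], so
    each moment reduces to a lower one. *)
Lemma is_series_pois_moment (f : nat -> R) (x l : R) :
  is_series (fun n => f (S n) * pois x n) l ->
  is_series (fun n => INR n * f n * pois x n) (x * l).
Proof.
  intros H. apply is_series_decr_1.
  change (is_series (fun k => INR (S k) * f (S k) * pois x (S k)) (x * l + - (INR 0 * f O * pois x 0))).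
  replace (x * l + - (INR 0 * f O * pois x 0)) with (x * l) by (simpl; ring).
  apply is_series_Rext with (fun n => x * (f (S n) * pois x n)).
  - intros n. replace (INR (S n) * f (S n) * pois x (S n)) with (f (S n) * (INR (S n) * pois x (S n))) by ring.
    rewrite pois_S. ring.
  - apply (is_series_scal x _ l H).
Qed.

Lemma is_series_pois_1 (x : R) : is_series (fun n => INR n * pois x n) (x * exp x).
Proof.
  apply is_series_Rext with (fun n => INR n * 1 * pois x n); [intros n; ring|].
  apply (is_series_pois_moment (fun _ => 1)).
  apply is_series_Rext with (pois x); [intros n; ring | apply is_series_pois].
Qed.

Lemma is_series_pois_2 (x : R) :
  is_series (fun n => INR n ^ 2 * pois x n) ((x * x + x) * exp x).
Proof.
  apply is_series_Rext with (fun n => INR n * INR n * pois x n); [intros n; ring|].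
  replace ((x * x + x) * exp x) with (x * (x * exp x + exp x)) by ring.
  apply (is_series_pois_moment INR).
  apply is_series_Rext with (fun n => INR n * pois x n + pois x n); [intros n; rewrite S_INR; ring|].
  exact (is_series_plus _ _ _ _ (is_series_pois_1 x) (is_series_pois x)).
Qed.

(** The shape of the majorant in the Abelian theorem. Its average is exact, and the quadratic
    deviation contributes only the variance term [r / x]. *)
Lemma is_series_pois_quadratic (x p q r : R) : 0 < x ->
  is_series (fun n => (p + q * (INR n / x) + r * (INR n / x - 1) ^ 2) * pois x n)
    ((p + q + r / x) * exp x).
Proof.
  intros Hx.
  pose proof (is_series_plus _ _ _ _
    (is_series_plus _ _ _ _ (is_series_scal (p + r) _ _ (is_series_pois x))
       (is_series_scal ((q - 2 * r) / x) _ _ (is_series_pois_1 x)))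
    (is_series_scal (r / (x * x)) _ _ (is_series_pois_2 x))) as H.
  replace ((p + q + r / x) * exp x) with
    (((p + r) * exp x + (q - 2 * r) / x * (x * exp x)) + r / (x * x) * ((x * x + x) * exp x))
    by (field; lra).
  eapply is_series_Rext; [|exact H].
  intros n. cbn. unfold mult; simpl. field. lra.
Qed.

Lemma ex_series_geom_pois (x : R) (b : nat -> R) (K q : R) :
  (forall n, Rabs (b n) <= K * q ^ n) -> ex_series (fun n => b n * pois x n).
Proof.
  intros H. apply (@ex_series_le R_AbsRing R_CompleteNormedModule) with (fun n => K * pois (q * Rabs x) n).
  - intros n. change (Rabs (b n * pois x n) <= K * pois (q * Rabs x) n).
    unfold pois, Rdiv. rewrite !Rabs_mult, <- RPow_abs, Rpow_mult_distr.
    rewrite (Rabs_pos_eq (/ _)) by (left; apply Rinv_0_lt_compat, INR_fact_lt_0).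
    rewrite <- !Rmult_assoc. apply Rmult_le_compat_r; [left; apply Rinv_0_lt_compat, INR_fact_lt_0|].
    apply Rmult_le_compat_r; [apply pow_le, Rabs_pos | apply H].
  - eexists. apply (is_series_scal K _ _ (is_series_pois _)).
Qed.

Lemma CV_radius_infinite (a : nat -> R) (x : R) :
  (forall y, ex_series (fun n => a n * y ^ n)) -> Rbar_lt (Rabs x) (CV_radius a).
Proof.
  intros H. apply Rbar_not_le_lt. intros Hle.
  apply (CV_disk_outside a (Rabs x + 1)).
  - eapply Rbar_le_lt_trans; [exact Hle|]. simpl. rewrite (Rabs_pos_eq (_ + 1)); pose proof (Rabs_pos x); lra.
  - apply (ex_series_lim_0 _ (H _)).
Qed.

(** Built from two real power series, so that termwise differentiation is that of real power series
    inside their disk of convergence. *)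
Definition egf (d : nat -> C) (x : R) : C :=
  (PSeries (fun n => Re (d n) / INR (fact n)) x, PSeries (fun n => Im (d n) / INR (fact n)) x).

Section RealPart.
(* [p] stands for [Re] or [Im]. *)
Variable p : C -> R.
Hypothesis p_le : forall z, Rabs (p z) <= Cmod z.

Lemma ex_series_part (d : nat -> C) (x : R) : geom_bounded d ->
  ex_series (fun n => p (d n) * pois x n).
Proof.
  intros (K & q & _ & _ & H). apply ex_series_geom_pois with K q.
  intros n. eapply Rle_trans; [apply p_le | apply H].
Qed.

Lemma ex_series_part' (d : nat -> C) (x : R) : geom_bounded d ->
  ex_series (fun n => p (d n) / INR (fact n) * x ^ n).
Proof.
  intros H. eapply ex_series_Rext; [|apply (ex_series_part d x H)].
  intros n. unfold pois, Rdiv. ring.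
Qed.

Lemma PSeries_part (d : nat -> C) (x : R) :
  PSeries (fun n => p (d n) / INR (fact n)) x = Series (fun n => p (d n) * pois x n).
Proof. apply Series_ext. intros n. unfold pois, Rdiv. ring. Qed.

Lemma is_derive_part (d : nat -> C) (x : R) : geom_bounded d ->
  is_derive (PSeries (fun n => p (d n) / INR (fact n))) x
    (PSeries (fun n => p (d (S n)) / INR (fact n)) x).
Proof.
  intros H. eapply is_derive_eq.
  - apply is_derive_PSeries, CV_radius_infinite. intros y. apply ex_series_part', H.
  - apply PSeries_ext. intros n. unfold PS_derive.
    change (fact (S n)) with (S n * fact n)%nat. rewrite mult_INR.
    pose proof (INR_fact_neq_0 n). assert (INR (S n) <> 0) by (apply not_0_INR; lia).
    field. auto.
Qed.

Lemma PSeries_part_decr (d : nat -> C) (x : R) :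
  (forall z r, p (z * RtoC r)%C = p z * r) -> geom_bounded d ->
  PSeries (fun n => p (d n) / INR (fact n)) x
  = p (d O) + x * PSeries (fun n => p (d (S n) / RtoC (INR (S n)))%C / INR (fact n)) x.
Proof.
  intros p_scal H. rewrite PSeries_decr_1 by (apply ex_pseries_R, ex_series_part', H).
  f_equal; [simpl; field|]. f_equal. apply PSeries_ext. intros n. unfold PS_decr_1.
  assert (E : INR (S n) <> 0) by (apply not_0_INR; lia).
  unfold Cdiv. rewrite <- RtoC_inv, p_scal by exact E.
  change (fact (S n)) with (S n * fact n)%nat. rewrite mult_INR.
  pose proof (INR_fact_neq_0 n). field. auto.
Qed.

End RealPart.

Lemma geom_bounded_shift (d : nat -> C) : geom_bounded d -> geom_bounded (fun n => d (S n)).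
Proof.
  intros (K & q & HK & Hq & H). exists (K * q), q. repeat split; [nra | exact Hq |].
  intros n. specialize (H (S n)). cbn [pow] in H. lra.
Qed.

Lemma geom_bounded_mult (d e : nat -> C) :
  geom_bounded d -> geom_bounded e -> geom_bounded (fun n => d n * e n)%C.
Proof.
  intros (K & q & HK & Hq & H) (K' & q' & HK' & Hq' & H'). exists (K * K'), (q * q').
  repeat split; [nra | nra |]. intros n. rewrite Cmod_mult, Rpow_mult_distr.
  replace (K * K' * (q ^ n * q' ^ n)) with ((K * q ^ n) * (K' * q' ^ n)) by ring.
  apply Rmult_le_compat; auto using Cmod_ge_0.
Qed.

Lemma geom_bounded_plus (d e : nat -> C) :
  geom_bounded d -> geom_bounded e -> geom_bounded (fun n => d n + e n)%C.
Proof.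
  intros (K & q & HK & Hq & H) (K' & q' & HK' & Hq' & H'). exists (K + K'), (q * q').
  repeat split; [lra | nra |]. intros n. eapply Rle_trans; [apply Cmod_triangle|].
  rewrite Rpow_mult_distr. specialize (H n). specialize (H' n).
  pose proof (pow_R1_Rle q n Hq). pose proof (pow_R1_Rle q' n Hq').
  assert (K * q ^ n <= K * (q ^ n * q' ^ n)) by (apply Rmult_le_compat_l; nra).
  assert (K' * q' ^ n <= K' * (q ^ n * q' ^ n)) by (apply Rmult_le_compat_l; nra). lra.
Qed.

Lemma geom_bounded_const (z : C) : geom_bounded (fun _ => z).
Proof.
  exists (Cmod z), 1. repeat split; [apply Cmod_ge_0 | lra |]. intros n. rewrite pow1. lra.
Qed.

Lemma geom_bounded_INR : geom_bounded (fun n => RtoC (INR n)).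
Proof.
  exists 1, 2. repeat split; [lra | lra |]. intros n.
  rewrite Cmod_R, Rabs_pos_eq by apply pos_INR.
  induction n as [|n IH]; [simpl; lra|]. rewrite S_INR. cbn [pow].
  pose proof (pow_R1_Rle 2 n ltac:(lra)). lra.
Qed.

Lemma geom_bounded_pred (d : nat -> C) : geom_bounded d -> geom_bounded (fun n => d (pred n)).
Proof.
  intros (K & q & HK & Hq & H). exists K, q. repeat split; [exact HK | exact Hq |].
  intros [|n]; [apply H|]. simpl. eapply Rle_trans; [apply H|].
  apply Rmult_le_compat_l; [exact HK|]. pose proof (pow_R1_Rle q n Hq). nra.
Qed.

Lemma egf_ext (d e : nat -> C) (x : R) : (forall n, d n = e n) -> egf d x = egf e x.
Proof. intros H. unfold egf. f_equal; apply PSeries_ext; intros n; rewrite H; reflexivity. Qed.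

Lemma is_derive_egf (d : nat -> C) (x : R) : geom_bounded d ->
  is_derive (egf d) x (egf (fun n => d (S n)) x).
Proof.
  intros H. apply is_derive_C.
  - apply (is_derive_part Re re_le_Cmod d x H).
  - apply (is_derive_part Im Im_le_Cmod d x H).
Qed.

Lemma Re_egf (d : nat -> C) (x : R) : Re (egf d x) = Series (fun n => Re (d n) * pois x n).
Proof. apply PSeries_part. Qed.

Lemma Im_egf (d : nat -> C) (x : R) : Im (egf d x) = Series (fun n => Im (d n) * pois x n).
Proof. apply PSeries_part. Qed.

Lemma egf_plus (d e : nat -> C) (x : R) : geom_bounded d -> geom_bounded e ->
  egf (fun n => d n + e n)%C x = (egf d x + egf e x)%C.
Proof.
  intros Hd He. apply Ceq.
  - rewrite re_plus, !Re_egf, <- Series_plus by (apply (ex_series_part Re re_le_Cmod); assumption).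
    apply Series_ext. intros n. rewrite re_plus. ring.
  - rewrite im_plus, !Im_egf, <- Series_plus by (apply (ex_series_part Im Im_le_Cmod); assumption).
    apply Series_ext. intros n. rewrite im_plus. ring.
Qed.

Lemma egf_scal (z : C) (d : nat -> C) (x : R) : geom_bounded d ->
  egf (fun n => z * d n)%C x = (z * egf d x)%C.
Proof.
  intros Hd.
  pose proof (ex_series_part Re re_le_Cmod d x Hd) as H1.
  pose proof (ex_series_part Im Im_le_Cmod d x Hd) as H2.
  assert (HS : forall (k : R) (u : nat -> R), ex_series u -> ex_series (fun n => k * u n))
    by (intros k u; apply (ex_series_scal k u)).
  apply Ceq.
  - rewrite re_mult, !Re_egf, Im_egf, <- !Series_scal_l, <- Series_minus by auto.
    apply Series_ext. intros n. rewrite re_mult. ring.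
  - rewrite im_mult, !Im_egf, Re_egf, <- !Series_scal_l, <- Series_plus by auto.
    apply Series_ext. intros n. rewrite im_mult. ring.
Qed.

Lemma egf_const (z : C) (x : R) : egf (fun _ => z) x = (z * RtoC (exp x))%C.
Proof.
  apply Ceq; rewrite ?Re_egf, ?Im_egf, Series_scal_l, (is_series_unique _ _ (is_series_pois x)),
    ?re_scal_r, ?im_scal_r; reflexivity.
Qed.

Lemma egf_decr (d : nat -> C) (x : R) : geom_bounded d ->
  egf d x = (d O + RtoC x * egf (fun n => d (S n) / RtoC (INR (S n))) x)%C.
Proof.
  intros H.
  apply Ceq; rewrite ?re_plus, ?im_plus, ?re_scal_l, ?im_scal_l.
  - apply (PSeries_part_decr Re re_le_Cmod); [apply re_scal_r | exact H].
  - apply (PSeries_part_decr Im Im_le_Cmod); [apply im_scal_r | exact H].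
Qed.

(** Together with [egf_decr] this trades a power of [n] in the coefficients for a power of [x]. Both
    move the exponent of the Abelian theorem by one, and this one also yields Kummer's equation. The
    default [pred 0] is harmless, being multiplied by [INR 0]. *)
Lemma egf_incr (d : nat -> C) (x : R) : geom_bounded d ->
  egf (fun n => RtoC (INR n) * d (pred n))%C x = (RtoC x * egf d x)%C.
Proof.
  intros H. rewrite egf_decr.
  - simpl INR at 1. rewrite Cmult_0_l, Cplus_0_l. f_equal. apply egf_ext. intros n.
    assert (E : RtoC (INR (S n)) <> 0) by (apply RtoC_neq_0, not_0_INR; lia).
    simpl pred. field. exact E.
  - apply geom_bounded_mult; [apply geom_bounded_INR | apply geom_bounded_pred, H].
Qed.

Lemma egf_bound (d : nat -> C) (b : nat -> R) (x l : R) : 0 <= x -> geom_bounded d ->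
  (forall n, Cmod (d n) <= b n) -> is_series (fun n => b n * pois x n) l ->
  Cmod (egf d x) <= 2 * l.
Proof.
  intros Hx Hd Hb Hl.
  assert (HB : forall p : C -> R, (forall z, Rabs (p z) <= Cmod z) ->
    Rabs (PSeries (fun n => p (d n) / INR (fact n)) x) <= l).
  { intros p Hp. rewrite PSeries_part, <- (is_series_unique _ _ Hl).
    assert (Hle : forall n, Rabs (p (d n) * pois x n) <= b n * pois x n).
    { intros n. rewrite Rabs_mult, (Rabs_pos_eq (pois x n)) by apply pois_pos, Hx.
      apply Rmult_le_compat_r; [apply pois_pos, Hx|]. eapply Rle_trans; [apply Hp | apply Hb]. }
    assert (Hex : ex_series (fun n => b n * pois x n)) by (eexists; exact Hl).
    eapply Rle_trans; [apply Series_Rabs|].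
    - apply (@ex_series_le R_AbsRing R_CompleteNormedModule) with (fun n => b n * pois x n); [|exact Hex].
      intros n. change (Rabs (Rabs (p (d n) * pois x n)) <= b n * pois x n). rewrite Rabs_Rabsolu. apply Hle.
    - apply Series_le; [|exact Hex]. intros n. split; [apply Rabs_pos | apply Hle]. }
  eapply Rle_trans; [apply Cmod_le_Re_Im|].
  pose proof (HB Re re_le_Cmod). pose proof (HB Im Im_le_Cmod).
  change (Re (egf d x)) with (PSeries (fun n => Re (d n) / INR (fact n)) x).
  change (Im (egf d x)) with (PSeries (fun n => Im (d n) / INR (fact n)) x). lra.
Qed.

(** * An Abelian theorem for Poisson averages *)

(** From [ln x <= 2 * sqrt x]; the square of [k * sqrt x - m], with [m] the modulus of [s], being
    nonnegative then absorbs the root into [k * x] and a constant. *)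
Lemma ln_le_linear (s k : R) : 0 < k -> exists K, forall x, 1 <= x -> Rabs (s * ln x) <= k * x + K.
Proof.
  intros Hk. set (m := Rabs s). assert (Hm : 0 <= m) by apply Rabs_pos.
  exists (m * m / k). intros x Hx.
  assert (Hl : 0 <= ln x) by (rewrite <- ln_1; apply ln_le; lra).
  rewrite Rabs_mult, (Rabs_pos_eq (ln x)) by exact Hl. fold m.
  pose proof (sqrt_lt_R0 x ltac:(lra)) as Hs. pose proof (sqrt_sqrt x ltac:(lra)) as Hss.
  set (r := sqrt x) in *.
  assert (H : ln x <= 2 * r).
  { rewrite <- Hss, ln_mult by exact Hs.
    pose proof (exp_ineq1_le (ln r)) as E. rewrite exp_ln in E by exact Hs. lra. }
  apply Rle_trans with (m * (2 * r)); [apply Rmult_le_compat_l; assumption|].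
  assert (0 <= (k * r - m) ^ 2 / k) by (apply Rmult_le_pos; [apply pow2_ge_0 | left; apply Rinv_0_lt_compat, Hk]).
  replace ((k * r - m) ^ 2 / k) with (k * (r * r) + m * m / k - m * (2 * r)) in H0 by (field; lra).
  rewrite Hss in H0. lra.
Qed.

Lemma exp_neg_linear_tends (k : R) : 0 < k -> Ctends (Rbar_locally p_infty) (fun x => RtoC (exp (- (k * x)))) 0.
Proof.
  intros Hk.
  apply Ctends_squeeze with (fun x => RtoC (/ k) * RtoC (/ x))%C.
  - exists 1. intros x Hx. replace (RtoC (exp (- (k * x))) - 0)%C with (RtoC (exp (- (k * x)))) by ring.
    assert (0 < / x) by (apply Rinv_0_lt_compat; lra). assert (0 < / k) by (apply Rinv_0_lt_compat; lra).
    rewrite Cmod_mult, !Cmod_R, !Rabs_pos_eq by (try (left; apply exp_pos); lra).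
    rewrite exp_Ropp, <- Rinv_mult. apply Rinv_le_contravar; [nra|].
    pose proof (exp_ineq1_le (k * x)). lra.
  - replace (RtoC 0) with (RtoC (/ k) * 0)%C by ring.
    apply Ctends_mult; [apply Ctends_const | apply Ctends_Cinv_infty].
Qed.

Lemma Cexp_decay_tends (s : C) :
  Ctends (Rbar_locally p_infty) (fun x : R => Cexp (- (RtoC x + s * RtoC (ln x)))) 0.
Proof.
  destruct (ln_le_linear (Re s) (1/2) ltac:(lra)) as [K HK].
  apply Ctends_squeeze with (fun x => RtoC (exp K) * RtoC (exp (- (1/2 * x))))%C.
  - exists 1. intros x Hx. replace (Cexp (- (x + s * ln x)) - 0)%C with (Cexp (- (x + s * ln x))) by ring.
    rewrite <- RtoC_mult, <- exp_plus, Cmod_R, Rabs_pos_eq by (left; apply exp_pos).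
    rewrite Cmod_Cexp. apply exp_le.
    rewrite re_opp, re_plus, re_scal_r. change (Re (RtoC x)) with x.
    specialize (HK x ltac:(lra)). apply Rabs_le_between in HK. lra.
  - replace (RtoC 0) with (RtoC (exp K) * 0)%C by ring.
    apply Ctends_mult; [apply Ctends_const | apply exp_neg_linear_tends; lra].
Qed.

Lemma exp_mul_ln_le (s y : R) : 0 <= s <= 1 -> 0 < y -> exp (s * ln y) <= 1 + y.
Proof.
  intros Hs Hy. destruct (Rle_lt_dec (ln y) 0) as [H|H].
  - apply Rle_trans with (exp 0); [apply exp_le; nra | rewrite exp_0; lra].
  - apply Rle_trans with (exp (ln y)); [apply exp_le; nra | rewrite exp_ln; lra].
Qed.

(** Continuity of [y^s] at 1 in a form that can be averaged. Near 1 the Lipschitz bound [k |y - 1|]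
    is split by the arithmetic-geometric inequality into [eps] and a multiple of the square. Away
    from 1, [0 <= Re s <= 1] gives [|y^s| <= 1 + y], both near 0 and at infinity, which the square
    dominates. *)
Lemma Cexp_ln_sub_1 (s : C) : 0 <= Re s <= 1 -> forall eps, 0 < eps -> exists K, 0 <= K /\
  forall y, 0 < y -> Cmod (Cexp (s * RtoC (ln y)) - 1)%C <= eps + K * (y - 1) ^ 2.
Proof.
  intros Hs eps He. pose proof (Cmod_ge_0 s) as Hc. set (m := Cmod s) in *.
  set (k := 4 * m * exp m).
  assert (Hk : 0 <= k) by (pose proof (exp_pos m); unfold k; nra).
  assert (Hkk : 0 <= k * k / eps) by (apply Rmult_le_pos; [nra | left; apply Rinv_0_lt_compat, He]).
  exists (14 + k * k / eps). split; [lra|].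
  intros y Hy. destruct (Rle_lt_dec (Rabs (y - 1)) (1/2)) as [H|H].
  - assert (Hln : Rabs (ln y) <= 2 * Rabs (y - 1)).
    { apply Rabs_le_between in H.
      pose proof (exp_ineq1_le (ln y)) as E1. rewrite exp_ln in E1 by exact Hy.
      pose proof (exp_ineq1_le (ln (/ y))) as E2. rewrite exp_ln, ln_Rinv in E2
        by (try apply Rinv_0_lt_compat; exact Hy).
      assert (E3 : / y - 1 <= 2 * Rabs (y - 1)).
      { replace (/ y - 1) with ((1 - y) * / y) by (field; lra).
        assert (/ y <= 2) by (replace 2 with (/ (1/2)) by field; apply Rinv_le_contravar; lra).
        assert (0 < / y) by (apply Rinv_0_lt_compat; lra).
        pose proof (Rle_abs (- (y - 1))). rewrite Rabs_Ropp in H2.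
        pose proof (Rabs_pos (y - 1)). nra. }
      apply Rabs_le. pose proof (Rle_abs (y - 1)). pose proof (Rabs_pos (y - 1)). lra. }
    eapply Rle_trans; [apply Cexp_sub_1_le|].
    rewrite Cmod_mult, Cmod_R. fold m.
    set (a := Rabs (y - 1)) in *. assert (Ha : 0 <= a) by apply Rabs_pos.
    assert (Hsq : (y - 1) ^ 2 = a * a) by (unfold a; rewrite <- Rabs_mult, Rabs_pos_eq; [ring | apply Rle_0_sqr]).
    rewrite Hsq. pose proof (Rabs_pos (ln y)) as Hl.
    assert (HH : 2 * (m * Rabs (ln y) * exp (m * Rabs (ln y))) <= k * a).
    { unfold k. replace (4 * m * exp m * a) with (2 * (m * (2 * a) * exp m)) by ring.
      apply Rmult_le_compat_l; [lra|]. apply Rmult_le_compat.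
      - nra.
      - left; apply exp_pos.
      - apply Rmult_le_compat_l; lra.
      - apply exp_le. nra. }
    assert (0 <= (eps - k * a) ^ 2 / eps) by (apply Rmult_le_pos; [apply pow2_ge_0 | left; apply Rinv_0_lt_compat, He]).
    replace ((eps - k * a) ^ 2 / eps) with (eps - 2 * (k * a) + k * k / eps * (a * a)) in H0 by (field; lra).
    nra.
  (* Equality holds at [y = 3/2], which fixes the constant 14. *)
  - assert (Hq : 14 * (y - 1) ^ 2 >= 2 + y).
    { destruct (Rle_lt_dec 1 y).
      - rewrite Rabs_pos_eq in H by lra. nra.
      - rewrite Rabs_left in H by lra. nra. }
    unfold Cminus. eapply Rle_trans; [apply Cmod_triangle|].
    rewrite Cmod_opp, Cmod_1, Cmod_Cexp, re_scal_r.
    pose proof (exp_mul_ln_le (Re s) y Hs Hy). pose proof (pow2_ge_0 (y - 1)). nra.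
Qed.

(* Under the Poisson weights [exp (-x) * pois x n] the ratio [n / x] has mean 1 and variance
   [1 / x], so [egf d x * exp (-x)] averages [d n ~ c * n ^ s] over [n] close to [x]. *)
Definition abelian (s : C) : Prop := forall (d : nat -> C) (c : C), geom_bounded d ->
  Ctends eventually (fun n => d n * Rcpow (INR n) (- s))%C c ->
  Ctends (Rbar_locally p_infty) (fun x => egf d x * Cexp (- (RtoC x + s * RtoC (ln x))))%C c.

(** For large [n], [X * d n] is close to [c * (n/x)^s], whose distance to [c] is at most a small
    constant plus a multiple of [(n/x - 1)^2]. The average of that square is [1/x]: this is
    Chebyshev's argument, with a pointwise majorant in place of a splitting of the sum around its
    mean. *)
Lemma abelian_strip (s : C) : 0 <= Re s <= 1 -> abelian s.
Proof.
  intros Hs d c Hd Hlim eps0 He0.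
  pose proof (Cmod_ge_0 c) as Hc.
  (* The final bound is [2 * (eps * (Cmod c + 2)) + 2 * (Kt / x)]; this choice makes its first half
     equal to [eps0 / 2]. *)
  set (eps := eps0 / (4 * (Cmod c + 2))).
  assert (He : 0 < eps) by (apply Rdiv_lt_0_compat; lra).
  destruct (Cexp_ln_sub_1 s Hs eps He) as [K [HK HKy]].
  destruct (Hlim eps He) as [N0 HN0].
  destruct Hd as (G & q & HG & Hq & Hgeo).
  set (N := S N0). set (D := G * q ^ N).
  assert (HD : 0 <= D) by (apply Rmult_le_pos; [exact HG | apply pow_le; lra]).
  set (Kt := Cmod c * K + 4 * (D + Cmod c)).
  assert (HKt : 0 <= Kt) by (unfold Kt; nra).
  (* The first threshold puts every [n < N] at [n/x <= 1/2], and ensures [x >= 1] since [N] is a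
     successor. The second makes [Kt / x] at most [eps0 / 4]. *)
  exists (Rmax (2 * INR N) (4 * Kt / eps0)).
  intros x Hx. pose proof (Rmax_l (2 * INR N) (4 * Kt / eps0)). pose proof (Rmax_r (2 * INR N) (4 * Kt / eps0)).
  assert (HN : 1 <= INR N) by (unfold N; rewrite S_INR; pose proof (pos_INR N0); lra).
  assert (Hx0 : 0 < x) by lra.
  set (X := Cexp (- (s * RtoC (ln x)))).
  assert (HX : Cmod X <= 1).
  { unfold X. rewrite Cmod_Cexp, re_opp, re_scal_r, <- exp_0. apply exp_le.
    assert (0 <= ln x) by (rewrite <- ln_1; apply ln_le; lra). nra. }
  set (b := fun n => (eps * (Cmod c + 1)) + eps * (INR n / x) + Kt * (INR n / x - 1) ^ 2).
  assert (Hb : forall n, Cmod (X * d n + - c)%C <= b n).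
  { intros n. unfold b. set (y := INR n / x).
    assert (Hy0 : 0 <= y) by (apply Rmult_le_pos; [apply pos_INR | left; apply Rinv_0_lt_compat, Hx0]).
    pose proof (pow2_ge_0 (y - 1)) as Hy2.
    destruct (Compare_dec.le_lt_dec N n) as [Hn|Hn].
    - assert (Hn0 : 0 < INR n) by (apply lt_0_INR; unfold N in Hn; lia).
      assert (Hy : 0 < y) by (apply Rdiv_lt_0_compat; assumption).
      specialize (HN0 n ltac:(unfold N in Hn; lia)). cbv beta in HN0.
      set (r := (d n * Rcpow (INR n) (- s) - c)%C) in *.
      assert (E : (X * d n + - c = c * (Cexp (s * RtoC (ln y)) - 1) + r * Cexp (s * RtoC (ln y)))%C).
      { assert (E1 : X = (Rcpow (INR n) (- s) * Cexp (s * RtoC (ln y)))%C).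
        { unfold X, Rcpow. rewrite <- Cexp_plus. f_equal. unfold y.
          rewrite ln_div by assumption. rewrite RtoC_minus. ring. }
        rewrite E1. unfold r. ring. }
      rewrite E. eapply Rle_trans; [apply Cmod_triangle|]. rewrite !Cmod_mult.
      assert (H1 : Cmod c * Cmod (Cexp (s * RtoC (ln y)) - 1) <= Cmod c * (eps + K * (y - 1) ^ 2)).
      { apply Rmult_le_compat_l; [exact Hc | apply HKy, Hy]. }
      assert (H2 : Cmod r * Cmod (Cexp (s * RtoC (ln y))) <= eps * (1 + y)).
      { apply Rmult_le_compat; try apply Cmod_ge_0; [exact HN0|].
        rewrite Cmod_Cexp, re_scal_r. apply exp_mul_ln_le; assumption. }
      assert (0 <= 4 * (D + Cmod c) * (y - 1) ^ 2) by (apply Rmult_le_pos; lra).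
      unfold Kt. lra.
    (* Below [N] only the bound [D] on [d n] is available. There [(y - 1)^2 >= 1/4], whence the part
       [4 * (D + Cmod c)] of [Kt]. *)
    - assert (Hy : y <= 1/2).
      { unfold y. apply (Rmult_le_reg_r x); [exact Hx0|].
        replace (INR n / x * x) with (INR n) by (field; lra).
        assert (INR n <= INR N) by (apply le_INR; lia). lra. }
      eapply Rle_trans; [apply Cmod_triangle|]. rewrite Cmod_opp, Cmod_mult.
      assert (H1 : Cmod X * Cmod (d n) <= 1 * D).
      { apply Rmult_le_compat; try apply Cmod_ge_0; [exact HX|].
        eapply Rle_trans; [apply Hgeo|]. apply Rmult_le_compat_l; [exact HG|].
        apply Rle_pow; [exact Hq | lia]. }
      assert (H2 : 1/4 <= (y - 1) ^ 2) by nra.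
      assert (0 <= eps * y) by nra. assert (0 <= eps * (Cmod c + 1)) by nra.
      assert (0 <= Cmod c * K * (y - 1) ^ 2) by (apply Rmult_le_pos; nra).
      unfold Kt. nra. }
  assert (Hd : geom_bounded d) by (exists G, q; auto).
  assert (E : (egf d x * Cexp (- (RtoC x + s * RtoC (ln x))) - c =
     Cexp (- RtoC x) * egf (fun n => X * d n + - c) x)%C).
  { rewrite egf_plus, egf_scal, egf_const; auto using geom_bounded_mult, geom_bounded_const.
    replace (- (RtoC x + s * RtoC (ln x)))%C with (- RtoC x + - (s * RtoC (ln x)))%C by ring.
    rewrite Cexp_plus. fold X. rewrite <- Cexp_RtoC, Cexp_opp. field. apply Cexp_neq_0. }
  rewrite E, Cmod_mult, Cmod_Cexp, re_opp. change (Re (RtoC x)) with x.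
  assert (HB : Cmod (egf (fun n => X * d n + - c)%C x) <= 2 * ((eps * (Cmod c + 1) + eps + Kt / x) * exp x)).
  { apply egf_bound with b; [lra | | exact Hb | apply is_series_pois_quadratic, Hx0].
    apply geom_bounded_plus; [apply geom_bounded_mult|]; auto using geom_bounded_const. }
  apply Rle_trans with (exp (- x) * (2 * ((eps * (Cmod c + 1) + eps + Kt / x) * exp x))).
  { apply Rmult_le_compat_l; [left; apply exp_pos | exact HB]. }
  rewrite exp_Ropp. pose proof (exp_pos x).
  replace (/ exp x * (2 * ((eps * (Cmod c + 1) + eps + Kt / x) * exp x)))
    with (2 * (eps * (Cmod c + 2)) + 2 * (Kt / x)) by (field; lra).
  replace (eps * (Cmod c + 2)) with (eps0 / 4) by (unfold eps; field; lra).
  assert (Kt / x <= eps0 / 4); [|lra].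
  apply (Rmult_le_reg_r x); [exact Hx0|]. replace (Kt / x * x) with (Kt) by (field; lra).
  replace Kt with (4 * Kt / eps0 * (eps0 / 4)) by (field; lra).
  rewrite (Rmult_comm (eps0 / 4)). apply Rmult_le_compat_r; lra.
Qed.

Lemma Ctends_shift (f : nat -> C) (l : C) :
  Ctends eventually f l <-> Ctends eventually (fun n => f (S n)) l.
Proof.
  split; intros H eps He; destruct (H eps He) as [N HN].
  - exists N. intros n Hn. apply HN; lia.
  - exists (S N). intros [|n] Hn; [lia|]. apply HN; lia.
Qed.

Lemma Cexp_tends_1 (f : nat -> C) : Ctends eventually f 0 -> Ctends eventually (fun n => Cexp (f n)) 1.
Proof.
  intros H. apply Ctends_squeeze with (fun n => f n * RtoC (2 * exp 1))%C.
  - generalize (H 1 Rlt_0_1). apply filter_imp. intros n Hn.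
    replace (f n - 0)%C with (f n) in Hn by ring.
    eapply Rle_trans; [apply Cexp_sub_1_le|].
    pose proof (exp_pos 1). pose proof (Cmod_ge_0 (f n)).
    rewrite Cmod_mult, Cmod_R, Rabs_pos_eq by lra.
    assert (exp (Cmod (f n)) <= exp 1) by (apply exp_le, Hn).
    assert (Cmod (f n) * exp (Cmod (f n)) <= Cmod (f n) * exp 1) by (apply Rmult_le_compat_l; lra). lra.
  - replace (RtoC 0) with (0 * RtoC (2 * exp 1))%C by ring.
    apply Ctends_mult; [exact H | apply Ctends_const].
Qed.

Lemma Cinv_INR_tends : Ctends eventually (fun n => RtoC (/ INR (S n))) 0.
Proof.
  apply (Ctends_comp (Rbar_locally p_infty) eventually (fun t => RtoC (/ t)) (fun n => INR (S n))).
  - intros P [M HM]. destruct (nfloor_ex (Rabs M) (Rabs_pos M)) as [N [_ HN]].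
    exists N. intros n Hn. apply HM. rewrite S_INR. apply le_INR in Hn. pose proof (Rle_abs M). lra.
  - apply Ctends_Cinv_infty.
Qed.

Lemma Rcpow_succ_tends (s : C) :
  Ctends eventually (fun n => Rcpow (INR (S (S n))) s * Rcpow (INR (S n)) (- s))%C 1.
Proof.
  apply Ctends_ext with (fun n => Cexp (s * RtoC (ln (INR (S (S n))) - ln (INR (S n))))).
  - intros n. unfold Rcpow. rewrite <- Cexp_plus. f_equal. rewrite RtoC_minus. ring.
  - apply Cexp_tends_1. apply Ctends_squeeze with (fun n => s * RtoC (/ INR (S n)))%C.
    + apply filter_forall. intros n. pose proof (ln_succ_bounds n) as H.
      pose proof (Rinv_0_lt_compat _ (INR_S_pos n)). pose proof (Rinv_0_lt_compat _ (INR_S_pos (S n))).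
      set (e := ln _ - ln _) in *.
      replace (s * RtoC e - 0)%C with (s * RtoC e)%C by ring.
      rewrite !Cmod_mult, !Cmod_R, !Rabs_pos_eq by lra.
      apply Rmult_le_compat_l; [apply Cmod_ge_0 | lra].
    + replace (RtoC 0) with (s * 0)%C by ring. apply Ctends_mult; [apply Ctends_const | apply Cinv_INR_tends].
Qed.

Lemma Rcpow_plus (b : R) (s t : C) : Rcpow b (s + t) = (Rcpow b s * Rcpow b t)%C.
Proof. unfold Rcpow. rewrite <- Cexp_plus. f_equal. ring. Qed.

Lemma Rcpow_opp_l (b : R) (s : C) : (Rcpow b (- s) * Rcpow b s = 1)%C.
Proof. rewrite <- Rcpow_plus. unfold Rcpow. rewrite <- Cexp_0. f_equal. ring. Qed.

Lemma Rcpow_1 (b : R) : 0 < b -> Rcpow b 1 = RtoC b.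
Proof. intros Hb. unfold Rcpow. rewrite Cmult_1_l, Cexp_RtoC, exp_ln by exact Hb. reflexivity. Qed.

Lemma geom_bounded_div_INR (d : nat -> C) :
  geom_bounded d -> geom_bounded (fun n => d n / RtoC (INR (S n)))%C.
Proof.
  intros (K & q & HK & Hq & H). exists K, q. repeat split; [exact HK | exact Hq |].
  intros n. pose proof (INR_S_pos n). rewrite Cmod_div by (apply RtoC_neq_0; lra).
  rewrite Cmod_R, Rabs_pos_eq by lra.
  apply (Rmult_le_reg_r (INR (S n))); [lra|]. unfold Rdiv. rewrite Rmult_assoc, Rinv_l, Rmult_1_r by lra.
  assert (1 <= INR (S n)) by (rewrite S_INR; pose proof (pos_INR n); lra).
  specialize (H n). pose proof (Cmod_ge_0 (d n)). nra.
Qed.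

(** Dividing the shifted coefficients by the index lowers their growth from [n^(s+1)] to [n^s], and
    the factor [x] in [egf_decr] restores the lost power. The isolated term [d O] is killed by
    [exp (- x)]. With the converse step, every exponent is reached from the strip by integer
    translations. *)
Lemma abelian_succ (s : C) : abelian s -> abelian (s + 1).
Proof.
  intros IH d c Hd Hlim.
  assert (Hd' : geom_bounded (fun n => d (S n) / RtoC (INR (S n)))%C)
    by (apply (geom_bounded_div_INR (fun n => d (S n))), geom_bounded_shift, Hd).
  specialize (IH (fun n => d (S n) / RtoC (INR (S n)))%C c Hd').
  apply Ctends_ext_loc with (fun x => d O * Cexp (- (RtoC x + (s + 1) * RtoC (ln x)))
     + egf (fun n => d (S n) / RtoC (INR (S n))) x * Cexp (- (RtoC x + s * RtoC (ln x))))%C.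
  - exists 0. intros x Hx. rewrite (egf_decr d x Hd).
    replace (- (RtoC x + s * RtoC (ln x)))%C with (- (RtoC x + (s + 1) * RtoC (ln x)) + 1 * RtoC (ln x))%C by ring.
    rewrite Cexp_plus. change (Cexp (1 * RtoC (ln x))) with (Rcpow x 1). rewrite Rcpow_1 by exact Hx. ring.
  - replace c with (d O * 0 + c)%C by ring. apply Ctends_plus.
    + apply Ctends_mult; [apply Ctends_const | apply Cexp_decay_tends].
    + apply IH. apply Ctends_shift.
      apply Ctends_ext with (fun n => (d (S (S n)) * Rcpow (INR (S (S n))) (- (s + 1))) *
         (Rcpow (INR (S (S n))) s * Rcpow (INR (S n)) (- s)))%C.
      { intros n. pose proof (INR_S_pos (S n)).
        replace (- s)%C with (- (s + 1) + 1)%C at 2 by ring.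
        assert (E : (Rcpow (INR (S (S n))) (- (s + 1)) * Rcpow (INR (S (S n))) s = / RtoC (INR (S (S n))))%C).
        { rewrite <- (Rcpow_1 (INR (S (S n)))) by assumption. rewrite <- Rcpow_plus.
          replace (- (s + 1) + s)%C with (- (1))%C by ring.
          pose proof (Rcpow_opp_l (INR (S (S n))) 1) as E.
          pose proof (Rcpow_neq_0 (INR (S (S n))) 1).
          replace (Rcpow (INR (S (S n))) (- (1)))%C with (Rcpow (INR (S (S n))) (- (1)) * Rcpow (INR (S (S n))) 1 / Rcpow (INR (S (S n))) 1)%C by (field; assumption).
          rewrite E. field; assumption. }
        replace (- (s + 1) + 1)%C with (- s)%C by ring.
        unfold Cdiv. rewrite <- E. ring. }
      replace c with (c * 1)%C by ring. apply Ctends_mult; [apply (Ctends_shift (fun n => d (S n) * Rcpow (INR (S n)) (- (s + 1)))%C), (Ctends_shift (fun n => d n * Rcpow (INR n) (- (s + 1)))%C), Hlim | apply Rcpow_succ_tends].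
Qed.

Lemma abelian_pred (s : C) : abelian s -> abelian (s - 1).
Proof.
  intros IH d c Hd Hlim.
  assert (Hd' : geom_bounded (fun n => RtoC (INR n) * d (pred n))%C)
    by (apply geom_bounded_mult; [apply geom_bounded_INR | apply geom_bounded_pred, Hd]).
  specialize (IH _ c Hd').
  eapply Ctends_ext_loc; [|apply IH].
  - exists 0. intros x Hx. rewrite egf_incr by exact Hd.
    replace (- (RtoC x + (s - 1) * RtoC (ln x)))%C with (- (RtoC x + s * RtoC (ln x)) + 1 * RtoC (ln x))%C by ring.
    rewrite Cexp_plus. change (Cexp (1 * RtoC (ln x))) with (Rcpow x 1). rewrite Rcpow_1 by exact Hx. ring.
  (* Two shifts make both the index and its predecessor positive, away from the default value of
     [ln] at 0. *)
  - do 2 apply <- Ctends_shift.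
    apply Ctends_ext with (fun n => (d (S n) * Rcpow (INR (S n)) (- (s - 1))) *
         (Rcpow (INR (S (S n))) (1 - s) * Rcpow (INR (S n)) (- (1 - s))))%C.
    { intros n. pose proof (INR_S_pos (S n)). simpl pred.
      replace (1 - s)%C with (1 + - s)%C at 1 by ring. rewrite Rcpow_plus, Rcpow_1 by assumption.
      pose proof (Rcpow_opp_l (INR (S n)) (1 - s)) as E.
      replace (- (s - 1))%C with (1 - s)%C by ring.
      transitivity (d (S n) * RtoC (INR (S (S n))) * Rcpow (INR (S (S n))) (- s) *
         (Rcpow (INR (S n)) (- (1 - s)) * Rcpow (INR (S n)) (1 - s)))%C; [ring|].
      rewrite E. ring. }
    replace c with (c * 1)%C by ring.
    apply Ctends_mult; [apply -> (Ctends_shift (fun n => d n * Rcpow (INR n) (- (s - 1)))%C); exact Hlim | apply Rcpow_succ_tends].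
Qed.

Lemma abelian_all (s : C) : abelian s.
Proof.
  assert (HS : forall n s, abelian s -> abelian (s + RtoC (INR n))).
  { induction n as [|n IH]; intros t Ht.
    - simpl. rewrite Cplus_0_r. exact Ht.
    - rewrite S_INR, RtoC_plus, Cplus_assoc. apply abelian_succ, IH, Ht. }
  assert (HP : forall n s, abelian s -> abelian (s - RtoC (INR n))).
  { induction n as [|n IH]; intros t Ht.
    - simpl. replace (t - 0)%C with t by ring. exact Ht.
    - rewrite S_INR, RtoC_plus. replace (t - (INR n + 1))%C with (t - INR n - 1)%C by ring.
      apply abelian_pred, IH, Ht. }
  destruct (Rle_lt_dec 0 (Re s)) as [H|H].
  - destruct (nfloor_ex (Re s) H) as [n Hn].
    replace s with ((s - RtoC (INR n)) + RtoC (INR n))%C by ring.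
    apply HS, abelian_strip. unfold Cminus. rewrite re_plus, re_opp. simpl Re. lra.
  - destruct (nfloor_ex (- Re s) ltac:(lra)) as [n Hn].
    replace s with ((s + RtoC (INR (S n))) - RtoC (INR (S n)))%C by ring.
    apply HP, abelian_strip. rewrite re_plus, S_INR. simpl Re. lra.
Qed.

(** * Values at the origin *)

(** The quotient [(al)_n / (b)_n] of rising factorials: the coefficient of Kummer's series
    [M(al, b, x)] without the [1/n!] that [egf] supplies. *)
Fixpoint kummer_coef (al : C) (b : R) (n : nat) : C :=
  match n with
  | O => 1
  | S m => (kummer_coef al b m * (al + RtoC (INR m)) / RtoC (b + INR m))%C
  end.

Lemma kummer_coef_S (al : C) (b : R) (n : nat) : 0 < b ->
  (kummer_coef al b (S n) * RtoC (b + INR n) = kummer_coef al b n * (al + RtoC (INR n)))%C.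
Proof.
  intros Hb. cbn [kummer_coef]. pose proof (pos_INR n). field. apply RtoC_neq_0; lra.
Qed.

Lemma geom_bounded_kummer (al : C) (b : R) : 0 < b -> geom_bounded (kummer_coef al b).
Proof.
  intros Hb. pose proof (Cmod_ge_0 al) as Ha.
  assert (Hq : 0 <= Cmod al / b) by (apply Rmult_le_pos; [exact Ha | left; apply Rinv_0_lt_compat, Hb]).
  exists 1, (1 + Cmod al / b). repeat split; [lra | lra |].
  induction n as [|n IH].
  - cbn [kummer_coef pow]. rewrite Cmod_1. lra.
  - cbn [kummer_coef]. pose proof (pos_INR n).
    rewrite Cmod_div, Cmod_mult, Cmod_R, (Rabs_pos_eq (b + INR n)) by (try apply RtoC_neq_0; lra).
    replace (1 * (1 + Cmod al / b) ^ S n) with (1 * (1 + Cmod al / b) ^ n * (1 + Cmod al / b)) by (cbn [pow]; ring).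
    unfold Rdiv at 1. rewrite Rmult_assoc.
    assert (H1 : Cmod (al + INR n) * / (b + INR n) <= 1 + Cmod al / b).
    { apply (Rmult_le_reg_r (b + INR n)); [lra|]. rewrite Rmult_assoc, Rinv_l, Rmult_1_r by lra.
      eapply Rle_trans; [apply Cmod_triangle|]. rewrite Cmod_R, Rabs_pos_eq by lra.
      replace ((1 + Cmod al / b) * (b + INR n)) with (b + INR n + Cmod al + Cmod al / b * INR n) by (field; lra). nra. }
    apply Rmult_le_compat; [apply Cmod_ge_0 | | exact IH | exact H1].
    apply Rmult_le_pos; [apply Cmod_ge_0 | left; apply Rinv_0_lt_compat; lra].
Qed.

Lemma rising_prod_pos_neq_0 (b : R) (n : nat) : 0 < b -> rising_prod (RtoC b) n <> 0.
Proof.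
  intros Hb. induction n as [|n IH]; cbn [rising_prod].
  - apply RtoC_neq_0; lra.
  - apply Cmult_neq_0; [exact IH|]. rewrite <- RtoC_plus. apply RtoC_neq_0. pose proof (pos_INR (S n)). lra.
Qed.

Lemma kummer_coef_rising (al : C) (b : R) (n : nat) : 0 < b ->
  kummer_coef al b (S n) = (rising_prod al n / rising_prod (RtoC b) n)%C.
Proof.
  intros Hb. induction n as [|n IH].
  - cbn [kummer_coef rising_prod]. simpl INR. rewrite !Rplus_0_r. field. apply RtoC_neq_0; lra.
  - change (kummer_coef al b (S (S n))) with
      (kummer_coef al b (S n) * (al + RtoC (INR (S n))) / RtoC (b + INR (S n)))%C.
    rewrite IH. cbn [rising_prod]. rewrite RtoC_plus. field. split.
    + rewrite <- RtoC_plus. apply RtoC_neq_0. pose proof (pos_INR (S n)). lra.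
    + apply rising_prod_pos_neq_0, Hb.
Qed.

(** The coefficient is a quotient of two Gauss terms of the same index: the factorials cancel and
    the powers combine to [n^(al - b)]. The index is shifted because [rising_prod w n] has [n + 1]
    factors. *)
Lemma kummer_coef_tends_S (al : C) (b : R) : 0 < b -> rgamma (RtoC b) <> 0 ->
  Ctends eventually (fun n => kummer_coef al b (S n) * Rcpow (INR n) (- (al - RtoC b)))%C
    (rgamma al / rgamma (RtoC b))%C.
Proof.
  intros Hb Hg.
  apply Ctends_ext with (fun n => gauss al n * / gauss (RtoC b) n)%C.
  - intros n. rewrite kummer_coef_rising by exact Hb. unfold gauss.
    replace (- (al - RtoC b))%C with (- al + RtoC b)%C by ring. rewrite Rcpow_plus.
    pose proof (Rcpow_neq_0 (INR n) al). pose proof (Rcpow_neq_0 (INR n) (RtoC b)).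
    assert (E : Rcpow (INR n) (- al) = (/ Rcpow (INR n) al)%C).
    { unfold Rcpow. rewrite <- Cexp_opp. f_equal. ring. }
    rewrite E. field. repeat split; auto using INR_fact_C_neq_0, rising_prod_pos_neq_0.
  - apply Ctends_mult; [apply gauss_tends | apply Ctends_inv; [exact Hg | apply gauss_tends]].
Qed.

Lemma kummer_coef_tends (al : C) (b : R) : 0 < b -> rgamma (RtoC b) <> 0 ->
  Ctends eventually (fun n => kummer_coef al b n * Rcpow (INR n) (- (al - RtoC b)))%C
    (rgamma al / rgamma (RtoC b))%C.
Proof.
  intros Hb Hg. set (s := (- (al - RtoC b))%C).
  do 2 apply <- Ctends_shift.
  apply Ctends_ext with (fun n => (kummer_coef al b (S (S n)) * Rcpow (INR (S n)) s) *
    (Rcpow (INR (S (S n))) s * Rcpow (INR (S n)) (- s)))%C.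
  - intros n. transitivity (kummer_coef al b (S (S n)) * Rcpow (INR (S (S n))) s *
      (Rcpow (INR (S n)) (- s) * Rcpow (INR (S n)) s))%C; [ring|]. rewrite Rcpow_opp_l. ring.
  - replace (rgamma al / rgamma (RtoC b))%C with (rgamma al / rgamma (RtoC b) * 1)%C by ring.
    apply Ctends_mult; [|apply Rcpow_succ_tends].
    apply -> (Ctends_shift (fun n => kummer_coef al b (S n) * Rcpow (INR n) s)%C).
    apply kummer_coef_tends_S; assumption.
Qed.

(** The Gauss term of [w] and that of [w + 1] at the preceding index differ by the factor [w] and a
    ratio of powers of consecutive integers, which tends to 1. *)
Lemma rgamma_succ (w : C) : rgamma w = (w * rgamma (w + 1))%C.
Proof.
  apply (Ctends_unique eventually (fun n => gauss w (S (S n)))).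
  - apply (proj1 (Ctends_shift (fun n => gauss w (S n)) _)), (proj1 (Ctends_shift (gauss w) _)), gauss_tends.
  - apply Ctends_ext with (fun n => w * gauss (w + 1) (S n) *
      (Rcpow (INR (S (S n))) (- (w + 1)) * Rcpow (INR (S n)) (- - (w + 1))))%C.
    + intros n. replace (- - (w + 1))%C with (w + 1)%C by ring.
      assert (HR : forall m, rising_prod w (S m) = (w * rising_prod (w + 1) m)%C).
      { induction m as [|m IH]; [reflexivity|].
        change (rising_prod w (S (S m))) with (rising_prod w (S m) * (w + RtoC (INR (S (S m)))))%C.
        rewrite IH. cbn [rising_prod]. rewrite (S_INR (S m)), RtoC_plus. ring. }
      unfold gauss. rewrite HR.
      assert (E : Rcpow (INR (S (S n))) (- (w + 1)) = (/ (Rcpow (INR (S (S n))) w * RtoC (INR (S (S n)))))%C).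
      { rewrite <- (Rcpow_1 (INR (S (S n)))) by apply INR_S_pos. rewrite <- Rcpow_plus.
        unfold Rcpow. rewrite <- Cexp_opp. f_equal. ring. }
      rewrite E.
      change (fact (S (S n))) with (S (S n) * fact (S n))%nat. rewrite mult_INR, RtoC_mult.
      pose proof (INR_S_pos (S n)).
      field. repeat split; auto using Rcpow_neq_0, INR_fact_C_neq_0. apply RtoC_neq_0; lra.
    + replace (w * rgamma (w + 1))%C with (w * rgamma (w + 1) * 1)%C by ring.
      apply Ctends_mult; [apply Ctends_mult; [apply Ctends_const|] | apply Rcpow_succ_tends].
      apply (proj1 (Ctends_shift (gauss (w + 1)) _)), gauss_tends.
Qed.

(** * Kummer's function and the Wronskian *)

Definition kummerM (al : C) (b x : R) : C := egf (kummer_coef al b) x.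
Definition kummerM1 (al : C) (b x : R) : C := egf (fun n => kummer_coef al b (S n)) x.
Definition kummerM2 (al : C) (b x : R) : C := egf (fun n => kummer_coef al b (S (S n))) x.

Lemma is_derive_kummerM (al : C) (b x : R) : 0 < b ->
  is_derive (kummerM al b) x (kummerM1 al b x) /\ is_derive (kummerM1 al b) x (kummerM2 al b x).
Proof.
  intros Hb. pose proof (geom_bounded_kummer al b Hb) as H. split.
  - apply is_derive_egf, H.
  - apply (is_derive_egf (fun n => kummer_coef al b (S n))), geom_bounded_shift, H.
Qed.

Lemma kummer_ode (al : C) (b x : R) : 0 < b ->
  (RtoC x * kummerM2 al b x + RtoC b * kummerM1 al b x
   = RtoC x * kummerM1 al b x + al * kummerM al b x)%C.
Proof.
  intros Hb. unfold kummerM, kummerM1, kummerM2.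
  pose proof (geom_bounded_kummer al b Hb) as H0.
  pose proof (geom_bounded_shift _ H0) as H1. pose proof (geom_bounded_shift _ H1) as H2.
  cbv beta in H1, H2.
  rewrite <- (egf_incr _ x H2), <- (egf_incr _ x H1), <- (egf_scal _ _ x H0), <- (egf_scal _ _ x H1).
  pose proof (geom_bounded_pred _ H1). pose proof (geom_bounded_pred _ H2).
  rewrite <- !egf_plus by auto using geom_bounded_mult, geom_bounded_INR, geom_bounded_const.
  apply egf_ext. intros n.
  pose proof (kummer_coef_S al b n Hb) as E. rewrite RtoC_plus in E.
  destruct n as [|n].
  - simpl INR in *. rewrite !Cmult_0_l, !Cplus_0_l. rewrite !Cplus_0_r in E. rewrite Cmult_comm, E. ring.
  - simpl pred. transitivity (kummer_coef al b (S (S n)) * (RtoC b + RtoC (INR (S n))))%C; [ring|].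
    rewrite E. ring.
Qed.

Lemma kummerM_0 (al : C) (b : R) : 0 < b -> kummerM al b 0 = 1.
Proof.
  intros Hb. unfold kummerM. rewrite egf_decr by apply geom_bounded_kummer, Hb.
  cbn [kummer_coef]. ring.
Qed.

Lemma filterlim_half_sqr :
  filterlim (fun t => t ^ 2 / 2) (Rbar_locally p_infty) (Rbar_locally p_infty).
Proof.
  intros P [M HM]. exists (Rmax 2 M). intros t Ht. apply HM.
  pose proof (Rmax_l 2 M). pose proof (Rmax_r 2 M). nra.
Qed.

(** In the variable [t] the power [(t^2/2)^s] is [t^(2 s)] times [2^(-s)]: the origin of the powers
    of 2 in the values at 0. *)
Lemma egf_half_sqr_tends (d : nat -> C) (s c : C) : geom_bounded d ->
  Ctends eventually (fun n => d n * Rcpow (INR n) (- s))%C c ->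
  Ctends (Rbar_locally p_infty)
    (fun t => egf d (t ^ 2 / 2) * Cexp (- (RtoC (t ^ 2 / 2) + 2 * s * RtoC (ln t))))%C
    (c * Rcpow 2 (- s))%C.
Proof.
  intros Hd Hc.
  pose proof (Ctends_comp _ _ _ _ _ filterlim_half_sqr (abelian_all s d c Hd Hc)) as H.
  apply Ctends_ext_loc with (fun t => (egf d (t ^ 2 / 2) *
    Cexp (- (RtoC (t ^ 2 / 2) + s * RtoC (ln (t ^ 2 / 2))))) * Rcpow 2 (- s))%C.
  - exists 0. intros t Ht. rewrite <- Cmult_assoc. unfold Rcpow. rewrite <- Cexp_plus. do 2 f_equal.
    rewrite ln_div, ln_pow by (try apply pow_lt; lra). rewrite RtoC_minus, RtoC_mult.
    replace (INR 2) with 2 by (simpl; ring). ring.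
  - apply Ctends_mult; [exact H | apply Ctends_const].
Qed.

Lemma Ctends_derive_0 (f df : R -> C) (l : C) :
  (forall t, is_derive f t (df t)) ->
  Ctends (Rbar_locally p_infty) f 0 -> Ctends (Rbar_locally p_infty) df l -> l = 0.
Proof.
  intros Hd Hf Hdf. apply Cmod_eq_0, Rle_antisym; [|apply Cmod_ge_0].
  (* Over [[t, t + 1]] the increment of [f] is at most [2 e] and differs from [l] by at most [2 e],
     so that [Cmod l] would be at most [4 e]. *)
  apply Rnot_lt_le. intros Hl. set (e := Cmod l / 5).
  assert (He : 0 < e) by (unfold e; lra).
  destruct (Hf e He) as [M1 H1]. destruct (Hdf e He) as [M2 H2].
  set (t := Rmax M1 M2 + 1). pose proof (Rmax_l M1 M2). pose proof (Rmax_r M1 M2).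
  pose proof (H1 t ltac:(unfold t; lra)) as Ht. pose proof (H1 (t + 1) ltac:(unfold t; lra)) as Ht1.
  cbv beta in Ht, Ht1.
  assert (HV : Cmod ((f (t + 1)%R - RtoC (t + 1) * l) - (f t - RtoC t * l))%C <= 2 * e * Rabs (t + 1 - t)).
  { apply (C_bounded_variation (fun t => f t - RtoC t * l)%C (fun t => df t - l)%C).
    intros u Hu. rewrite Rmin_left, Rmax_right in Hu by lra. split.
    - eapply is_derive_Ceq.
      + apply is_derive_Cminus; [apply Hd|].
        apply is_derive_Cmult; [apply is_derive_RtoC, is_derive_id | apply is_derive_Cconst].
      + change (@one R_AbsRing) with 1. cbv beta. ring.
    - apply H2. unfold t in Hu. lra. }
  replace (t + 1 - t) with 1 in HV by ring. rewrite Rabs_R1 in HV.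
  assert (Cmod l <= Cmod (f (t + 1)%R - 0) + Cmod (f t - 0) + Cmod (f (t + 1)%R - RtoC (t + 1) * l - (f t - RtoC t * l))); [|unfold e in *; lra].
  rewrite <- (Cmod_opp (f t - 0)), <- (Cmod_opp (_ - (f t - _))).
  replace l with ((f (t + 1)%R - 0) + - (f t - 0) + - (f (t + 1)%R - RtoC (t + 1) * l - (f t - RtoC t * l)))%C at 1
    by (rewrite RtoC_plus; ring).
  eapply Rle_trans; [apply Cmod_triangle|]. apply Rplus_le_compat_r, Cmod_triangle.
Qed.

(* [2 U u' = W + (U u)'] and [U u -> 0], so the constant Wronskian [W] is the limit of [2 U u'];
   no asymptotics of [U'] is needed. *)
Lemma pcf_wronskian (a : C) (U U' u u' : R -> C) (A : C) :
  is_PCU a U U' ->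
  (forall t, is_derive u t (u' t)) ->
  (forall t, is_derive u' t ((RtoC (t ^ 2 / 4) + a) * u t)%C) ->
  Ctends (Rbar_locally p_infty)
    (fun t => u t * Cexp (- (RtoC (t ^ 2 / 4) + (a - RtoC (1/2)) * RtoC (ln t))))%C A ->
  Ctends (Rbar_locally p_infty)
    (fun t => u' t * Cexp (- (RtoC (t ^ 2 / 4) + (a + RtoC (1/2)) * RtoC (ln t))))%C (A * RtoC (1/2))%C ->
  (U 0 * u' 0 - U' 0 * u 0 = A)%C.
Proof.
  intros (HU & HU' & Hlim) Hu Hu' HA HA'.
  apply Ctends_filterlim in Hlim.
  set (W := (U 0%R * u' 0%R - U' 0%R * u 0%R)%C).
  assert (HW : forall t, (U t * u' t - U' t * u t)%C = W).
  { intros t. apply (C_constant (fun t => U t * u' t - U' t * u t)%C t 0). intros x.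
    eapply is_derive_Ceq.
    - apply is_derive_Cminus; apply is_derive_Cmult; auto.
    - ring. }
  assert (H1 : Ctends (Rbar_locally p_infty) (fun t => U t * u' t)%C (A * RtoC (1/2))%C).
  { replace (A * RtoC (1/2))%C with (1 * (A * RtoC (1/2)))%C by ring.
    eapply Ctends_ext; [|apply (Ctends_mult _ _ _ _ Hlim HA')].
    intros t. cbv beta.
    replace (- (RtoC (t ^ 2 / 4) + (a + RtoC (1/2)) * RtoC (ln t)))%C
      with (- ((a + RtoC (1/2)) * RtoC (ln t) + RtoC (t ^ 2 / 4)))%C by ring.
    rewrite Cexp_opp. field. apply Cexp_neq_0. }
  (* The exponentials cancel and the powers [t^(-a-1/2)] and [t^(a-1/2)] multiply to [1/t]. *)
  assert (H0 : Ctends (Rbar_locally p_infty) (fun t => U t * u t)%C 0).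
  { replace (RtoC 0) with (1 * A * 0)%C by ring.
    eapply Ctends_ext_loc; [|apply (Ctends_mult _ _ _ _ (Ctends_mult _ _ _ _ Hlim HA) Ctends_Cinv_infty)].
    exists 0. intros t Ht. cbv beta.
    assert (E : (RtoC (/ t) = Cexp (- RtoC (ln t)))%C).
    { rewrite Cexp_opp, Cexp_RtoC, exp_ln by exact Ht. rewrite RtoC_inv by lra. reflexivity. }
    rewrite E.
    transitivity (U t * u t * (Cexp ((a + RtoC (1/2)) * RtoC (ln t) + RtoC (t ^ 2 / 4)) *
      (Cexp (- (RtoC (t ^ 2 / 4) + (a - RtoC (1/2)) * RtoC (ln t))) * Cexp (- RtoC (ln t)))))%C; [ring|].
    rewrite <- !Cexp_plus.
    replace (_ + _)%C with (RtoC (1/2) * 2 * RtoC (ln t) - RtoC (ln t))%C by ring.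
    rewrite <- RtoC_mult. replace (1/2*2) with 1 by field.
    replace (1 * RtoC (ln t) - RtoC (ln t))%C with (RtoC 0) by ring. rewrite Cexp_0. ring. }
  assert (E : (A - W)%C = 0).
  { apply (Ctends_derive_0 (fun t => U t * u t)%C (fun t => 2 * (U t * u' t) + - W)%C).
    - intros t. eapply is_derive_Ceq; [apply is_derive_Cmult; auto|]. rewrite <- (HW t). ring.
    - exact H0.
    - replace (A - W)%C with (2 * (A * RtoC (1/2)) + - W)%C.
      + apply Ctends_plus; [apply Ctends_mult; [apply Ctends_const | exact H1] | apply Ctends_const].
      + transitivity (RtoC (2 * (1/2)) * A - W)%C; [rewrite RtoC_mult; ring|].
        replace (2 * (1/2)) with 1 by field. ring. }
  symmetry. apply Ceq_minus. exact E.
Qed.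

Lemma rgamma_half_neq_0 : rgamma (RtoC (1/2)) <> 0.
Proof.
  rewrite rgamma_half. apply RtoC_neq_0, Rinv_neq_0_compat, Rgt_not_eq, sqrt_lt_R0, PI_RGT_0.
Qed.

Lemma rgamma_three_halves : rgamma (RtoC (3/2)) = RtoC (2 * / sqrt PI).
Proof.
  pose proof (rgamma_succ (RtoC (1/2))) as E. rewrite rgamma_half, <- RtoC_plus in E.
  replace (1/2 + 1) with (3/2) in E by field.
  rewrite RtoC_mult, E, Cmult_assoc, <- RtoC_mult.
  replace (2 * (1/2)) with 1 by field. ring.
Qed.

Lemma is_derive_half_sqr (t : R) : is_derive (fun t => t ^ 2 / 2) t t.
Proof. auto_derive; trivial. field. Qed.

Lemma is_derive_gaussian (t : R) :
  is_derive (fun t : R => Cexp (- RtoC (t ^ 2 / 4))) t (- RtoC (t / 2) * Cexp (- RtoC (t ^ 2 / 4)))%C.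
Proof.
  apply is_derive_Cexp, is_derive_Copp, is_derive_RtoC. auto_derive; trivial. field.
Qed.

Lemma is_derive_kummer_sqr (al : C) (b t : R) : 0 < b ->
  is_derive (fun t : R => kummerM al b (t ^ 2 / 2)) t (RtoC t * kummerM1 al b (t ^ 2 / 2))%C /\
  is_derive (fun t : R => kummerM1 al b (t ^ 2 / 2)) t (RtoC t * kummerM2 al b (t ^ 2 / 2))%C.
Proof.
  intros Hb. destruct (is_derive_kummerM al b (t ^ 2 / 2) Hb) as [H1 H2].
  split; apply is_derive_Ccomp with (g := fun t => t ^ 2 / 2); auto using is_derive_half_sqr.
Qed.

Lemma kummer_sqr_tends (al : C) (b : R) : 0 < b -> rgamma (RtoC b) <> 0 ->
  let L := (rgamma al / rgamma (RtoC b) * Rcpow 2 (- (al - RtoC b)))%C in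
  let E t := Cexp (- (RtoC (t ^ 2 / 2) + 2 * (al - RtoC b) * RtoC (ln t))) in
  Ctends (Rbar_locally p_infty) (fun t => kummerM al b (t ^ 2 / 2) * E t)%C L /\
  Ctends (Rbar_locally p_infty) (fun t => kummerM1 al b (t ^ 2 / 2) * E t)%C L.
Proof.
  intros Hb Hg L E. pose proof (geom_bounded_kummer al b Hb) as H. split.
  - apply egf_half_sqr_tends; [exact H | apply kummer_coef_tends; assumption].
  - apply (egf_half_sqr_tends (fun n => kummer_coef al b (S n)));
      [apply geom_bounded_shift, H | apply kummer_coef_tends_S; assumption].
Qed.

Lemma Cexp_ln (t : R) : 0 < t -> Cexp (RtoC (ln t)) = RtoC t.
Proof. intros Ht. rewrite Cexp_RtoC, exp_ln by exact Ht. reflexivity. Qed.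

Lemma RtoC_half_sqr (t : R) : RtoC (t ^ 2 / 2) = (RtoC t * RtoC t / RtoC 2)%C.
Proof. rewrite <- RtoC_mult, <- RtoC_div by lra. f_equal. field. Qed.

Lemma RtoC_quarter_sqr (t : R) : RtoC (t ^ 2 / 4) = (RtoC t * RtoC t / RtoC 4)%C.
Proof. rewrite <- RtoC_mult, <- RtoC_div by lra. f_equal. field. Qed.

Lemma RtoC_2_neq_0 : RtoC 2 <> 0.
Proof. apply RtoC_neq_0; lra. Qed.

Lemma RtoC_4_neq_0 : RtoC 4 <> 0.
Proof. apply RtoC_neq_0; lra. Qed.

(** Here [u] is the even solution [exp(-t^2/4) M(a/2 + 1/4, 1/2, t^2/2)], with [u 0 = 1] and
    [u' 0 = 0], so that the Wronskian is [- U' 0]. *)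
Lemma pcf_derive_at_0 (a : C) (U U' : R -> C) : is_PCU a U U' ->
  U' 0 = (- (RtoC (sqrt PI) * Rcpow 2 (- (a / RtoC 2 - RtoC (1/4)))
           * rgamma (a / RtoC 2 + RtoC (1/4))))%C.
Proof.
  intros HP. set (al := (a / RtoC 2 + RtoC (1/4))%C).
  pose proof RtoC_2_neq_0 as N2. pose proof RtoC_4_neq_0 as N4.
  assert (Hb : 0 < 1/2) by lra.
  assert (Es : (al - RtoC (1/2) = a / RtoC 2 - RtoC (1/4))%C).
  { unfold al. rewrite !RtoC_div by lra. field; auto. }
  destruct (kummer_sqr_tends al (1/2) Hb rgamma_half_neq_0) as [T0 T1]. cbv zeta in T0, T1.
  rewrite Es in T0, T1.
  set (A := (rgamma al / rgamma (RtoC (1/2)) * Rcpow 2 (- (a / RtoC 2 - RtoC (1/4))))%C) in *.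
  set (g := fun t : R => Cexp (- RtoC (t ^ 2 / 4))).
  set (M := fun t : R => kummerM al (1/2) (t ^ 2 / 2)) in *.
  set (M1 := fun t : R => kummerM1 al (1/2) (t ^ 2 / 2)) in *.
  set (M2 := fun t : R => kummerM2 al (1/2) (t ^ 2 / 2)).
  assert (Dg : forall t, is_derive g t (- RtoC (t / 2) * g t)%C) by apply is_derive_gaussian.
  assert (DM : forall t, is_derive M t (RtoC t * M1 t)%C) by (intros t; exact (proj1 (is_derive_kummer_sqr al (1/2) t Hb))).
  assert (DM1 : forall t, is_derive M1 t (RtoC t * M2 t)%C) by (intros t; exact (proj2 (is_derive_kummer_sqr al (1/2) t Hb))).
  set (u := fun t : R => (g t * M t)%C).
  set (u' := fun t : R => (RtoC t * (g t * (M1 t - RtoC (1/2) * M t)))%C).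
  assert (W : (U 0 * u' 0 - U' 0 * u 0 = A)%C).
  { apply (pcf_wronskian a U U' u u' A HP).
    - intros t. eapply is_derive_Ceq; [apply is_derive_Cmult; auto|].
      unfold u'. rewrite !RtoC_div by lra. field; auto.
    - intros t. eapply is_derive_Ceq.
      + apply is_derive_Cmult; [apply is_derive_RtoC, is_derive_id|].
        apply is_derive_Cmult; [apply Dg|].
        apply is_derive_Cminus; [apply DM1|].
        apply is_derive_Cmult; [apply is_derive_Cconst | apply DM].
      + change (@one R_AbsRing) with 1. cbv beta.
        pose proof (kummer_ode al (1/2) (t ^ 2 / 2) Hb) as O. apply Ceq_minus in O.
        fold (M t) (M1 t) (M2 t) in O. unfold u.
        apply Ceq_minus.
        (* The defect of [u] in the parabolic cylinder equation is [2 * g t] times the defect of [M]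
           in Kummer's equation at [t^2/2]. *)
        match type of O with ?L = _ => transitivity (2 * g t * L)%C end; [|rewrite O; ring].
        unfold al. rewrite RtoC_quarter_sqr, RtoC_half_sqr, !RtoC_div by lra. field; auto.
    - eapply Ctends_ext; [|exact T0]. intros t. cbv beta. unfold u, g.
      transitivity (M t * (Cexp (- RtoC (t ^ 2 / 4)) *
        Cexp (- (RtoC (t ^ 2 / 4) + (a - RtoC (1/2)) * RtoC (ln t)))))%C; [|unfold M; ring].
      rewrite <- Cexp_plus. do 2 f_equal.
      rewrite RtoC_quarter_sqr, RtoC_half_sqr, !RtoC_div by lra. field; auto.
    (* [M] and [M1] have the same leading behaviour, so [M1 - M/2] keeps half of it. *)
    - assert (T2 := Ctends_plus _ _ _ _ T1 (Ctends_mult _ _ _ _ (Ctends_const (- RtoC (1/2))%C) T0)).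
      replace (A * RtoC (1/2))%C with (A + - RtoC (1/2) * A)%C by (rewrite !RtoC_div by lra; field; auto).
      eapply Ctends_ext_loc; [|exact T2]. exists 0. intros t Ht. cbv beta. unfold u', g.
      set (E := Cexp (- (RtoC (t ^ 2 / 2) + 2 * (a / RtoC 2 - RtoC (1/4)) * RtoC (ln t)))).
      transitivity (E * (M1 t - RtoC (1/2) * M t))%C; [unfold M, M1; rewrite !RtoC_div by lra; field; auto|].
      replace E with (Cexp (RtoC (ln t)) * (Cexp (- RtoC (t ^ 2 / 4)) *
        Cexp (- (RtoC (t ^ 2 / 4) + (a + RtoC (1/2)) * RtoC (ln t)))))%C.
      { rewrite Cexp_ln by exact Ht. ring. }
      rewrite <- !Cexp_plus. unfold E. f_equal.
      rewrite RtoC_quarter_sqr, RtoC_half_sqr, !RtoC_div by lra. field; auto. }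
  assert (E0 : (U 0 * u' 0 - U' 0 * u 0 = - U' 0)%C).
  { unfold u, u', g, M. replace (0 ^ 2 / 2) with 0 by field. replace (0 ^ 2 / 4) with 0 by field.
    rewrite kummerM_0, Copp_0, Cexp_0 by exact Hb. ring. }
  rewrite E0 in W. replace (U' 0) with (- - U' 0)%C by ring. rewrite W. unfold A.
  assert (Hs : sqrt PI <> 0) by (apply Rgt_not_eq, sqrt_lt_R0, PI_RGT_0).
  rewrite rgamma_half, RtoC_inv by exact Hs. field. apply RtoC_neq_0, Hs.
Qed.

(** Here [u] is the odd solution [t exp(-t^2/4) M(a/2 + 3/4, 3/2, t^2/2)], with [u 0 = 0] and
    [u' 0 = 1], so that the Wronskian is [U 0]. *)
Lemma pcf_at_0 (a : C) (U U' : R -> C) : is_PCU a U U' ->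
  U 0 = (RtoC (sqrt PI) * Rcpow 2 (- (a / RtoC 2 + RtoC (1/4)))
           * rgamma (a / RtoC 2 + RtoC (3/4)))%C.
Proof.
  intros HP. set (al := (a / RtoC 2 + RtoC (3/4))%C).
  pose proof RtoC_2_neq_0 as N2. pose proof RtoC_4_neq_0 as N4.
  assert (Hs : sqrt PI <> 0) by (apply Rgt_not_eq, sqrt_lt_R0, PI_RGT_0).
  assert (Hb : 0 < 3/2) by lra.
  assert (Hg : rgamma (RtoC (3/2)) <> 0).
  { rewrite rgamma_three_halves. apply RtoC_neq_0, Rmult_integral_contrapositive_currified; [lra|].
    apply Rinv_neq_0_compat, Hs. }
  assert (Es : (al - RtoC (3/2) = a / RtoC 2 - RtoC (3/4))%C).
  { unfold al. rewrite !RtoC_div by lra. field; auto. }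
  destruct (kummer_sqr_tends al (3/2) Hb Hg) as [T0 T1]. cbv zeta in T0, T1.
  rewrite Es in T0, T1.
  set (A := (rgamma al / rgamma (RtoC (3/2)) * Rcpow 2 (- (a / RtoC 2 - RtoC (3/4))))%C) in *.
  set (g := fun t : R => Cexp (- RtoC (t ^ 2 / 4))).
  set (M := fun t : R => kummerM al (3/2) (t ^ 2 / 2)) in *.
  set (M1 := fun t : R => kummerM1 al (3/2) (t ^ 2 / 2)) in *.
  set (M2 := fun t : R => kummerM2 al (3/2) (t ^ 2 / 2)).
  assert (Dg : forall t, is_derive g t (- RtoC (t / 2) * g t)%C) by apply is_derive_gaussian.
  assert (DM : forall t, is_derive M t (RtoC t * M1 t)%C) by (intros t; exact (proj1 (is_derive_kummer_sqr al (3/2) t Hb))).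
  assert (DM1 : forall t, is_derive M1 t (RtoC t * M2 t)%C) by (intros t; exact (proj2 (is_derive_kummer_sqr al (3/2) t Hb))).
  assert (Did : forall t : R, is_derive (fun t : R => RtoC t) t (RtoC 1)).
  { intros t. apply is_derive_RtoC. exact (@is_derive_id R_AbsRing t). }
  set (u := fun t : R => (RtoC t * (g t * M t))%C).
  set (u' := fun t : R => (g t * (M t + RtoC t * RtoC t * (M1 t - RtoC (1/2) * M t)))%C).
  assert (W : (U 0 * u' 0 - U' 0 * u 0 = A)%C).
  { apply (pcf_wronskian a U U' u u' A HP).
    - intros t. eapply is_derive_Ceq.
      + apply is_derive_Cmult; [apply Did | apply is_derive_Cmult; auto].
      + unfold u'. rewrite !RtoC_div by lra. field; auto.
    - intros t. eapply is_derive_Ceq.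
      + apply is_derive_Cmult; [apply Dg|].
        apply is_derive_Cplus; [apply DM|].
        apply is_derive_Cmult; [apply is_derive_Cmult; apply Did|].
        apply is_derive_Cminus; [apply DM1|].
        apply is_derive_Cmult; [apply is_derive_Cconst | apply DM].
      + pose proof (kummer_ode al (3/2) (t ^ 2 / 2) Hb) as O. apply Ceq_minus in O.
        fold (M t) (M1 t) (M2 t) in O. unfold u.
        apply Ceq_minus.
        match type of O with ?L = _ => transitivity (2 * RtoC t * g t * L)%C end; [|rewrite O; ring].
        unfold al. rewrite RtoC_quarter_sqr, RtoC_half_sqr, !RtoC_div by lra. field; auto.
    - eapply Ctends_ext_loc; [|exact T0]. exists 0. intros t Ht. cbv beta. unfold u, g.
      rewrite <- (Cexp_ln t Ht).
      transitivity (M t * (Cexp (RtoC (ln t)) * (Cexp (- RtoC (t ^ 2 / 4)) *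
        Cexp (- (RtoC (t ^ 2 / 4) + (a - RtoC (1/2)) * RtoC (ln t))))))%C; [|unfold M; ring].
      rewrite <- !Cexp_plus. unfold M. do 2 f_equal.
      rewrite RtoC_quarter_sqr, RtoC_half_sqr, !RtoC_div by lra. field; auto.
    - assert (T2 := Ctends_plus _ _ _ _ T1 (Ctends_mult _ _ _ _ (Ctends_const (- RtoC (1/2))%C) T0)).
      (* The factor [t] of [u] leaves in [u'] a term [g * M], smaller than the others by [1/t^2]. *)
      assert (T3 := Ctends_mult _ _ _ _ (Ctends_mult _ _ _ _ Ctends_Cinv_infty Ctends_Cinv_infty) T0).
      replace (A * RtoC (1/2))%C with (A + - RtoC (1/2) * A + 0 * 0 * A)%C by (rewrite !RtoC_div by lra; field; auto).
      eapply Ctends_ext_loc; [|exact (Ctends_plus _ _ _ _ T2 T3)]. exists 0. intros t Ht. cbv beta. unfold u', g.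
      set (E := Cexp (- (RtoC (t ^ 2 / 2) + 2 * (a / RtoC 2 - RtoC (3/4)) * RtoC (ln t)))).
      assert (Nt : RtoC t <> 0) by (apply RtoC_neq_0; lra).
      rewrite RtoC_inv by lra.
      transitivity (E / (RtoC t * RtoC t) * (M t + RtoC t * RtoC t * (M1 t - RtoC (1/2) * M t)))%C;
        [unfold M, M1; rewrite !RtoC_div by lra; field; auto|].
      replace E with (Cexp (RtoC (ln t)) * (Cexp (RtoC (ln t)) * (Cexp (- RtoC (t ^ 2 / 4)) *
        Cexp (- (RtoC (t ^ 2 / 4) + (a + RtoC (1/2)) * RtoC (ln t))))))%C.
      { rewrite Cexp_ln by exact Ht. field; auto. }
      rewrite <- !Cexp_plus. unfold E. f_equal.
      rewrite RtoC_quarter_sqr, RtoC_half_sqr, !RtoC_div by lra. field; auto. }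
  assert (E0 : (U 0 * u' 0 - U' 0 * u 0 = U 0)%C).
  { unfold u, u', g, M. replace (0 ^ 2 / 2) with 0 by field. replace (0 ^ 2 / 4) with 0 by field.
    rewrite kummerM_0, Copp_0, Cexp_0 by exact Hb. ring. }
  rewrite E0 in W. rewrite W. unfold A.
  rewrite rgamma_three_halves, RtoC_mult, RtoC_inv by exact Hs.
  replace (- (a / RtoC 2 - RtoC (3/4)))%C with (- (a / RtoC 2 + RtoC (1/4)) + 1)%C
    by (rewrite !RtoC_div by lra; field; auto).
  rewrite Rcpow_plus, Rcpow_1 by lra. field. apply RtoC_neq_0, Hs.
Qed.

(** * Laplace transforms *)

Lemma norm_C_R (z : C) : @norm R_AbsRing C_R_NormedModule z = Cmod z.
Proof.
  change (sqrt (Rabs (fst z) ^ 2 + Rabs (snd z) ^ 2) = Cmod z). unfold Cmod.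
  rewrite <- !Rsqr_pow2, <- !Rsqr_abs. reflexivity.
Qed.

Lemma is_derive_continuous (f : R -> C) (t : R) (l : C) : is_derive f t l -> continuous f t.
Proof. intros H. apply (@ex_derive_continuous R_AbsRing C_R_NormedModule). eexists. exact H. Qed.

Lemma is_derive_eps (f : R -> C) (u : R) (l : C) :
  is_derive f u l <->
  forall eps, 0 < eps -> exists d, 0 < d /\ forall v, Rabs (v - u) < d ->
    Cmod (f v - f u - RtoC (v - u) * l)%C <= eps * Rabs (v - u).
Proof.
  assert (E : forall v, minus (minus (f v) (f u)) (@scal R_AbsRing C_R_NormedModule (minus v u) l)
    = (f v - f u - RtoC (v - u) * l)%C).
  { intros v. rewrite scal_R_Cmult. reflexivity. }
  split.
  - intros [_ H] eps He.
    destruct (H u (fun P HP => HP) (mkposreal eps He)) as [d Hd].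
    exists d. split; [apply cond_pos|]. intros v Hv. specialize (Hd v Hv). cbv beta in Hd.
    rewrite <- E, <- norm_C_R. exact Hd.
  - intros H. split; [apply is_linear_scal_l|].
    intros x Hx. rewrite <- (@is_filter_lim_locally_unique R_AbsRing R_NormedModule u x Hx). clear x Hx.
    intros [eps He]. destruct (H eps He) as [d [Hd Hv]].
    exists (mkposreal d Hd). intros v Hb. specialize (Hv v Hb).
    rewrite <- E, <- norm_C_R in Hv. exact Hv.
Qed.

Lemma antiderivative_exp_bound (f Phi : R -> C) (K : R) :
  (forall t, continuous f t) -> (forall t, is_derive Phi t (f t)) ->
  (forall t, 0 <= t -> Cmod (f t) <= K * exp (- t)) ->
  forall s t, 0 <= s <= t -> Cmod (Phi t - Phi s)%C <= K * (exp (- s) - exp (- t)).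
Proof.
  intros Hc Hd Hb s t Hst.
  assert (I1 : is_RInt f s t (minus (Phi t) (Phi s))).
  { apply (@is_RInt_derive C_R_CompleteNormedModule Phi f); intros; auto. }
  assert (I2 : is_RInt (fun t => K * exp (- t)) s t (minus (- K * exp (- t)) (- K * exp (- s)))).
  { apply (is_RInt_derive (fun t => - K * exp (- t)) (fun t => K * exp (- t))).
    - intros x _. auto_derive; trivial. ring.
    - intros x _. apply (ex_derive_continuous (fun t => K * exp (- t))). auto_derive; trivial. }
  rewrite <- norm_C_R.
  assert (H := norm_RInt_le f (fun t => K * exp (- t)) s t
    (minus (Phi t) (Phi s)) (minus (- K * exp (- t)) (- K * exp (- s))) (proj2 Hst)).
  change (minus (- K * exp (- t)) (- K * exp (- s))) with (- K * exp (- t) + - (- K * exp (- s))) in *.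
  eapply Rle_trans; [apply H|]; [|exact I1 | exact I2 | apply Req_le; ring].
  intros x Hx. rewrite norm_C_R. apply Hb. lra.
Qed.

Definition improper (f : R -> C) : C :=
  @RInt_gen C_R_CompleteNormedModule f (at_point 0) (Rbar_locally p_infty).

Lemma improper_eq (f Phi : R -> C) (l : C) :
  (forall t, continuous f t) -> (forall t, is_derive Phi t (f t)) ->
  Ctends (Rbar_locally p_infty) Phi l -> improper f = (l - Phi 0)%C.
Proof.
  intros Hc Hd Hl. unfold improper.
  apply (@is_RInt_gen_unique C_R_CompleteNormedModule (at_point 0) (Rbar_locally p_infty)
    (Proper_StrongProper _ _) (Proper_StrongProper _ _) f (l - Phi 0)%C).
  assert (Hl' : filterlim (fun t => Phi t - Phi 0)%C (Rbar_locally p_infty) (locally (l - Phi 0)%C)).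
  { apply Ctends_filterlim. intros eps He. generalize (Hl eps He). apply filter_imp. intros t Ht.
    replace (Phi t - Phi 0%R - (l - Phi 0%R))%C with (Phi t - l)%C by ring. exact Ht. }
  intros P HP. specialize (Hl' P HP).
  apply (Filter_prod _ _ _ (fun a => a = 0) (fun b => P (Phi b - Phi 0)%C)); [reflexivity | exact Hl' |].
  intros x y -> Hy. exists (Phi y - Phi 0)%C. split; [|exact Hy].
  apply (@is_RInt_derive C_R_CompleteNormedModule Phi f); intros; auto.
Qed.

(** Every later property of the integrals passes through such a primitive: linearity, integration by
    parts and expansions become statements about derivatives and one limit, converted back by
    [improper_eq]. *)
Lemma improper_correct (f : R -> C) (K : R) :
  (forall t, continuous f t) -> (forall t, 0 <= t -> Cmod (f t) <= K * exp (- t)) ->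
  exists Phi : R -> C, Phi 0 = 0 /\ (forall t, is_derive Phi t (f t)) /\
    Ctends (Rbar_locally p_infty) Phi (improper f).
Proof.
  intros Hc Hb. set (Phi := fun t => @RInt C_R_CompleteNormedModule f 0 t).
  assert (HI : forall t, is_RInt f 0 t (Phi t)).
  { intros t. apply (@RInt_correct C_R_CompleteNormedModule), (@ex_RInt_continuous C_R_CompleteNormedModule).
    intros; apply Hc. }
  assert (Hd : forall t, is_derive Phi t (f t)).
  { intros t. apply (@is_derive_RInt C_R_NormedModule f Phi 0 t); [|apply Hc].
    apply filter_forall. exact HI. }
  assert (H0 : Phi 0 = RtoC 0) by apply (@RInt_point C_R_CompleteNormedModule).
  exists Phi. split; [exact H0|]. split; [exact Hd|].
  pose proof (antiderivative_exp_bound f Phi K Hc Hd Hb) as HB.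
  assert (HK : 0 <= K).
  { specialize (Hb 0 (Rle_refl 0)). rewrite Ropp_0, exp_0 in Hb. pose proof (Cmod_ge_0 (f 0)). lra. }
  enough (HL : exists l : C, filterlim Phi (Rbar_locally p_infty) (locally l)).
  { destruct HL as [l Hl]. apply Ctends_filterlim in Hl.
    rewrite (improper_eq f Phi l Hc Hd Hl), H0. replace (l - 0)%C with l by ring. exact Hl. }
  apply (@filterlim_locally_cauchy R
     (CompleteNormedModule.CompleteSpace _ C_CompleteNormedModule) (Rbar_locally p_infty) _ Phi).
  intros eps.
  assert (He : 0 < eps / (2 * (K + 1))) by (apply Rdiv_lt_0_compat; [apply cond_pos | lra]).
  destruct (exp_neg_linear_tends 1 Rlt_0_1 _ He) as [M HM].
  exists (fun t => Rmax 0 M < t). split; [exists (Rmax 0 M); auto|].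
  assert (HH : forall u v, Rmax 0 M < u -> u <= v -> Cmod (Phi v - Phi u)%C < eps).
  { intros u v Hu Huv. pose proof (Rmax_l 0 M). pose proof (Rmax_r 0 M).
    eapply Rle_lt_trans; [apply HB; lra|].
    specialize (HM u ltac:(lra)). cbv beta in HM. rewrite Rmult_1_l in HM.
    replace (RtoC (exp (- u)) - 0)%C with (RtoC (exp (- u))) in HM by ring.
    rewrite Cmod_R, Rabs_pos_eq in HM by (left; apply exp_pos).
    pose proof (exp_pos (- v)). pose proof (cond_pos eps).
    assert (K * exp (- u) <= K * (eps / (2 * (K + 1)))) by (apply Rmult_le_compat_l; assumption).
    assert (K * (eps / (2 * (K + 1))) < eps).
    { apply (Rmult_lt_reg_r (2 * (K + 1))); [lra|].
      replace (K * (eps / (2 * (K + 1))) * (2 * (K + 1))) with (K * eps) by (field; lra). nra. }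
    nra. }
  intros u v Hu Hv. apply (@norm_compat1 C_AbsRing C_NormedModule). change (Cmod (Phi v - Phi u) < eps).
  destruct (Rle_lt_dec u v) as [H|H].
  + apply HH; assumption.
  + rewrite <- Cmod_opp, Copp_minus_distr. apply HH; lra.
Qed.

Lemma improper_bound (f : R -> C) (K : R) :
  (forall t, continuous f t) -> (forall t, 0 <= t -> Cmod (f t) <= K * exp (- t)) ->
  Cmod (improper f) <= K.
Proof.
  intros Hc Hb. destruct (improper_correct f K Hc Hb) as (Phi & H0 & Hd & Hl).
  pose proof (antiderivative_exp_bound f Phi K Hc Hd Hb) as HB.
  assert (HK : 0 <= K).
  { specialize (Hb 0 (Rle_refl 0)). rewrite Ropp_0, exp_0 in Hb. pose proof (Cmod_ge_0 (f 0)). lra. }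
  apply le_epsilon. intros eps He. destruct (Hl eps He) as [M HM].
  set (t := Rmax 0 M + 1). pose proof (Rmax_l 0 M). pose proof (Rmax_r 0 M).
  specialize (HM t ltac:(unfold t; lra)). specialize (HB 0 t ltac:(unfold t; lra)).
  rewrite H0, Ropp_0, exp_0 in HB. replace (Phi t - 0)%C with (Phi t) in HB by ring.
  replace (improper f) with (Phi t + - (Phi t - improper f))%C by ring.
  eapply Rle_trans; [apply Cmod_triangle|]. rewrite Cmod_opp. pose proof (exp_pos (- t)). nra.
Qed.

(** Decay beyond every exponential makes the Laplace integral converge for all complex [lam] and
    leaves room for extra factors [t] and for differentiation in [lam]. *)
Definition super_exp (G : R -> C) : Prop :=
  (forall t, continuous G t) /\
  forall B, exists K, forall t, 0 <= t -> Cmod (G t) <= K * exp (- (B * t)).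

Definition laplace (G : R -> C) (lam : C) : C :=
  improper (fun t : R => Cexp (- (lam * RtoC t)) * G t)%C.

Lemma continuous_Cmult (f g : R -> C) (t : R) :
  continuous f t -> continuous g t -> continuous (fun t => f t * g t)%C t.
Proof.
  intros Hf Hg. apply Ctends_filterlim, Ctends_mult; apply Ctends_filterlim; assumption.
Qed.

Lemma is_derive_Cexp_lin (lam : C) (t : R) :
  is_derive (fun t : R => Cexp (- (lam * RtoC t))) t (- lam * Cexp (- (lam * RtoC t)))%C.
Proof.
  apply is_derive_Cexp. eapply is_derive_Ceq.
  - apply is_derive_Copp, is_derive_Cmult; [apply is_derive_Cconst | apply is_derive_RtoC, is_derive_id].
  - change (@one R_AbsRing) with 1. cbv beta. ring.
Qed.

Lemma continuous_laplace (G : R -> C) (lam : C) (t : R) :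
  (forall t, continuous G t) -> continuous (fun t : R => Cexp (- (lam * RtoC t)) * G t)%C t.
Proof.
  intros HG. apply continuous_Cmult; [|apply HG].
  eapply is_derive_continuous, is_derive_Cexp_lin.
Qed.

Lemma Cmod_Cexp_lin (lam : C) (t : R) : 0 <= t -> Cmod (Cexp (- (lam * RtoC t))) <= exp (Cmod lam * t).
Proof.
  intros Ht. eapply Rle_trans; [apply Cmod_Cexp_le|]. apply exp_le.
  rewrite Cmod_opp, Cmod_mult, Cmod_R, Rabs_pos_eq by exact Ht. lra.
Qed.

Lemma laplace_integrand_bound (G : R -> C) (lam : C) : super_exp G ->
  exists K, forall t, 0 <= t -> Cmod (Cexp (- (lam * RtoC t)) * G t)%C <= K * exp (- t).
Proof.
  intros [_ HG]. destruct (HG (Cmod lam + 1)) as [K HK]. exists K. intros t Ht.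
  rewrite Cmod_mult. replace (K * exp (- t)) with (exp (Cmod lam * t) * (K * exp (- ((Cmod lam + 1) * t)))).
  - apply Rmult_le_compat; try apply Cmod_ge_0; [apply Cmod_Cexp_lin, Ht | apply HK, Ht].
  - replace (- t) with (Cmod lam * t + - ((Cmod lam + 1) * t)) by ring. rewrite exp_plus. ring.
Qed.

Lemma laplace_correct (G : R -> C) (lam : C) : super_exp G ->
  exists Phi : R -> C, Phi 0 = 0 /\ (forall t, is_derive Phi t (Cexp (- (lam * RtoC t)) * G t)%C) /\
    Ctends (Rbar_locally p_infty) Phi (laplace G lam).
Proof.
  intros HG. destruct (laplace_integrand_bound G lam HG) as [K HK].
  apply (improper_correct _ K); [|exact HK].
  intros t. apply continuous_laplace, HG.
Qed.

Lemma laplace_eq (G Phi : R -> C) (lam l : C) : super_exp G -> Phi 0 = 0 ->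
  (forall t, is_derive Phi t (Cexp (- (lam * RtoC t)) * G t)%C) ->
  Ctends (Rbar_locally p_infty) Phi l -> laplace G lam = l.
Proof.
  intros HG H0 Hd Hl. unfold laplace. rewrite (improper_eq _ Phi l).
  - rewrite H0. ring.
  - intros t. apply continuous_laplace, HG.
  - exact Hd.
  - exact Hl.
Qed.

Lemma super_exp_plus (G H : R -> C) : super_exp G -> super_exp H -> super_exp (fun t => G t + H t)%C.
Proof.
  intros [HGc HG] [HHc HH]. split.
  - intros t. apply (@continuous_plus _ R_AbsRing C_R_NormedModule); auto.
  - intros B. destruct (HG B) as [K HK]. destruct (HH B) as [K' HK']. exists (K + K').
    intros t Ht. eapply Rle_trans; [apply Cmod_triangle|]. specialize (HK t Ht). specialize (HK' t Ht). lra.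
Qed.

Lemma super_exp_scal (z : C) (G : R -> C) : super_exp G -> super_exp (fun t => z * G t)%C.
Proof.
  intros [HGc HG]. split.
  - intros t. apply continuous_Cmult; [apply continuous_const | apply HGc].
  - intros B. destruct (HG B) as [K HK]. exists (Cmod z * K). intros t Ht.
    rewrite Cmod_mult, Rmult_assoc. apply Rmult_le_compat_l; [apply Cmod_ge_0 | apply HK, Ht].
Qed.

Lemma super_exp_id_mult (G : R -> C) : super_exp G -> super_exp (fun t => RtoC t * G t)%C.
Proof.
  intros [HGc HG]. split.
  - intros t. apply continuous_Cmult; [|apply HGc].
    apply is_derive_continuous with (RtoC 1). apply is_derive_RtoC. exact (@is_derive_id R_AbsRing t).
  - intros B. destruct (HG (B + 1)) as [K HK]. exists K. intros t Ht.
    rewrite Cmod_mult, Cmod_R, Rabs_pos_eq by exact Ht.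
    replace (K * exp (- (B * t))) with (exp t * (K * exp (- ((B + 1) * t)))).
    + apply Rmult_le_compat; [exact Ht | apply Cmod_ge_0 | | apply HK, Ht].
      pose proof (exp_ineq1_le t). lra.
    + replace (- (B * t)) with (t + - ((B + 1) * t)) by ring. rewrite exp_plus. ring.
Qed.

Lemma super_exp_ext (G H : R -> C) : (forall t, G t = H t) -> super_exp G -> super_exp H.
Proof.
  intros E [HGc HG]. split.
  - intros t. apply (continuous_ext G); auto.
  - intros B. destruct (HG B) as [K HK]. exists K. intros t Ht. rewrite <- E. auto.
Qed.

Lemma laplace_ext (G H : R -> C) (lam : C) : super_exp G -> (forall t, G t = H t) ->
  laplace G lam = laplace H lam.
Proof.
  intros HG E. destruct (laplace_correct G lam HG) as (Phi & H0 & Hd & Hl).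
  symmetry. apply laplace_eq with Phi; auto.
  - apply super_exp_ext with G; auto.
  - intros t. rewrite <- E. apply Hd.
Qed.

Lemma laplace_plus (G H : R -> C) (lam : C) : super_exp G -> super_exp H ->
  laplace (fun t => G t + H t)%C lam = (laplace G lam + laplace H lam)%C.
Proof.
  intros HG HH.
  destruct (laplace_correct G lam HG) as (Phi & H0 & Hd & Hl).
  destruct (laplace_correct H lam HH) as (Psi & H0' & Hd' & Hl').
  apply laplace_eq with (fun t => Phi t + Psi t)%C.
  - apply super_exp_plus; assumption.
  - rewrite H0, H0'. ring.
  - intros t. eapply is_derive_Ceq; [apply is_derive_Cplus; auto|]. cbv beta. ring.
  - apply Ctends_plus; assumption.
Qed.

Lemma laplace_scal (z : C) (G : R -> C) (lam : C) : super_exp G ->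
  laplace (fun t => z * G t)%C lam = (z * laplace G lam)%C.
Proof.
  intros HG. destruct (laplace_correct G lam HG) as (Phi & H0 & Hd & Hl).
  apply laplace_eq with (fun t => z * Phi t)%C.
  - apply super_exp_scal, HG.
  - rewrite H0. ring.
  - intros t. eapply is_derive_Ceq; [apply is_derive_Cmult; [apply is_derive_Cconst | apply Hd]|]. cbv beta. ring.
  - apply Ctends_mult; [apply Ctends_const | exact Hl].
Qed.

(** With [Phi] and [Psi] the primitives of the two integrands, [lam * Phi - Psi + exp(-lam t) * G]
    has zero derivative; its values at 0 and at infinity give the formula. *)
Lemma laplace_by_parts (G G' : R -> C) (lam : C) : super_exp G -> super_exp G' ->
  (forall t, is_derive G t (G' t)) -> (lam * laplace G lam = G 0 + laplace G' lam)%C.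
Proof.
  intros HG HG' HD.
  destruct (laplace_correct G lam HG) as (Phi & H0 & Hd & Hl).
  destruct (laplace_correct G' lam HG') as (Psi & H0' & Hd' & Hl').
  assert (E : forall t, (lam * Phi t + - Psi t + Cexp (- (lam * RtoC t)) * G t)%C = G 0).
  { intros t. rewrite (C_constant (fun t => lam * Phi t + - Psi t + Cexp (- (lam * RtoC t)) * G t)%C t 0).
    - rewrite H0, H0'. replace (- (lam * 0))%C with (RtoC 0) by ring. rewrite Cexp_0. ring.
    - intros x. eapply is_derive_Ceq.
      + apply is_derive_Cplus; [apply is_derive_Cplus|].
        * apply is_derive_Cmult; [apply is_derive_Cconst | apply Hd].
        * apply is_derive_Copp, Hd'.
        * apply is_derive_Cmult; [apply is_derive_Cexp_lin | apply HD].
      + cbv beta. ring. }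
  assert (T : Ctends (Rbar_locally p_infty) (fun t : R => Cexp (- (lam * RtoC t)) * G t)%C 0).
  { destruct (laplace_integrand_bound G lam HG) as [K HK].
    apply Ctends_squeeze with (fun t => RtoC K * RtoC (exp (- (1 * t))))%C.
    - exists 0. intros t Ht.
      replace (Cexp (- (lam * RtoC t)) * G t - 0)%C with (Cexp (- (lam * RtoC t)) * G t)%C by ring.
      rewrite <- RtoC_mult, Cmod_R, Rmult_1_l. eapply Rle_trans; [apply HK; lra | apply Rle_abs].
    - replace (RtoC 0) with (RtoC K * 0)%C by ring.
      apply Ctends_mult; [apply Ctends_const | apply exp_neg_linear_tends; lra]. }
  assert (L : (lam * laplace G lam + - laplace G' lam + 0)%C = G 0).
  { apply (Ctends_unique (Rbar_locally p_infty) (fun _ => G 0)); [|apply Ctends_const].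
    apply Ctends_ext with (fun t : R => lam * Phi t + - Psi t + Cexp (- (lam * RtoC t)) * G t)%C; [exact E|].
    apply Ctends_plus; [apply Ctends_plus|exact T].
    - apply Ctends_mult; [apply Ctends_const | exact Hl].
    - apply Ctends_opp, Hl'. }
  rewrite <- L. ring.
Qed.

(** * Derivatives of the parabolic cylinder function *)

(** Differentiation under the integral: [d/dlam] brings down [- t], and the second-order estimate of
    the exponential makes the remainder quadratic in [mu - lam]. *)
Lemma laplace_taylor (G : R -> C) (lam : C) : super_exp G -> exists K, 0 <= K /\
  forall mu, Cmod (mu - lam)%C <= 1 ->
  Cmod (laplace G mu - laplace G lam - (mu - lam) * laplace (fun t => - (1) * (RtoC t * G t)) lam)%C
  <= K * Cmod (mu - lam)%C ^ 2.
Proof.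
  intros HG. pose proof (super_exp_id_mult G HG) as HG1.
  pose proof (super_exp_scal (- (1))%C _ HG1) as HG1'.
  (* Beyond [Cmod lam], one unit of decay pays for [exp (Cmod w * t)] with [Cmod w <= 1], the other
     leaves the integrable [exp (- t)]. *)
  destruct (proj2 (super_exp_id_mult _ HG1) (Cmod lam + 2)) as [K HK].
  assert (HK0 : 0 <= K).
  { specialize (HK 0 (Rle_refl 0)). rewrite Rmult_0_r, Ropp_0, exp_0 in HK.
    pose proof (Cmod_ge_0 (RtoC 0 * (RtoC 0 * G 0%R))). lra. }
  exists (4 * K). split; [lra|]. intros mu Hmu. set (w := (mu - lam)%C) in *.
  set (f := fun t : R => (Cexp (- (lam * RtoC t)) * ((Cexp (- (w * RtoC t)) - 1 - - (w * RtoC t)) * G t))%C).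
  assert (Hc : forall t, continuous f t).
  { intros t. apply continuous_laplace. intros s. apply continuous_Cmult; [|apply HG].
    eapply is_derive_continuous, is_derive_Cminus; [apply is_derive_Cminus|].
    - apply is_derive_Cexp_lin.
    - apply is_derive_Cconst.
    - apply is_derive_Copp, is_derive_Cmult; [apply is_derive_Cconst | apply is_derive_RtoC, is_derive_id]. }
  assert (Hb : forall t, 0 <= t -> Cmod (f t) <= (4 * K * Cmod w ^ 2) * exp (- t)).
  { intros t Ht. unfold f. rewrite !Cmod_mult.
    pose proof (Cexp_taylor (- (w * RtoC t))) as H1.
    rewrite Cmod_opp, Cmod_mult, Cmod_R, Rabs_pos_eq in H1 by exact Ht.
    pose proof (Cmod_Cexp_lin lam t Ht) as H2.
    specialize (HK t Ht). rewrite !Cmod_mult, Cmod_R, Rabs_pos_eq in HK by exact Ht.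
    pose proof (Cmod_ge_0 w) as Hw. pose proof (Cmod_ge_0 (G t)) as HGt.
    assert (H3 : exp (Cmod w * t) <= exp t) by (apply exp_le; nra).
    assert (H4 : 4 * ((Cmod w * t) ^ 2 * exp (Cmod w * t)) <= 4 * ((Cmod w * t) ^ 2 * exp t)).
    { apply Rmult_le_compat_l; [lra|]. apply Rmult_le_compat_l; [apply pow2_ge_0 | exact H3]. }
    apply Rle_trans with (exp (Cmod lam * t) * (4 * ((Cmod w * t) ^ 2 * exp t) * Cmod (G t))).
    - apply Rmult_le_compat; [apply Cmod_ge_0 | apply Rmult_le_pos; apply Cmod_ge_0 | exact H2 |].
      apply Rmult_le_compat_r; [exact HGt | lra].
    - replace (exp (Cmod lam * t) * (4 * ((Cmod w * t) ^ 2 * exp t) * Cmod (G t)))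
        with (4 * Cmod w ^ 2 * (exp (Cmod lam * t) * exp t) * (t * (t * Cmod (G t)))) by ring.
      apply Rle_trans with (4 * Cmod w ^ 2 * (exp (Cmod lam * t) * exp t) * (K * exp (- ((Cmod lam + 2) * t)))).
      + apply Rmult_le_compat_l; [|exact HK].
        pose proof (exp_pos (Cmod lam * t)). pose proof (exp_pos t). pose proof (pow2_ge_0 (Cmod w)).
        apply Rmult_le_pos; [lra|]. apply Rmult_le_pos; lra.
      + apply Req_le. replace (- t) with (Cmod lam * t + t + - ((Cmod lam + 2) * t)) by ring.
        rewrite !exp_plus. ring. }
  destruct (laplace_correct G mu HG) as (P1 & Z1 & D1 & L1).
  destruct (laplace_correct G lam HG) as (P2 & Z2 & D2 & L2).
  destruct (laplace_correct _ lam HG1') as (P3 & Z3 & D3 & L3).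
  assert (E : improper f = (laplace G mu - laplace G lam - w * laplace (fun t => - (1) * (RtoC t * G t)) lam)%C).
  { rewrite (improper_eq f (fun t => P1 t + - P2 t + - (w * P3 t))%C
      (laplace G mu + - laplace G lam + - (w * laplace (fun t => - (1) * (RtoC t * G t)) lam))%C Hc).
    - rewrite Z1, Z2, Z3. ring.
    - intros t. eapply is_derive_Ceq.
      + apply is_derive_Cplus; [apply is_derive_Cplus; [apply D1 | apply is_derive_Copp, D2]|].
        apply is_derive_Copp, is_derive_Cmult; [apply is_derive_Cconst | apply D3].
      + unfold f. replace (- (mu * RtoC t))%C with (- (lam * RtoC t) + - (w * RtoC t))%C
          by (unfold w; ring). rewrite Cexp_plus. ring.
    - apply Ctends_plus; [apply Ctends_plus; [exact L1 | apply Ctends_opp, L2]|].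
      apply Ctends_opp, Ctends_mult; [apply Ctends_const | exact L3]. }
  rewrite <- E. eapply Rle_trans; [apply (improper_bound f _ Hc Hb)|]. apply Req_le; ring.
Qed.

(** A chain rule along a real curve in the [lam]-plane, the form in which the transform is
    differentiated on the hyperbolas. *)
Lemma is_derive_laplace_path (G : R -> C) (lam : R -> C) (u : R) (l : C) : super_exp G ->
  is_derive lam u l ->
  is_derive (fun u => laplace G (lam u)) u (l * laplace (fun t => - (1) * (RtoC t * G t)) (lam u))%C.
Proof.
  intros HG Hl. destruct (laplace_taylor G (lam u) HG) as [K [HK HT]].
  set (J1 := laplace (fun t => - (1) * (RtoC t * G t))%C (lam u)) in *.
  pose proof (proj1 (is_derive_eps _ _ _) Hl) as Hl'.
  apply is_derive_eps. intros eps He.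
  pose proof (Cmod_ge_0 J1) as HJ. pose proof (Cmod_ge_0 l) as Hl0.
  set (m := Cmod l + 1).
  set (e1 := Rmin 1 (eps / (2 * (Cmod J1 + 1)))).
  assert (He1 : 0 < e1) by (apply Rmin_pos; [lra | apply Rdiv_lt_0_compat; lra]).
  destruct (Hl' e1 He1) as [d [Hd Hv]].
  assert (Hden : 0 < 2 * (K + 1) * (m * m)) by (unfold m; apply Rmult_lt_0_compat; nra).
  (* [m] is a Lipschitz constant of [lam] near [u]. The bound [/ m] keeps [lam v] within distance 1
     of [lam u], as [laplace_taylor] demands, and the last one makes its quadratic remainder at most
     [eps / 2 * Rabs (v - u)]. *)
  exists (Rmin d (Rmin (/ m) (eps / (2 * (K + 1) * (m * m))))). split.
  { repeat apply Rmin_pos; [exact Hd | apply Rinv_0_lt_compat; unfold m; lra | apply Rdiv_lt_0_compat; assumption]. }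
  intros v Hvu.
  pose proof (Rmin_l d (Rmin (/ m) (eps / (2 * (K + 1) * (m * m))))).
  pose proof (Rmin_r d (Rmin (/ m) (eps / (2 * (K + 1) * (m * m))))).
  pose proof (Rmin_l (/ m) (eps / (2 * (K + 1) * (m * m)))).
  pose proof (Rmin_r (/ m) (eps / (2 * (K + 1) * (m * m)))).
  specialize (Hv v ltac:(lra)). set (x := Rabs (v - u)) in *.
  assert (Hx : 0 <= x) by apply Rabs_pos.
  pose proof (Rmin_l 1 (eps / (2 * (Cmod J1 + 1)))) as Hm1.
  pose proof (Rmin_r 1 (eps / (2 * (Cmod J1 + 1)))) as Hm2. fold e1 in Hm1, Hm2.
  assert (Hlip : Cmod (lam v - lam u) <= m * x).
  { replace (lam v - lam u)%C with ((lam v - lam u - RtoC (v - u) * l) + RtoC (v - u) * l)%C by ring.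
    eapply Rle_trans; [apply Cmod_triangle|]. rewrite Cmod_mult, Cmod_R. fold x. unfold m. nra. }
  assert (Hmx : m * x <= 1).
  { apply Rle_trans with (m * / m); [apply Rmult_le_compat_l; unfold m in *; lra|].
    rewrite Rinv_r; [lra | unfold m; lra]. }
  specialize (HT (lam v) ltac:(lra)).
  replace (laplace G (lam v) - laplace G (lam u) - RtoC (v - u) * (l * J1))%C with
    ((laplace G (lam v) - laplace G (lam u) - (lam v - lam u) * J1)
      + (lam v - lam u - RtoC (v - u) * l) * J1)%C by ring.
  eapply Rle_trans; [apply Cmod_triangle|]. rewrite Cmod_mult.
  assert (B1 : Cmod (lam v - lam u - RtoC (v - u) * l) * Cmod J1 <= eps / 2 * x).
  { apply Rle_trans with (e1 * x * Cmod J1); [apply Rmult_le_compat_r; assumption|].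
    apply Rle_trans with (eps / (2 * (Cmod J1 + 1)) * x * (Cmod J1 + 1)).
    - apply Rmult_le_compat; [apply Rmult_le_pos; lra | exact HJ | apply Rmult_le_compat_r; assumption | lra].
    - apply Req_le. field. lra. }
  assert (B2 : K * Cmod (lam v - lam u) ^ 2 <= eps / 2 * x).
  { assert (Cmod (lam v - lam u) ^ 2 <= (m * x) ^ 2) by (apply pow_incr; split; [apply Cmod_ge_0 | exact Hlip]).
    apply Rle_trans with ((K + 1) * (m * x) ^ 2).
    { apply Rmult_le_compat; [exact HK | apply pow2_ge_0 | lra | assumption]. }
    replace ((K + 1) * (m * x) ^ 2) with ((K + 1) * (m * m) * x * x) by ring.
    apply Rmult_le_compat_r; [exact Hx|].
    apply Rle_trans with ((K + 1) * (m * m) * (eps / (2 * (K + 1) * (m * m)))).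
    - apply Rmult_le_compat_l; [|lra]. apply Rmult_le_pos; [lra|]. unfold m; nra.
    - apply Req_le. field. unfold m; split; lra. }
  lra.
Qed.

(* Differentiating [y'' = (t^2/4 + a) y] [n] times gives a three-term recursion for the
   derivatives; the state holds the derivatives of orders [n-2], [n-1], [n], [n+1], the first two
   being irrelevant junk as long as their coefficients vanish. *)
Fixpoint pcf_state (a : C) (U U' : R -> C) (n : nat) : (R -> C) * (R -> C) * (R -> C) * (R -> C) :=
  match n with
  | O => (U, U, U, U')
  | S m => let '(p, q, r, s) := pcf_state a U U' m in
      (q, r, s, fun t => ((RtoC (t ^ 2 / 4) + a) * r t + RtoC (INR m / 2) * (RtoC t * q t)
                         + RtoC (INR m * (INR m - 1) / 4) * p t)%C)
  end.

Definition pcf_deriv (a : C) (U U' : R -> C) (n : nat) : R -> C :=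
  snd (fst (pcf_state a U U' n)).

(** The junk [U, U] of the initial state is chosen to agree with truncated subtraction, which sends
    [n - 1] and [n - 2] to 0 for the smallest orders. *)
Lemma pcf_state_deriv (a : C) (U U' : R -> C) (n : nat) :
  pcf_state a U U' n = (pcf_deriv a U U' (n - 2), pcf_deriv a U U' (n - 1),
                        pcf_deriv a U U' n, pcf_deriv a U U' (S n)).
Proof.
  unfold pcf_deriv. induction n as [|n IH]; [reflexivity|].
  cbn [pcf_state]. replace (S n - 1)%nat with n by lia.
  destruct n as [|n]; [reflexivity|].
  replace (S (S n) - 2)%nat with n by lia. replace (S n - 1)%nat with n in IH by lia.
  cbn [pcf_state] in *.
  destruct (pcf_state a U U' n) as [[[p q] r] s]. cbn [fst snd] in *. reflexivity.
Qed.

Lemma pcf_deriv_rec (a : C) (U U' : R -> C) (n : nat) (t : R) :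
  pcf_deriv a U U' (S (S n)) t = ((RtoC (t ^ 2 / 4) + a) * pcf_deriv a U U' n t
     + RtoC (INR n / 2) * (RtoC t * pcf_deriv a U U' (n - 1) t)
     + RtoC (INR n * (INR n - 1) / 4) * pcf_deriv a U U' (n - 2) t)%C.
Proof.
  unfold pcf_deriv at 1. cbn [pcf_state]. rewrite pcf_state_deriv. reflexivity.
Qed.

Section Pcf.
Variables (a : C) (U U' : R -> C).
Hypothesis HP : is_PCU a U U'.

Let V := pcf_deriv a U U'.

Lemma is_derive_pcf_deriv (n : nat) (t : R) : is_derive (V n) t (V (S n) t).
Proof.
  destruct HP as (HU & HU' & _).
  enough (H : forall n t, is_derive (V n) t (V (S n) t) /\ is_derive (V (S n)) t (V (S (S n)) t)) by apply H.
  clear n t. induction n as [n IH] using (well_founded_induction Wf_nat.lt_wf). intros t.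
  destruct n as [|n].
  - split; [apply HU|]. eapply is_derive_Ceq; [apply HU'|].
    unfold V. rewrite pcf_deriv_rec. simpl INR. unfold Rdiv. rewrite !Rmult_0_l.
    change (pcf_deriv a U U' 0) with U. ring.
  - split; [apply IH; lia|].
    assert (E : forall s, V (S (S n)) s = ((RtoC (s ^ 2 / 4) + a) * V n s
       + RtoC (INR n / 2) * (RtoC s * V (n - 1)%nat s)
       + RtoC (INR n * (INR n - 1) / 4) * V (n - 2)%nat s)%C) by (intros s; apply pcf_deriv_rec).
    apply (is_derive_ext (K := R_AbsRing) (V := C_R_NormedModule) (fun s => ((RtoC (s ^ 2 / 4) + a) * V n s
       + RtoC (INR n / 2) * (RtoC s * V (n - 1)%nat s)
       + RtoC (INR n * (INR n - 1) / 4) * V (n - 2)%nat s)%C)); [intros s; symmetry; apply E|].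
    assert (D0 : is_derive (V n) t (V (S n) t)) by (apply IH; lia).
    assert (D1 : is_derive (V (n - 1)%nat) t (V (S (n - 1)) t)) by (apply IH; lia).
    assert (D2 : is_derive (V (n - 2)%nat) t (V (S (n - 2)) t)) by (apply IH; lia).
    eapply is_derive_Ceq.
    + apply is_derive_Cplus; [apply is_derive_Cplus|].
      * apply is_derive_Cmult; [|exact D0]. apply is_derive_Cplus; [|apply is_derive_Cconst].
        apply (is_derive_RtoC (fun s => s ^ 2 / 4) t (t / 2)). auto_derive; trivial. field.
      * apply is_derive_Cmult; [apply is_derive_Cconst|]. apply is_derive_Cmult; [|exact D1].
        apply (is_derive_RtoC (fun s => s) t 1). exact (@is_derive_id R_AbsRing t).
      * apply is_derive_Cmult; [apply is_derive_Cconst | exact D2].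
    + transitivity ((RtoC (t ^ 2 / 4) + a) * V (S n) t
         + RtoC (INR (S n) / 2) * (RtoC t * V (S n - 1)%nat t)
         + RtoC (INR (S n) * (INR (S n) - 1) / 4) * V (S n - 2)%nat t)%C;
        [|symmetry; apply pcf_deriv_rec].
      pose proof RtoC_2_neq_0. pose proof RtoC_4_neq_0.
      (* For orders 0 and 1 a truncated index no longer shifts with [n]; there the coefficient [n]
         or [n (n - 1)] vanishes instead. *)
      destruct n as [|[|n]].
      * simpl. rewrite !RtoC_div, !RtoC_mult, ?RtoC_minus by lra. field; auto.
      * simpl. rewrite !RtoC_div, !RtoC_mult, ?RtoC_minus, ?RtoC_plus by lra. field; auto.
      * replace (S (S n) - 1)%nat with (S n) by lia. replace (S (S n) - 2)%nat with n by lia.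
        replace (S (S (S n)) - 1)%nat with (S (S n)) by lia. replace (S (S (S n)) - 2)%nat with (S n) by lia.
        rewrite !S_INR, !RtoC_div, !RtoC_mult, ?RtoC_minus, ?RtoC_plus by lra. field; auto.
Qed.

Lemma super_exp_pcf : super_exp U.
Proof.
  destruct HP as (HU & _ & Hlim). split; [intros t; eapply is_derive_continuous, HU|].
  intros B. apply Ctends_filterlim in Hlim. destruct (Hlim 1 Rlt_0_1) as [M HM].
  destruct (ln_le_linear (Re (a + RtoC (1/2))) 1 Rlt_0_1) as [L HL].
  set (T := Rmax 1 M + 1). pose proof (Rmax_l 1 M). pose proof (Rmax_r 1 M).
  assert (Hlarge : forall t, T <= t -> Cmod (U t) <= 2 * exp (L + (1 + B) ^ 2) * exp (- (B * t))).
  { intros t Ht. specialize (HM t ltac:(unfold T in Ht; lra)). specialize (HL t ltac:(unfold T in Ht; lra)).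
    cbv beta in HM. set (w := ((a + RtoC (1/2)) * RtoC (ln t) + RtoC (t ^ 2 / 4))%C) in *.
    assert (H2 : Cmod (U t * Cexp w) <= 2).
    { replace (U t * Cexp w)%C with (1 + (U t * Cexp w - 1))%C by ring.
      eapply Rle_trans; [apply Cmod_triangle|]. rewrite Cmod_1. lra. }
    rewrite Cmod_mult, Cmod_Cexp in H2.
    (* The logarithm costs at most [t + L], and [t^2/4] dominates [(1 + B) * t] up to [(1 + B)^2]
       because [(t/2 - (1 + B))^2] is nonnegative. *)
    assert (Hw : - Re w <= L + (1 + B) ^ 2 + - (B * t)).
    { unfold w. rewrite re_plus, re_scal_r. change (Re (RtoC (t ^ 2 / 4))) with (t ^ 2 / 4).
      apply Rabs_le_between in HL. pose proof (pow2_ge_0 (t / 2 - (1 + B))). lra. }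
    replace (Cmod (U t)) with (Cmod (U t) * exp (Re w) * exp (- Re w)).
    - rewrite Rmult_assoc, <- exp_plus.
      rewrite exp_plus, <- Rmult_assoc. apply Rle_trans with (2 * exp (- Re w)).
      + apply Rmult_le_compat_r; [left; apply exp_pos | exact H2].
      + rewrite Rmult_assoc. apply Rmult_le_compat_l; [lra|]. rewrite <- exp_plus. apply exp_le. lra.
    - rewrite Rmult_assoc, <- exp_plus, Rplus_opp_r, exp_0. ring. }
  assert (Hsmall : exists K, 0 <= K /\ forall t, 0 <= t <= T -> Cmod (U t) <= K).
  { assert (Hp : forall p : C -> R, (forall t, continuity_pt (fun t => p (U t)) t) ->
      exists K, forall t, 0 <= t <= T -> Rabs (p (U t)) <= K).
    { intros p Hc.
      destruct (continuity_ab_maj (fun t => Rabs (p (U t))) 0 T) as [m [Hm _]].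
      - unfold T; lra.
      - intros t _. apply (continuity_pt_comp (fun t => p (U t)) Rabs); [apply Hc | apply Rcontinuity_abs].
      - exists (Rabs (p (U m))). exact Hm. }
    destruct (Hp Re) as [K1 HK1].
    { intros t. apply continuity_pt_filterlim, (ex_derive_continuous (fun t => Re (U t))).
      eexists. apply is_derive_Re, HU. }
    destruct (Hp Im) as [K2 HK2].
    { intros t. apply continuity_pt_filterlim, (ex_derive_continuous (fun t => Im (U t))).
      eexists. apply is_derive_Im, HU. }
    exists (K1 + K2). split.
    - pose proof (HK1 0 ltac:(unfold T; lra)). pose proof (HK2 0 ltac:(unfold T; lra)).
      pose proof (Rabs_pos (Re (U 0))). pose proof (Rabs_pos (Im (U 0))). lra.
    - intros t Ht. eapply Rle_trans; [apply Cmod_le_Re_Im|].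
      pose proof (HK1 t Ht). pose proof (HK2 t Ht). lra. }
  destruct Hsmall as [K [HK HKt]].
  exists (K * exp (Rabs B * T) + 2 * exp (L + (1 + B) ^ 2)). intros t Ht.
  rewrite Rmult_plus_distr_r.
  assert (P1 : 0 <= K * exp (Rabs B * T) * exp (- (B * t))).
  { pose proof (exp_pos (Rabs B * T)). pose proof (exp_pos (- (B * t))). apply Rmult_le_pos; nra. }
  assert (P2 : 0 <= 2 * exp (L + (1 + B) ^ 2) * exp (- (B * t))).
  { pose proof (exp_pos (L + (1 + B) ^ 2)). pose proof (exp_pos (- (B * t))). apply Rmult_le_pos; nra. }
  destruct (Rle_lt_dec T t) as [H1|H1].
  - specialize (Hlarge t H1). lra.
  - apply Rle_trans with (K * exp (Rabs B * T) * exp (- (B * t))); [|lra].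
    rewrite Rmult_assoc, <- exp_plus. rewrite <- (Rmult_1_r (Cmod (U t))).
    apply Rmult_le_compat; [apply Cmod_ge_0 | lra | apply HKt; lra |].
    rewrite <- exp_0. apply exp_le.
    pose proof (Rle_abs B). pose proof (Rabs_pos B).
    assert (B * t <= Rabs B * t) by nra. assert (Rabs B * t <= Rabs B * T) by nra. lra.
Qed.

Lemma super_exp_quadratic (b : C) (G : R -> C) : super_exp G ->
  super_exp (fun t => (RtoC (t ^ 2 / 4) + b) * G t)%C.
Proof.
  intros HG.
  apply super_exp_ext with (fun t => RtoC (/ 4) * (RtoC t * (RtoC t * G t)) + b * G t)%C.
  - intros t. replace (t ^ 2 / 4) with (/ 4 * (t * t)) by field. rewrite !RtoC_mult. ring.
  - apply super_exp_plus; repeat apply super_exp_scal; [|exact HG].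
    do 2 apply super_exp_id_mult. exact HG.
Qed.

(* Taylor's formula bounds [U'] by values of [U] and [U'']. *)
Lemma super_exp_pcf' : super_exp U'.
Proof.
  pose proof super_exp_pcf as HUs. destruct HP as (HU & HU' & _).
  split; [intros t; eapply is_derive_continuous, HU'|].
  intros B. destruct (proj2 (super_exp_quadratic a U HUs) (Rabs B)) as [K2 HK2].
  destruct (proj2 HUs (Rabs B)) as [K0 HK0].
  assert (HK2p : 0 <= K2).
  { specialize (HK2 0 (Rle_refl 0)). rewrite Rmult_0_r, Ropp_0, exp_0 in HK2.
    pose proof (Cmod_ge_0 ((RtoC (0 ^ 2 / 4) + a) * U 0%R)%C). lra. }
  assert (HK0p : 0 <= K0).
  { specialize (HK0 0 (Rle_refl 0)). rewrite Rmult_0_r, Ropp_0, exp_0 in HK0.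
    pose proof (Cmod_ge_0 (U 0%R)). lra. }
  exists (4 * K2 + 2 * K0). intros t Ht.
  set (x := exp (- (Rabs B * t))).
  assert (Hdec : forall s, t <= s -> exp (- (Rabs B * s)) <= x).
  { intros s Hs. apply exp_le. pose proof (Rabs_pos B). nra. }
  assert (H1 : forall s, t <= s <= t + 1 -> Cmod (U' s - U' t) <= 2 * (K2 * x)).
  { intros s Hs. apply Rle_trans with (2 * (K2 * x) * Rabs (s - t)).
    - apply C_bounded_variation with (df := fun t => ((RtoC (t ^ 2 / 4) + a) * U t)%C).
      intros r Hr. rewrite Rmin_left, Rmax_right in Hr by lra. split; [apply HU'|].
      eapply Rle_trans; [apply HK2; lra|]. apply Rmult_le_compat_l; [exact HK2p | apply Hdec; lra].
    - rewrite Rabs_pos_eq by lra. assert (0 <= K2 * x) by (apply Rmult_le_pos; [exact HK2p | left; apply exp_pos]). nra. }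
  assert (H2 : Cmod ((U (t + 1)%R - RtoC (t + 1) * U' t) - (U t - RtoC t * U' t))%C <= 2 * (2 * (K2 * x)) * Rabs (t + 1 - t)).
  { apply (C_bounded_variation (fun s => U s - RtoC s * U' t)%C (fun s => U' s - U' t)%C).
    intros s Hs. rewrite Rmin_left, Rmax_right in Hs by lra. split; [|apply H1, Hs].
    eapply is_derive_Ceq.
    - apply is_derive_Cminus; [apply HU|]. apply is_derive_Cmult; [|apply is_derive_Cconst].
      apply (is_derive_RtoC (fun s => s) s 1). exact (@is_derive_id R_AbsRing s).
    - cbv beta. ring. }
  replace (t + 1 - t) with 1 in H2 by ring. rewrite Rabs_R1, Rmult_1_r in H2.
  assert (H3 : Cmod (U' t) <= 2 * (2 * (K2 * x)) + Cmod (U (t + 1)) + Cmod (U t)).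
  { replace (U' t) with (- ((U (t + 1)%R - RtoC (t + 1) * U' t) - (U t - RtoC t * U' t)) + U (t + 1)%R + - U t)%C
      by (rewrite RtoC_plus; ring).
    eapply Rle_trans; [apply Cmod_triangle|]. rewrite Cmod_opp. apply Rplus_le_compat_r.
    eapply Rle_trans; [apply Cmod_triangle|]. rewrite Cmod_opp. apply Rplus_le_compat_r, H2. }
  pose proof (HK0 t Ht) as H4. pose proof (HK0 (t + 1) ltac:(lra)) as H5. fold x in H4.
  assert (H6 : K0 * exp (- (Rabs B * (t + 1))) <= K0 * x) by (apply Rmult_le_compat_l; [exact HK0p | apply Hdec; lra]).
  apply Rle_trans with ((4 * K2 + 2 * K0) * x); [lra|].
  apply Rmult_le_compat_l; [lra|]. apply exp_le. pose proof (Rle_abs B). nra.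
Qed.

Lemma super_exp_pcf_deriv (n : nat) : super_exp (V n).
Proof.
  induction n as [n IH] using (well_founded_induction Wf_nat.lt_wf).
  destruct n as [|[|n]]; [apply super_exp_pcf | apply super_exp_pcf' |].
  eapply super_exp_ext; [intros t; symmetry; apply pcf_deriv_rec|].
  apply super_exp_plus; [apply super_exp_plus|].
  - apply super_exp_quadratic, IH; lia.
  - apply super_exp_scal, super_exp_id_mult, IH; lia.
  - apply super_exp_scal, IH; lia.
Qed.

Lemma laplace_pcf_step (n : nat) (lam : C) :
  (lam * laplace (V n) lam = V n 0 + laplace (V (S n)) lam)%C.
Proof.
  apply laplace_by_parts; auto using super_exp_pcf_deriv. apply is_derive_pcf_deriv.
Qed.

(** At the origin the term with the factor [t] drops out, so even and odd orders decouple: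
    [n = 2s + 2] gives the recurrence of [alpha], and [n = 2s + 3] that of [beta]. *)
Lemma pcf_deriv_0_rec (n : nat) :
  (V (S (S n)) 0 = a * V n 0 + RtoC (INR n * (INR n - 1) / 4) * V (n - 2)%nat 0)%C.
Proof.
  unfold V. rewrite pcf_deriv_rec. replace (0 ^ 2 / 4) with 0 by field. ring.
Qed.

Lemma pcf_deriv_even_0 (s : nat) : V (2 * s) 0 = (U 0 * alpha a s)%C.
Proof.
  enough (H : (V (2 * s) 0 = U 0 * fst (alpha_beta 1 a s) /\ V (2 * S s) 0 = U 0 * snd (alpha_beta 1 a s))%C) by apply H.
  induction s as [|s [IH1 IH2]].
  - simpl. unfold V. rewrite pcf_deriv_rec. simpl INR. unfold Rdiv. rewrite !Rmult_0_l.
    change (pcf_deriv a U U' 0) with U. replace (0 ^ 2 * / 4) with 0 by field. split; ring.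
  - cbn [alpha_beta]. destruct (alpha_beta 1 a s) as [g0 g1]. cbn [fst snd] in *. split; [exact IH2|].
    replace (2 * S (S s))%nat with (S (S (2 * S s))) by lia.
    rewrite pcf_deriv_0_rec, IH2. replace (2 * S s - 2)%nat with (2 * s)%nat by lia. rewrite IH1.
    rewrite mult_INR. replace (INR 2 * INR (S s) * (INR 2 * INR (S s) - 1) / 4)
      with (/ 2 * INR (S s) * (2 * INR s + 1)) by (rewrite S_INR; simpl INR; field). ring.
Qed.

Lemma pcf_deriv_odd_0 (s : nat) : V (S (2 * s)) 0 = (U' 0 * beta a s)%C.
Proof.
  enough (H : (V (S (2 * s)) 0 = U' 0 * fst (alpha_beta 3 a s) /\ V (S (2 * S s)) 0 = U' 0 * snd (alpha_beta 3 a s))%C) by apply H.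
  induction s as [|s [IH1 IH2]].
  - simpl. unfold V. rewrite pcf_deriv_rec. simpl INR.
    change (pcf_deriv a U U' 1) with U'. replace (0 ^ 2 / 4) with 0 by field.
    replace (1 * (1 - 1) / 4) with 0 by field. split; ring.
  - cbn [alpha_beta]. destruct (alpha_beta 3 a s) as [g0 g1]. cbn [fst snd] in *. split; [exact IH2|].
    replace (S (2 * S (S s)))%nat with (S (S (S (2 * S s)))) by lia.
    rewrite pcf_deriv_0_rec, IH2. replace (S (2 * S s) - 2)%nat with (S (2 * s))%nat by lia. rewrite IH1.
    rewrite S_INR, mult_INR. replace ((INR 2 * INR (S s) + 1) * (INR 2 * INR (S s) + 1 - 1) / 4)
      with (/ 2 * INR (S s) * (2 * INR s + 3)) by (rewrite S_INR; simpl INR; field). ring.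
Qed.

Lemma laplace_pcf_expansion (lam : C) (N : nat) : lam <> 0 ->
  (laplace U lam - LU_trunc a (U 0) (U' 0) lam N = laplace (V (2 * N)) lam / Cpow lam (2 * N))%C.
Proof.
  intros Hl. induction N as [|N IH].
  - unfold LU_trunc. simpl. change (V 0) with U. field. exact Hl.
  - pose proof (laplace_pcf_step (2 * N) lam) as E0.
    pose proof (laplace_pcf_step (S (2 * N)) lam) as E1.
    rewrite pcf_deriv_even_0 in E0. rewrite pcf_deriv_odd_0 in E1.
    replace (2 * S N)%nat with (S (S (2 * N))) by lia.
    unfold LU_trunc in *. cbn [csum].
    assert (E2 : Cpow lam 2 = (lam * lam)%C) by (simpl; ring). rewrite E2 in *.
    set (A := csum (fun s => alpha a s / Cpow lam (2 * s))%C N) in *.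
    set (B := csum (fun s => beta a s / Cpow lam (2 * s))%C N) in *.
    pose proof (Cpow_nz lam (2 * N) Hl) as Hp. rewrite !Cpow_S. set (p := Cpow lam (2 * N)) in *.
    set (J0 := laplace (V (2 * N)) lam) in *. set (J1 := laplace (V (S (2 * N))) lam) in *.
    set (J2 := laplace (V (S (S (2 * N)))) lam) in *.
    assert (EJ1 : J1 = ((U' 0 * beta a N + J2) / lam)%C) by (rewrite <- E1; field; exact Hl).
    assert (EJ0 : J0 = ((U 0 * alpha a N + J1) / lam)%C) by (rewrite <- E0; field; exact Hl).
    transitivity ((laplace U lam - (U 0 / lam * A + U' 0 / (lam * lam) * B))
       - (U 0 / lam * (alpha a N / p) + U' 0 / (lam * lam) * (beta a N / p)))%C; [ring|].
    rewrite IH, EJ0, EJ1. field. auto.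
Qed.

End Pcf.

(** * Bounds in the sector *)

Lemma exp_ge_1 (x : R) : 0 <= x -> 1 <= exp x.
Proof. intros H. rewrite <- exp_0. apply exp_le, H. Qed.

Lemma is_derive_Cmod_sqr (y : R -> C) (u : R) (l : C) : is_derive y u l ->
  is_derive (fun u => Cmod (y u) ^ 2) u (2 * Re (Cconj (y u) * l)%C).
Proof.
  intros H. pose proof (is_derive_Re _ _ _ H) as H1. pose proof (is_derive_Im _ _ _ H) as H2.
  assert (E : forall v, Re (y v) * Re (y v) + Im (y v) * Im (y v) = Cmod (y v) ^ 2).
  { intros v. rewrite Cmod2_alt. ring. }
  apply (is_derive_ext _ _ _ _ E). eapply is_derive_eq.
  - apply (is_derive_plus (V := R_NormedModule)); apply Derive.is_derive_mult; eassumption.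
  - rewrite re_mult, re_conj, im_conj. cbn. ring.
Qed.

(* A purely imaginary coefficient coupling [y1] and [y2] symmetrically preserves
   [|y1|^2 + |y2|^2]. *)
Lemma oscillator_gronwall (y1 y2 w : R -> C) (om : R -> R) (c L u0 : R) :
  0 <= c -> 0 <= u0 -> 0 <= L ->
  (forall u, is_derive y1 u (Ci * RtoC (om u) * y2 u)%C) ->
  (forall u, is_derive y2 u (Ci * RtoC (om u) * y1 u + w u)%C) ->
  (forall u, - u0 <= u <= u0 -> Cmod (w u) <= c * (L + Cmod (y1 u) + Cmod (y2 u))) ->
  Cmod (y1 u0) ^ 2 <= exp (8 * c * u0) * (Cmod (y1 (- u0)) ^ 2 + Cmod (y2 (- u0)) ^ 2 + L ^ 2).
Proof.
  intros Hc Hu0 HL D1 D2 Hw.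
  (* Including [L ^ 2] makes the bound on [w] homogeneous in the energy, so that
     [exp (-4 c u) * E u] is nonincreasing. The exponent [8 c u0] is [4 c] times the length of the
     interval. *)
  set (E := fun u => Cmod (y1 u) ^ 2 + Cmod (y2 u) ^ 2 + L ^ 2).
  set (E' := fun u => 2 * Re (Cconj (y2 u) * w u)%C).
  assert (DE : forall u, is_derive E u (E' u)).
  { intros u. eapply is_derive_eq.
    - apply (is_derive_plus (V := R_NormedModule)); [|apply @is_derive_const].
      apply (is_derive_plus (V := R_NormedModule)); apply is_derive_Cmod_sqr; auto.
    - unfold E'. destruct (y1 u) as [p1 q1], (y2 u) as [p2 q2], (w u) as [p3 q3]. cbn. ring. }
  assert (BE : forall u, - u0 <= u <= u0 -> E' u <= 4 * c * E u).
  { intros u Hu. unfold E', E. specialize (Hw u Hu).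
    pose proof (Re_le_Cmod (Cconj (y2 u) * w u)) as H1. rewrite Cmod_mult, Cmod_conj in H1.
    pose proof (Cmod_ge_0 (y1 u)) as P1. pose proof (Cmod_ge_0 (y2 u)) as P2.
    set (p := Cmod (y1 u)) in *. set (q := Cmod (y2 u)) in *.
    assert (H2 : q * Cmod (w u) <= q * (c * (L + p + q))) by (apply Rmult_le_compat_l; assumption).
    assert (H3 : 2 * (q * (L + p + q)) <= 4 * (p ^ 2 + q ^ 2 + L ^ 2)).
    { pose proof (pow2_ge_0 (p - q)). pose proof (pow2_ge_0 (L - q)). pose proof (pow2_ge_0 p). pose proof (pow2_ge_0 L). nra. }
    assert (H4 : c * (2 * (q * (L + p + q))) <= c * (4 * (p ^ 2 + q ^ 2 + L ^ 2))) by (apply Rmult_le_compat_l; assumption).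
    lra. }
  destruct (MVT_gen (fun u => exp (- (4 * c * u)) * E u) (- u0) u0
    (fun u => exp (- (4 * c * u)) * (E' u - 4 * c * E u))) as [x [Hx Hmvt]].
  { intros u _.
    assert (De : is_derive (fun u => exp (- (4 * c * u))) u (- (4 * c) * exp (- (4 * c * u))))
      by (auto_derive; trivial; ring).
    eapply is_derive_eq; [apply Derive.is_derive_mult; [exact De | apply DE]|]. cbv beta. ring. }
  { intros u _. apply continuity_pt_mult.
    - apply continuity_pt_filterlim, (ex_derive_continuous (fun u => exp (- (4 * c * u)))). auto_derive; trivial.
    - apply continuity_pt_filterlim, (ex_derive_continuous E). eexists. apply DE. }
  rewrite Rmin_left, Rmax_right in Hx by lra.
  specialize (BE x Hx).
  assert (Hle : exp (- (4 * c * u0)) * E u0 <= exp (- (4 * c * - u0)) * E (- u0)).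
  { cbv beta in Hmvt. pose proof (exp_pos (- (4 * c * x))) as Hpos.
    assert (0 <= exp (- (4 * c * x)) * (4 * c * E x - E' x) * (u0 - - u0))
      by (apply Rmult_le_pos; [apply Rmult_le_pos|]; lra).
    lra. }
  apply Rle_trans with (E u0).
  - unfold E. pose proof (pow2_ge_0 (Cmod (y2 u0))). pose proof (pow2_ge_0 L). lra.
  - change (E u0 <= exp (8 * c * u0) * E (- u0)).
    replace (E u0) with (exp (4 * c * u0) * (exp (- (4 * c * u0)) * E u0)).
    + replace (exp (8 * c * u0) * E (- u0)) with (exp (4 * c * u0) * (exp (- (4 * c * - u0)) * E (- u0))).
      * apply Rmult_le_compat_l; [left; apply exp_pos | exact Hle].
      * rewrite <- Rmult_assoc, <- exp_plus. f_equal. f_equal. ring.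
    + rewrite <- Rmult_assoc, <- exp_plus, Rplus_opp_r, exp_0. ring.
Qed.

(* Along this branch of the hyperbola, [lam^2 = - k^2 - i eps k^2 sinh (2 u)] has constant real
   part, so the factors [exp (lam^2)] and [exp (- lam^2)] of the homogeneous solutions have
   constant modulus. *)
Definition hyperbola (k eps u : R) : C := (- (k * sinh u), eps * (k * cosh u)).
Definition hyperbola' (k eps u : R) : C := (- (k * cosh u), eps * (k * sinh u)).

Lemma cosh2_sinh2 (u : R) : cosh u * cosh u = 1 + sinh u * sinh u.
Proof.
  unfold cosh, sinh.
  assert (exp u * exp (- u) = 1) by (rewrite <- exp_plus, Rplus_opp_r; apply exp_0). nra.
Qed.

Lemma is_derive_hyperbola (k eps u : R) : is_derive (hyperbola k eps) u (hyperbola' k eps u).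
Proof.
  assert (Hs : is_derive sinh u (cosh u)) by apply is_derive_Reals, derivable_pt_lim_sinh.
  assert (Hc : is_derive cosh u (sinh u)) by apply is_derive_Reals, derivable_pt_lim_cosh.
  apply is_derive_C; cbn.
  - apply (is_derive_opp (V := R_NormedModule) (fun u => k * sinh u)). apply is_derive_scal, Hs.
  - do 2 apply is_derive_scal. exact Hc.
Qed.

(** The derivative of [lam^2] along the curve is purely imaginary; it is the coupling coefficient of
    the system solved by the transform. *)
Lemma hyperbola_mul (k eps u : R) : eps * eps = 1 ->
  (2 * hyperbola k eps u * hyperbola' k eps u
   = Ci * RtoC (- 2 * eps * (k * k * (sinh u * sinh u + cosh u * cosh u))))%C.
Proof. intros He. apply Ceq; cbn; [|ring]. ring_simplify. replace (eps ^ 2) with 1 by lra. ring. Qed.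

Lemma Cmod_hyperbola (k eps u : R) : eps * eps = 1 ->
  Cmod (hyperbola k eps u) ^ 2 = k ^ 2 * (1 + 2 * sinh u ^ 2).
Proof.
  intros He. rewrite Cmod2_alt. cbn [hyperbola Re Im fst snd].
  replace ((eps * (k * cosh u)) ^ 2) with ((eps * eps) * (k * k * (cosh u * cosh u))) by ring.
  rewrite He, cosh2_sinh2. ring.
Qed.

Lemma Cmod_hyperbola' (k eps u : R) : eps * eps = 1 ->
  Cmod (hyperbola' k eps u) = Cmod (hyperbola k eps u).
Proof.
  intros He. unfold Cmod. f_equal. cbn [hyperbola hyperbola' fst snd].
  replace ((eps * (k * cosh u)) ^ 2) with ((eps * eps) * (k * cosh u) ^ 2) by ring.
  replace ((eps * (k * sinh u)) ^ 2) with ((eps * eps) * (k * sinh u) ^ 2) by ring.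
  rewrite He. ring.
Qed.

Lemma sinh_le (x y : R) : x <= y -> sinh x <= sinh y.
Proof. intros H. unfold sinh. pose proof (exp_le x y H). pose proof (exp_le (- y) (- x)). lra. Qed.

Lemma sinh_opp (x : R) : sinh (- x) = - sinh x.
Proof. unfold sinh. rewrite Ropp_involutive. field. Qed.

Lemma laplace_right_bound (G : R -> C) : super_exp G ->
  exists K, 0 <= K /\ forall lam, 0 <= Re lam -> Cmod (laplace G lam) <= K.
Proof.
  intros HG. destruct (proj2 HG 1) as [K HK]. exists K. split.
  - specialize (HK 0 (Rle_refl 0)). rewrite Rmult_0_r, Ropp_0, exp_0 in HK. pose proof (Cmod_ge_0 (G 0)). lra.
  - intros lam Hl. apply improper_bound; [intros t; apply continuous_laplace, HG|].
    intros t Ht. rewrite Cmod_mult, Cmod_Cexp, re_opp, re_scal_r.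
    specialize (HK t Ht). rewrite Rmult_1_l in HK.
    assert (exp (- (Re lam * t)) <= 1) by (rewrite <- exp_0; apply exp_le; nra).
    pose proof (Cmod_ge_0 (G t)). pose proof (exp_pos (- (Re lam * t))). nra.
Qed.

Lemma is_derive_Cinv (f : R -> C) (t : R) (l : C) : f t <> 0 ->
  is_derive f t l -> is_derive (fun t => / f t)%C t (- l * / (f t * f t))%C.
Proof.
  intros Hn Hf.
  pose proof (is_derive_Re _ _ _ Hf) as H1. pose proof (is_derive_Im _ _ _ Hf) as H2.
  assert (HN : Re (f t) ^ 2 + Im (f t) ^ 2 <> 0).
  { rewrite <- Cmod2_alt. apply pow_nonzero. apply Rgt_not_eq, Cmod_gt_0, Hn. }
  assert (HD : is_derive (fun t => Re (f t) ^ 2 + Im (f t) ^ 2) t (2 * Re l * Re (f t) + 2 * Im l * Im (f t))).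
  { eapply is_derive_eq.
    - apply (is_derive_plus (V := R_NormedModule)); apply is_derive_pow; eassumption.
    - cbn. ring. }
  assert (El : (- l * / (f t * f t) = - l * (Cconj (f t) * Cconj (f t)) * RtoC (/ (Re (f t) ^ 2 + Im (f t) ^ 2) ^ 2))%C).
  { rewrite RtoC_inv, RtoC_pow, <- Cmod2_alt, Cmod2_conj by (apply pow_nonzero, HN).
    assert (Cconj (f t) <> 0).
    { intros E. apply Hn. rewrite <- (Cconj_conj (f t)), E. apply Ceq; cbn; ring. }
    field. auto. }
  rewrite El. apply is_derive_C.
  - eapply is_derive_eq; [apply (is_derive_div _ _ _ _ _ H1 HD HN)|].
    destruct (f t) as [p q], l as [r s]. cbn in *. field. intros X; apply HN; lra.
  - eapply is_derive_eq; [apply (is_derive_div (fun t => - Im (f t)) _ _ (- Im l) _ (is_derive_opp (V := R_NormedModule) _ _ _ H2) HD HN)|].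
    destruct (f t) as [p q], l as [r s]. cbn in *. field. intros X; apply HN; lra.
Qed.

(** * The equation of the transform and its energy estimate *)

Section Sector.
Variables (a : C) (U U' : R -> C).
Hypothesis HP : is_PCU a U U'.
Variable m : nat.

Let V := pcf_deriv a U U'.
(** An order of at least 2, so that [n - 1] and [n - 2] in the recursion are genuine orders. Below,
    [S1] and [S2] are the first two derivatives of [S0] in [lam], written as Laplace transforms. *)
Let n := S (S m).
Let S0 (lam : C) : C := laplace (V n) lam.
Let S1 (lam : C) : C := laplace (fun t => - (1) * (RtoC t * V n t))%C lam.
Let S2 (lam : C) : C := laplace (fun t => - (1) * (RtoC t * (- (1) * (RtoC t * V n t))))%C lam.

Let V_exp (k : nat) : super_exp (V k) := super_exp_pcf_deriv a U U' HP k.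

(** The Laplace transform of the recursion for [V (S (S n))]: the left side gives [lam^2 S0] minus
    boundary values, and [t^2/4 * V n] gives [S2 / 4]. The boundary value [lam * V n 0] causes the
    term [Cmod lam]; dividing [S1] by [2 lam] makes the later first-order system symmetric. *)
Lemma pcf_second_derivative : exists c, 0 <= c /\ forall lam, 1 <= Cmod lam ->
  Cmod (S2 lam - 4 * lam * lam * S0 lam)%C
  <= c * (Cmod lam + Cmod (S0 lam) + Cmod (S1 lam / (2 * lam))%C).
Proof.
  set (c0 := Cmod (V m 0)). set (c1 := Cmod (V (S m) 0)). set (c2 := Cmod (V n 0)). set (c3 := Cmod (V (S n) 0)).
  set (q1 := INR n). set (q2 := INR n * (INR n - 1)).
  assert (P0 : 0 <= c0) by apply Cmod_ge_0. assert (P1 : 0 <= c1) by apply Cmod_ge_0.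
  assert (P2 : 0 <= c2) by apply Cmod_ge_0. assert (P3 : 0 <= c3) by apply Cmod_ge_0.
  assert (Q1 : 0 <= q1) by apply pos_INR.
  assert (Q2 : 0 <= q2).
  { unfold q2, n. rewrite !S_INR. pose proof (pos_INR m). nra. }
  exists (4 * c2 + 4 * c3 + 4 * Cmod a + 2 * q1 * (c1 + 3) + q2 * (c0 + c1 + 1)). split.
  { pose proof (Cmod_ge_0 a). assert (0 <= q1 * (c1 + 3)) by nra. assert (0 <= q2 * (c0 + c1 + 1)) by nra. lra. }
  intros lam Hlam.
  assert (Nl : lam <> 0) by (apply Cmod_gt_0; lra).
  pose proof (V_exp n) as Xn. pose proof (V_exp (S m)) as Xp. pose proof (V_exp m) as Xq.
  pose proof (super_exp_id_mult _ Xn) as Xtn. pose proof (super_exp_id_mult _ Xp) as Xtp.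
  set (T := laplace (fun t => RtoC t * V (S m) t)%C lam).
  assert (E1 : S1 lam = (- laplace (fun t => RtoC t * V n t) lam)%C).
  { unfold S1. rewrite laplace_scal by exact Xtn. ring. }
  assert (E2 : S2 lam = (4 * (laplace (V (S (S n))) lam - a * S0 lam - RtoC (q1 / 2) * T - RtoC (q2 / 4) * laplace (V m) lam))%C).
  { assert (E : laplace (V (S (S n))) lam =
      (RtoC (/ 4) * S2 lam + a * S0 lam + RtoC (q1 / 2) * T + RtoC (q2 / 4) * laplace (V m) lam)%C).
    { unfold S2, S0, T.
      pose proof (super_exp_scal (- (1))%C _ Xtn) as Y1. pose proof (super_exp_id_mult _ Y1) as Y2.
      pose proof (super_exp_scal (- (1))%C _ Y2) as Y3.
      rewrite <- !laplace_scal by assumption.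
      rewrite <- !laplace_plus by auto using super_exp_plus, super_exp_scal.
      apply laplace_ext; [apply V_exp|]. intros t. unfold V. rewrite pcf_deriv_rec. fold V.
      replace (n - 1)%nat with (S m) by (unfold n; lia). replace (n - 2)%nat with m by (unfold n; lia).
      fold q2; fold q1. replace (t ^ 2 / 4) with (/ 4 * (t * t)) by field. rewrite !RtoC_mult. ring. }
    rewrite E. rewrite RtoC_inv by lra. field. }
  (* [T] carries the order [n - 1]; integrating by parts raises it to [n] and expresses [T] through
     [S1]. *)
  assert (E3 : (lam * T = laplace (V (S m)) lam + - S1 lam)%C).
  { unfold T. rewrite (laplace_by_parts _ (fun t => V (S m) t + RtoC t * V n t)%C).
    - rewrite laplace_plus by assumption. rewrite E1. ring.
    - exact Xtp.
    - apply super_exp_plus; assumption.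
    - intros t. eapply is_derive_Ceq.
      + apply is_derive_Cmult; [|apply (is_derive_pcf_deriv a U U' HP)].
        apply (is_derive_RtoC (fun s => s) t 1). exact (@is_derive_id R_AbsRing t).
      + cbv beta. fold V n. ring. }
  pose proof (laplace_pcf_step a U U' HP m lam) as Lm.
  pose proof (laplace_pcf_step a U U' HP (S m) lam) as Lp.
  pose proof (laplace_pcf_step a U U' HP n lam) as Ln.
  pose proof (laplace_pcf_step a U U' HP (S n) lam) as Ln1.
  fold V n in Lm, Lp, Ln, Ln1. change (laplace (V n) lam) with (S0 lam) in *.
  set (s0 := S0 lam) in *. set (s1 := S1 lam) in *. set (y2 := (s1 / (2 * lam))%C).
  assert (Es1 : s1 = (2 * lam * y2)%C) by (unfold y2; field; exact Nl).
  set (Jp := laplace (V (S m)) lam) in *. set (Jm := laplace (V m) lam) in *.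
  set (l := Cmod lam) in *.
  assert (Hs0 : 0 <= Cmod s0) by apply Cmod_ge_0. assert (Hy2 : 0 <= Cmod y2) by apply Cmod_ge_0.
  assert (Hdiv : forall z w : C, (lam * z = w)%C -> Cmod z <= Cmod w).
  { intros z w Hzw. rewrite <- Hzw, Cmod_mult. fold l. pose proof (Cmod_ge_0 z). nra. }
  assert (B1 : Cmod Jp <= c1 + Cmod s0).
  { eapply Rle_trans; [apply (Hdiv _ _ Lp)|]. apply Cmod_triangle. }
  assert (B2 : Cmod Jm <= c0 + c1 + Cmod s0).
  { eapply Rle_trans; [apply (Hdiv _ _ Lm)|]. eapply Rle_trans; [apply Cmod_triangle|]. fold c0. lra. }
  assert (B3 : Cmod T <= c1 + Cmod s0 + 2 * Cmod y2).
  { assert (ET : T = (Jp / lam + - (2 * y2))%C).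
    { replace T with (lam * T / lam)%C by (field; exact Nl). rewrite E3, Es1. field. exact Nl. }
    rewrite ET. eapply Rle_trans; [apply Cmod_triangle|].
    rewrite Cmod_opp, Cmod_mult, Cmod_R, Rabs_pos_eq by lra.
    assert (Cmod (Jp / lam) <= Cmod Jp) by (apply Hdiv; field; exact Nl). lra. }
  assert (EL : laplace (V (S (S n))) lam = (lam * lam * s0 - lam * V n 0%R - V (S n) 0%R)%C).
  { replace (lam * lam * s0)%C with (lam * (lam * s0))%C by ring. rewrite Ln.
    replace (lam * (V n 0%R + laplace (V (S n)) lam))%C with (lam * V n 0%R + lam * laplace (V (S n)) lam)%C by ring.
    rewrite Ln1. ring. }
  rewrite E2, EL.
  replace (4 * (lam * lam * s0 - lam * V n 0%R - V (S n) 0%R - a * s0 - RtoC (q1 / 2) * T - RtoC (q2 / 4) * Jm) - 4 * lam * lam * s0)%C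
    with (- (4 * (lam * V n 0%R) + 4 * V (S n) 0%R + 4 * (a * s0) + 4 * (RtoC (q1 / 2) * T) + 4 * (RtoC (q2 / 4) * Jm)))%C by ring.
  rewrite Cmod_opp.
  assert (Tri : forall (z w : C) r s, Cmod z <= r -> Cmod w <= s -> Cmod (z + w) <= r + s).
  { intros z w r s Hz Hw. eapply Rle_trans; [apply Cmod_triangle | lra]. }
  assert (Cm : forall (r : R) (z : C) s, 0 <= r -> Cmod z <= s -> Cmod (RtoC r * z) <= r * s).
  { intros r z s Hr Hz. rewrite Cmod_mult, Cmod_R, Rabs_pos_eq by exact Hr. apply Rmult_le_compat_l; assumption. }
  pose proof (Cmod_ge_0 a) as Ha.
  apply Rle_trans with (4 * (l * c2) + 4 * c3 + 4 * (Cmod a * Cmod s0) + 4 * (q1 / 2 * (c1 + Cmod s0 + 2 * Cmod y2))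
     + 4 * (q2 / 4 * (c0 + c1 + Cmod s0))).
  { repeat apply Tri; repeat (apply Cm; [lra|]); try assumption;
      rewrite ?Cmod_mult; unfold l, c2, c3; lra. }
  set (x := Cmod s0) in *. set (y := Cmod y2) in *.
  assert (1 <= l + x + y) by lra. set (g := l + x + y) in *.
  assert (l * c2 <= g * c2) by (apply Rmult_le_compat_r; unfold g; lra).
  assert (1 * c3 <= g * c3) by (apply Rmult_le_compat_r; lra).
  assert (x * Cmod a <= g * Cmod a) by (apply Rmult_le_compat_r; unfold g; lra).
  assert (1 * c1 <= g * c1) by (apply Rmult_le_compat_r; lra).
  assert (1 * c0 <= g * c0) by (apply Rmult_le_compat_r; lra).
  assert (q1 * (c1 + x + 2 * y) <= q1 * ((c1 + 3) * g)) by (apply Rmult_le_compat_l; unfold g in *; lra).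
  assert (q2 * (c0 + c1 + x) <= q2 * ((c0 + c1 + 1) * g)) by (apply Rmult_le_compat_l; unfold g in *; lra).
  lra.
Qed.

(** On the curve [S0] and [S1 / (2 lam)] form an oscillator of real frequency [om], perturbed by
    terms whose size relative to the energy is independent of [k]. The Gronwall factor thus depends
    only on the parameter interval, however far out the hyperbola lies. *)
Lemma laplace_pcf_arc_bound (ub : R) : exists K, 0 <= K /\ forall k eps u0,
  eps * eps = 1 -> 1 <= k -> 0 <= u0 <= ub ->
  Cmod (S0 (hyperbola k eps u0)) <= K * Cmod (hyperbola k eps u0).
Proof.
  pose proof (V_exp n) as Xn. pose proof (super_exp_scal (- (1))%C _ (super_exp_id_mult _ Xn)) as X1.
  destruct pcf_second_derivative as [c [Hc HS2]].
  destruct (laplace_right_bound _ Xn) as [K0 [HK0 HB0]].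
  destruct (laplace_right_bound _ X1) as [K1 [HK1 HB1]].
  (* [Rabs ub] gives [1 <= M] for every [ub]. The energy estimate bounds the square of [S0] by
     [M * L ^ 2], and [1 <= M] turns this into [(M * L) ^ 2]. *)
  set (M := exp (8 * (c + 1) * Rabs ub) * (K0 ^ 2 + K1 ^ 2 + 1)).
  assert (HM : 1 <= M).
  { unfold M. pose proof (pow2_ge_0 K0). pose proof (pow2_ge_0 K1).
    assert (1 <= exp (8 * (c + 1) * Rabs ub)) by (apply exp_ge_1, Rmult_le_pos; [lra | apply Rabs_pos]). rewrite <- (Rmult_1_l 1) at 1. apply Rmult_le_compat; lra. }
  exists M. split; [lra|]. intros k eps u0 He Hk Hu0.
  set (lam := hyperbola k eps).
  assert (Hsq : forall u, Cmod (lam u) ^ 2 = k ^ 2 * (1 + 2 * sinh u ^ 2)) by (intros u; apply Cmod_hyperbola, He).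
  assert (Hge : forall u, 1 <= Cmod (lam u)).
  { intros u. pose proof (Cmod_ge_0 (lam u)). specialize (Hsq u). pose proof (pow2_ge_0 (sinh u)).
    assert (1 <= k ^ 2) by nra. nra. }
  assert (Nl : forall u, lam u <> 0) by (intros u; apply Cmod_gt_0; specialize (Hge u); lra).
  set (L := Cmod (lam u0)).
  assert (HLe : forall u, - u0 <= u <= u0 -> Cmod (lam u) <= L).
  { intros u Hu. apply Rsqr_incr_0_var; [|apply Cmod_ge_0].
    unfold L. rewrite !Rsqr_pow2, !Hsq. apply Rmult_le_compat_l; [apply pow2_ge_0|].
    assert (- sinh u0 <= sinh u <= sinh u0) by (rewrite <- sinh_opp; split; apply sinh_le; lra). nra. }
  set (y1 := fun u => S0 (lam u)). set (y2 := fun u => (S1 (lam u) * / (2 * lam u))%C).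
  (* What remains of the derivative of [y2] after the coupling term. Since [hyperbola'] has the
     modulus of [lam], the leading factor has modulus 1. *)
  set (w := fun u => (hyperbola' k eps u * / lam u *
     (RtoC (/ 2) * (S2 (lam u) - 4 * lam u * lam u * S0 (lam u)) - y2 u))%C).
  set (om := fun u => - 2 * eps * (k * k * (sinh u * sinh u + cosh u * cosh u))).
  assert (Hom : forall u, (Ci * RtoC (om u) = 2 * lam u * hyperbola' k eps u)%C)
    by (intros u; symmetry; apply hyperbola_mul, He).
  pose proof RtoC_2_neq_0 as N2.
  assert (D1 : forall u, is_derive y1 u (Ci * RtoC (om u) * y2 u)%C).
  { intros u. eapply is_derive_Ceq.
    - apply (is_derive_laplace_path (V n)); [exact Xn | apply is_derive_hyperbola].
    - rewrite Hom. unfold y2. fold lam. change (laplace _ (lam u)) with (S1 (lam u)). field. auto. }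
  assert (D2 : forall u, is_derive y2 u (Ci * RtoC (om u) * y1 u + w u)%C).
  { intros u. eapply is_derive_Ceq.
    - apply is_derive_Cmult.
      + apply (is_derive_laplace_path (fun t => - (1) * (RtoC t * V n t))%C); [exact X1 | apply is_derive_hyperbola].
      + apply is_derive_Cinv; [apply Cmult_neq_0; auto|].
        apply is_derive_Cmult; [apply is_derive_Cconst | apply is_derive_hyperbola].
    - rewrite Hom. unfold w, y1, y2. fold lam.
      change (laplace (fun t => - (1) * (RtoC t * (- (1) * (RtoC t * V n t))))%C (lam u)) with (S2 (lam u)).
      rewrite RtoC_inv by lra. field. auto. }
  assert (Bw : forall u, - u0 <= u <= u0 -> Cmod (w u) <= (c + 1) * (L + Cmod (y1 u) + Cmod (y2 u))).
  { intros u Hu. specialize (HS2 (lam u) (Hge u)). specialize (HLe u Hu). specialize (Hge u).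
    unfold w. rewrite Cmod_mult, Cmod_mult, Cmod_inv by apply Nl.
    unfold lam at 1. rewrite <- (Cmod_hyperbola' k eps u He).
    rewrite Rinv_r, Rmult_1_l.
    2: { unfold lam in Hge. rewrite <- (Cmod_hyperbola' k eps u He) in Hge. lra. }
    unfold Cminus at 1. eapply Rle_trans; [apply Cmod_triangle|].
    rewrite Cmod_opp, Cmod_mult, Cmod_R, Rabs_pos_eq by lra.
    change (S1 (lam u) / (2 * lam u))%C with (y2 u) in HS2. change (S0 (lam u)) with (y1 u) in *.
    pose proof (Cmod_ge_0 (y1 u)). pose proof (Cmod_ge_0 (y2 u)).
    assert (c * (Cmod (lam u) + Cmod (y1 u) + Cmod (y2 u)) <= c * (L + Cmod (y1 u) + Cmod (y2 u)))
      by (apply Rmult_le_compat_l; lra).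
    assert (0 <= c * (L + Cmod (y1 u) + Cmod (y2 u))) by (apply Rmult_le_pos; lra). lra. }
  assert (HG := oscillator_gronwall y1 y2 w om (c + 1) L u0).
  specialize (HG ltac:(lra) ltac:(lra) (Cmod_ge_0 _) D1 D2 Bw).
  (* The arc starts at the mirror image of its end point, in the right half-plane, where both
     transforms are bounded. *)
  assert (Hre : 0 <= Re (lam (- u0))).
  { unfold lam, hyperbola. cbn [Re fst]. rewrite sinh_opp.
    assert (sinh 0 <= sinh u0) by (apply sinh_le; lra). rewrite sinh_0 in *. nra. }
  assert (I1 : Cmod (y1 (- u0)) <= K0) by (apply HB0, Hre).
  assert (I2 : Cmod (y2 (- u0)) <= K1).
  { unfold y2. pose proof (HB1 _ Hre) as H1. fold (S1 (lam (- u0))) in H1.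
    specialize (Hge (- u0)).
    rewrite Cmod_mult, Cmod_inv by (apply Cmult_neq_0; auto).
    rewrite Cmod_mult, Cmod_R, Rabs_pos_eq by lra.
    assert (/ (2 * Cmod (lam (- u0))) <= 1) by (apply Rle_trans with (/ 1); [apply Rinv_le_contravar|]; lra).
    assert (0 < / (2 * Cmod (lam (- u0)))) by (apply Rinv_0_lt_compat; lra).
    pose proof (Cmod_ge_0 (S1 (lam (- u0)))). nra. }
  assert (HL1 : 1 <= L) by apply Hge.
  apply Rsqr_incr_0_var; [|apply Rmult_le_pos; lra].
  change (Rsqr (Cmod (y1 u0)) <= Rsqr (M * L)). rewrite !Rsqr_pow2.
  eapply Rle_trans; [exact HG|].
  apply Rle_trans with (M * L ^ 2).
  - unfold M. rewrite (Rmult_assoc (exp _)). apply Rmult_le_compat.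
    + left; apply exp_pos.
    + pose proof (pow2_ge_0 (Cmod (y1 (- u0)))). pose proof (pow2_ge_0 (Cmod (y2 (- u0)))). pose proof (pow2_ge_0 L). lra.
    + apply exp_le. apply Rmult_le_compat_l; [lra|]. pose proof (Rle_abs ub). lra.
    + assert (Cmod (y1 (- u0)) ^ 2 <= K0 ^ 2) by (apply pow_incr; split; [apply Cmod_ge_0 | exact I1]).
      assert (Cmod (y2 (- u0)) ^ 2 <= K1 ^ 2) by (apply pow_incr; split; [apply Cmod_ge_0 | exact I2]).
      assert (1 <= L ^ 2) by nra. pose proof (pow2_ge_0 K0). pose proof (pow2_ge_0 K1). nra.
  - pose proof (pow2_ge_0 L). rewrite Rpow_mult_distr. apply Rmult_le_compat_r; [assumption|]. nra.
Qed.

(** The last expression is [- Re (lam^2) / Cmod lam ^ 2], equal to [cos (2 |th| - PI)] with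
    [2 |th| - PI] between 0 and [PI/2 - 2 d]. *)
Lemma sector_angle (d th : R) : 0 < d -> Rabs th <= 3 * PI / 4 - d -> cos th < 0 ->
  0 < sin (2 * d) <= sin th * sin th - cos th * cos th.
Proof.
  intros Hd Hth Hc. pose proof PI_RGT_0 as HPI.
  assert (E : cos th = cos (Rabs th)) by (unfold Rabs; destruct (Rcase_abs th); [rewrite cos_neg|]; reflexivity).
  set (x := Rabs th) in *. assert (Hx0 : 0 <= x) by apply Rabs_pos.
  assert (Hx : PI / 2 < x).
  { apply Rnot_le_lt. intros Hx. rewrite E in Hc. pose proof (cos_ge_0 x). lra. }
  assert (Hcos : sin th * sin th - cos th * cos th = cos (2 * x - PI)).
  { rewrite cos_minus, cos_PI, sin_PI, cos_2a, <- E.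
    pose proof (sin2_cos2 th) as H1. pose proof (sin2_cos2 x) as H2. rewrite <- E in H2.
    unfold Rsqr in *. lra. }
  rewrite Hcos. split.
  - apply sin_gt_0; lra.
  - rewrite <- cos_shift. apply cos_decr_1; lra.
Qed.

Lemma laplace_pcf_sector_bound (d : R) : 0 < d -> exists K r, 1 <= r /\ forall lam,
  in_sector (3 * PI / 4 - d) lam -> r <= Cmod lam -> Cmod (S0 lam) <= K * Cmod lam.
Proof.
  intros Hd.
  destruct (laplace_right_bound _ (V_exp n)) as [K0 [HK0 HB0]].
  (* The sign of [sg] is still unknown, as [d] may be large; it is positive as soon as the sector
     contains a point with [Re lam < 0]. *)
  set (sg := sin (2 * d)).
  destruct (laplace_pcf_arc_bound (arcsinh (/ sg + 1))) as [K [HK HB]].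
  (* This radius gives [sg * Cmod lam ^ 2 >= 1], hence [1 <= k]. Likewise [/ sg + 1] in the
     parameter bound is a crude majorant of the square root of [/ sg]. *)
  exists (K0 + K), (Rmax 1 (/ sg + 1)). split; [apply Rmax_l|].
  intros lam [Nl [th [Hth El]]] Hr.
  pose proof (Rmax_l 1 (/ sg + 1)) as R1. pose proof (Rmax_r 1 (/ sg + 1)) as R2.
  set (l := Cmod lam) in *. assert (Hl : 1 <= l) by lra.
  destruct (Rle_lt_dec 0 (Re lam)) as [Hre|Hre].
  { specialize (HB0 lam Hre). change (laplace (V n) lam) with (S0 lam) in HB0. nra. }
  assert (HRe : Re lam = l * cos th) by (rewrite El; reflexivity).
  assert (HIm : Im lam = l * sin th) by (rewrite El; reflexivity).
  assert (Hc : cos th < 0) by nra.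
  destruct (sector_angle d th Hd Hth Hc) as [Hs0 Hs1]. fold sg in Hs0, Hs1.
  assert (Hsg1 : sg <= 1) by (apply SIN_bound).
  assert (Hi : 0 < / sg) by (apply Rinv_0_lt_compat; exact Hs0).
  assert (Hii : sg * / sg = 1) by (apply Rinv_r; lra).
  (* [h = - Re (lam^2)] selects the hyperbola through [k], the sign of [Im lam] selects the branch
     [eps], and [- Re lam / k] is the [sinh] of the parameter. *)
  set (h := Im lam * Im lam - Re lam * Re lam).
  assert (Hh : sg * (l * l) <= h).
  { unfold h. rewrite HRe, HIm. assert (0 <= l * l) by nra. nra. }
  assert (Hh1 : 1 <= h).
  { apply Rle_trans with (sg * ((/ sg + 1) * (/ sg + 1))).
    - nra.
    - eapply Rle_trans; [|exact Hh]. apply Rmult_le_compat_l; [lra|]. nra. }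
  set (k := sqrt h). assert (Hkk : k * k = h) by (apply sqrt_sqrt; lra).
  assert (Hk : 1 <= k) by (unfold k; rewrite <- sqrt_1; apply sqrt_le_1_alt, Hh1).
  set (eps := if Rle_lt_dec 0 (Im lam) then 1 else -1).
  assert (Heps : eps * eps = 1 /\ eps * Im lam = Rabs (Im lam)).
  { unfold eps. destruct (Rle_lt_dec 0 (Im lam)).
    - rewrite Rabs_pos_eq by assumption. lra.
    - rewrite Rabs_left by assumption. lra. }
  destruct Heps as [He HeI].
  set (x := - Re lam / k). set (u0 := arcsinh x).
  assert (Hx0 : 0 <= x) by (apply Rmult_le_pos; [lra | left; apply Rinv_0_lt_compat; lra]).
  assert (Hxk : k * x = - Re lam) by (unfold x; field; lra).
  assert (Hx1 : x <= / sg + 1).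
  { assert (HRl : - Re lam <= l) by (pose proof (re_le_Cmod lam) as H; apply Rabs_le_between in H; fold l in H; lra).
    assert (x * x <= / sg).
    { apply (Rmult_le_reg_l (k * k)); [nra|].
      replace (k * k * (x * x)) with (k * x * (k * x)) by ring. rewrite Hxk, Hkk.
      apply Rle_trans with (l * l); [nra|].
      apply Rle_trans with (sg * (l * l) * / sg); [apply Req_le; field; lra|].
      apply Rmult_le_compat_r; lra. }
    nra. }
  assert (Hsh : sinh u0 = x) by apply sinh_arcsinh.
  assert (Hu0 : 0 <= u0 <= arcsinh (/ sg + 1)).
  { split; [rewrite <- arcsinh_0|]; apply arcsinh_le; lra. }
  assert (Elam : lam = hyperbola k eps u0).
  { apply Ceq; cbn [hyperbola Re Im fst snd]; change (fst lam) with (Re lam); change (snd lam) with (Im lam).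
    - rewrite Hsh, Hxk. ring.
    - assert (Hcosh : k * cosh u0 = Rabs (Im lam)).
      { assert (0 <= cosh u0) by (unfold cosh; pose proof (exp_pos u0); pose proof (exp_pos (- u0)); lra).
        rewrite <- (Rabs_pos_eq (k * cosh u0)) by nra. apply Rsqr_eq_abs_0. unfold Rsqr.
        replace (k * cosh u0 * (k * cosh u0)) with (k * k * (cosh u0 * cosh u0)) by ring.
        rewrite cosh2_sinh2, Hsh.
        replace (k * k * (1 + x * x)) with (k * k + k * x * (k * x)) by ring. rewrite Hxk, Hkk. unfold h. ring. }
      rewrite Hcosh, <- HeI, <- Rmult_assoc, He. ring. }
  specialize (HB k eps u0 He Hk Hu0). rewrite <- Elam in HB. fold l in HB.
  assert (0 <= K0 * l) by nra. lra.
Qed.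

End Sector.

Theorem theorem5p1 (a : C) (U U' : R -> C) (delta : R) :
  is_PCU a U U' -> 0 < delta ->
  (* U(a,0) = sqrt(pi) / (2^(a/2+1/4) Gamma(a/2+3/4)) *)
  U 0 = (RtoC (sqrt PI) * Rcpow 2 (- (a / RtoC 2 + RtoC (1/4)))
           * rgamma (a / RtoC 2 + RtoC (3/4)))%C /\
  (* U'(a,0) = - sqrt(pi) / (2^(a/2-1/4) Gamma(a/2+1/4)) *)
  U' 0 = (- (RtoC (sqrt PI) * Rcpow 2 (- (a / RtoC 2 - RtoC (1/4)))
           * rgamma (a / RtoC 2 + RtoC (1/4))))%C /\
  (* Poincare asymptotic expansion, uniform in |arg lambda| <= 3pi/4 - delta *)
  (forall N : nat, exists K Rr : R,
     forall lam : C,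
       in_sector (3 * PI / 4 - delta) lam -> Rr <= Cmod lam ->
       Cmod (LU U lam - LU_trunc a (U 0) (U' 0) lam N)%C
         <= K / Cmod lam ^ (2 * N + 1)).
Proof.
  intros HP Hd. split; [exact (pcf_at_0 a U U' HP)|]. split; [exact (pcf_derive_at_0 a U U' HP)|].
  intros N.
  (* With [m = 2 N] the bound concerns the derivative of order [2 N + 2]. *)
  destruct (laplace_pcf_sector_bound a U U' HP (2 * N) delta Hd) as (K & r & Hr & HB).
  set (c0 := pcf_deriv a U U' (2 * N) 0). set (c1 := pcf_deriv a U U' (S (2 * N)) 0).
  exists (Cmod c0 + Cmod c1 + K), r. intros lam Hs Hl.
  assert (H1 : 1 <= Cmod lam) by lra.
  assert (Nl : lam <> 0) by (apply Cmod_gt_0; lra).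
  specialize (HB lam Hs Hl).
  change (LU U lam) with (laplace U lam).
  rewrite (laplace_pcf_expansion a U U' HP lam N Nl).
  pose proof (laplace_pcf_step a U U' HP (2 * N) lam) as E0.
  pose proof (laplace_pcf_step a U U' HP (S (2 * N)) lam) as E1.
  fold c0 in E0. fold c1 in E1.
  set (J0 := laplace (pcf_deriv a U U' (2 * N)) lam) in *.
  set (J1 := laplace (pcf_deriv a U U' (S (2 * N))) lam) in *.
  set (J2 := laplace (pcf_deriv a U U' (S (S (2 * N)))) lam) in *.
  set (l := Cmod lam) in *.
  (* [J2] grows at most like [l], so [J1] is bounded, and then so is [l * J0]. This gains the one
     power of [lam] that brings the remainder to the order of the first omitted term. *)
  assert (B : l * Cmod J0 <= Cmod c0 + Cmod c1 + K).
  { unfold l. rewrite <- Cmod_mult, E0.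
    eapply Rle_trans; [apply Cmod_triangle|].
    assert (l * Cmod J1 <= l * (Cmod c1 + K)).
    { unfold l at 1. rewrite <- Cmod_mult, E1. eapply Rle_trans; [apply Cmod_triangle|].
      pose proof (Cmod_ge_0 c1). nra. }
    assert (Cmod J1 <= Cmod c1 + K) by (apply (Rmult_le_reg_l l); lra). lra. }
  rewrite Cmod_div, Cmod_pow by (apply Cpow_nz, Nl). fold l.
  replace (2 * N + 1)%nat with (S (2 * N)) by lia. cbn [pow].
  assert (Hp : 0 < l ^ (2 * N)) by (apply pow_lt; lra).
  replace (Cmod J0 / l ^ (2 * N)) with (l * Cmod J0 / (l * l ^ (2 * N))) by (field; split; lra).
  apply Rmult_le_compat_r; [left; apply Rinv_0_lt_compat, Rmult_lt_0_compat; lra | exact B].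
Qed.
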